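(* Let $q\ge 3$ and $p=2q+1$ both be prime, and write $q-1=2^r s$ with $r\geq 1$ and $s$ odd. Let $\sigma_0(s)$ be the number of positive divisors of $s$. There are in total $(6r+4)\sigma_0(s)+2$ isomorphism types of permutation groups $G$ of degree $pq$ which are realised by a Hopf-Galois structure of cyclic type (that is, of type $C_{pq}$). These include the two regular groups, i.e. the cyclic and the non-abelian groups of order $pq$, for which the corresponding Galois extensions have $1$ and $p$ Hopf-Galois structures of cyclic type respectively. For all the remaining groups $G$, any field extension $L/K$ realising $G$ is almost classically Galois and admits a unique Hopf-Galois structure of cyclic type.
   Context: All permutation groups are finite and transitive. A permutation group of degree $n$ is a group $G$ with an injective homomorphism $G\to\mathrm{Perm}(X)$, $|X|=n$; up to isomorphism it is $G$ acting by left multiplication $\lambda$ on $X=G/G'$, where $G'$ (the stabiliser of a point) is a subgroup of index $n$ with trivial core. Two permutation groups are isomorphic (as permutation groups) if there is a group isomorphism between them taking a point stabiliser to a point stabiliser. Let $L/K$ be a finite separable field extension with normal closure $E$. A Hopf-Galois structure on $L/K$ consists of a cocommutative $K$-Hopf algebra $H$ together with an action of $H$ on $L$ making $L$ an $H$-module algebra such that the $K$-linear map $L\otimes_K H\to \mathrm{End}_K(L)$, $x\otimes h\mapsto (y\mapsto x(h\cdot y))$, is bijective. By the theorem of Greither and Pareigis, with $\Gamma=\mathrm{Gal}(E/K)$, $\Gamma'=\mathrm{Gal}(E/L)$, $X=\Gamma/\Gamma'$, the Hopf-Galois structures on $L/K$ correspond bijectively to the regular subgroups $N$ of $\mathrm{Perm}(X)$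 normalised by $\lambda(\Gamma)$; the isomorphism class of $N$ (a group of order $[L:K]$) is called the type of the structure. A separable extension $L/K$ realises the permutation group $G$ (with point stabiliser $G'$) if there is an isomorphism $G\to\mathrm{Gal}(E/K)$ taking $G'$ to $\mathrm{Gal}(E/L)$. $G$ is realised by a Hopf-Galois structure of type $N$ if an extension $L/K$ realising $G$ admits a Hopf-Galois structure of type $N$; this and the number of such structures depend only on $G$ as a permutation group. $L/K$ is almost classically Galois if $\mathrm{Gal}(E/L)$ has a normal complement in $\mathrm{Gal}(E/K)$. *)

(* Defs.v *)
(* Mathematical Components; no classical axioms are needed. *)
From HB Require Import structures.
From mathcomp Require Import all_boot all_order all_fingroup all_algebra.
From mathcomp Require Import all_solvable all_field.

Set Implicit Arguments.
Unset Strict Implicit.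
Unset Printing Implicit Defensive.

Import GRing.Theory GroupScope.
Local Open Scope ring_scope.

(* For an equivalence relation R: up to R, exactly k objects satisfy P. *)
Definition num_classes (T : Type) (R : T -> T -> Prop) (P : T -> Prop)
    (k : nat) : Prop :=
  exists x : 'I_k -> T,
    [/\ forall i, P (x i),
        forall i j, R (x i) (x j) -> i = j
      & forall y, P y -> exists i, R y (x i)].

(* Permutation groups of degree n are taken to be transitive subgroups of 'S_n,
   the stabiliser of x being 'C_G[x | 'P]. Products of permutations, and of
   Galois automorphisms below, are in diagrammatic order: (s * t) x = t (s x).
   Hence left cosets for functional composition are right cosets here, and left
   translations are right translations; as inversion is an isomorphism onto the
   opposite group preserving each subgroup, isomorphism is not affected. *)

Definition perm_transitive (n : nat) (G : {group 'S_n}) : Prop :=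
  [transitive G, on [set: 'I_n] | 'P].

Definition perm_iso (n : nat) (G1 G2 : {group 'S_n}) : Prop :=
  exists (x y : 'I_n) (f : {morphism G1 >-> 'S_n}),
    isom G1 G2 f /\ f @* 'C_G1[x | 'P] = 'C_G2[y | 'P].

(* A regular subgroup of Perm(X), with Perm(X) seen as the permutations of the
   ambient type T that are supported on X. *)
Definition regular_on (T : finType) (X : {set T}) (N : {group {perm T}}) :
    Prop :=
  [/\ {in N, forall eta, perm_on X eta}, [transitive N, on X | 'P]
    & forall x, x \in X -> 'C_N[x | 'P] = 1%g].

(* U (x) V, the coordinates being those on the basis e_i (x) f_j, for e and f
   the canonical bases of U and V. *)
Definition tensor (K : fieldType) (U V : vectType K) : vectType K :=
  'M[K]_(\dim {:U}, \dim {:V}).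

Definition tens (K : fieldType) (U V : vectType K) (u : U) (v : V) :
    tensor U V :=
  \matrix_(i, j) (coord (vbasis {:U}) i u * coord (vbasis {:V}) j v).

(* The linear map on U (x) V induced by a map b : U -> V -> W, which is only
   meaningful for bilinear b. In Sweedler notation, tlift b (Delta h) is the sum
   of the b h_(1) h_(2). *)
Definition tlift (K : fieldType) (U V W : vectType K) (b : U -> V -> W)
    (t : tensor U V) : W :=
  \sum_i \sum_j (t : 'M_(_, _)) i j *: b (vbasis {:U})`_i (vbasis {:V})`_j.

Lemma tlift_tens (K : fieldType) (U V W : vectType K) (b : U -> V -> W) u v :
  (forall v, linear (b^~ v)) -> (forall u, linear (b u)) ->
  tlift b (tens u v) = b u v.
Proof.
move=> bl br.
pose bv v : {linear U -> W} :=
  HB.pack (b^~ v) (GRing.isLinear.Build K U W *:%R (b^~ v) (bl v)).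
pose bu u : {linear V -> W} :=
  HB.pack (b u) (GRing.isLinear.Build K V W *:%R (b u) (br u)).
rewrite {2}(coord_vbasis (memvf u)) -[b _ v]/(bv v _) linear_sum.
apply: eq_bigr => i _; rewrite linearZ /= -[b _ v]/(bu _ v).
rewrite {2}(coord_vbasis (memvf v)) linear_sum scaler_sumr.
by apply: eq_bigr => j _; rewrite linearZ /= scalerA mxE.
Qed.

(* Finite dimension is no restriction: it is forced by the bijection in
   hopf_galois below, where L / K is finite. *)
Record hopf_algebra (K : fieldType) := HopfAlgebra {
  hopf_carrier :> falgType K;
  comul : 'Hom(hopf_carrier, tensor hopf_carrier hopf_carrier);
  counit : 'Hom(hopf_carrier, K^o);
  antipode : 'End(hopf_carrier);
  comul_assoc : forall h,
    tlift (fun a b => tens a (comul b)) (comul h)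
    = tlift (fun a b => tlift (fun c d => tens c (tens d b)) (comul a))
        (comul h);
  counit_l : forall h, tlift (fun a b => counit a *: b) (comul h) = h;
  counit_r : forall h, tlift (fun a b => counit b *: a) (comul h) = h;
  comul_one : comul 1 = tens 1 1;
  comul_mul : forall h k,
    comul (h * k)
    = tlift (fun a b => tlift (fun c d => tens (a * c) (b * d)) (comul k))
        (comul h);
  counit_one : counit 1 = 1;
  counit_mul : forall h k, counit (h * k) = counit h * counit k;
  antipode_l : forall h, tlift (fun a b => antipode a * b) (comul h)
                         = (counit h)%:A;
  antipode_r : forall h, tlift (fun a b => a * antipode b) (comul h)
                         = (counit h)%:A
}.

Arguments comul {K _}.
Arguments counit {K _}.
Arguments antipode {K _}.

Definition cocommutative (K : fieldType) (H : hopf_algebra K) : Prop :=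
  forall h : H, tlift (fun a b => tens b a) (comul h) = comul h.

Record hopf_galois (K : fieldType) (L : fieldExtType K) := HopfGalois {
  hg_alg :> hopf_algebra K;
  hg_act : 'Hom(hg_alg, 'End(L));
  hg_cocommutative : cocommutative hg_alg;
  hg_act1 : forall x, hg_act 1 x = x;
  hg_actM : forall (h k : hg_alg) x, hg_act (h * k) x = hg_act h (hg_act k x);
  hg_act_one : forall h : hg_alg, hg_act h 1 = (counit h)%:A;
  hg_act_mul : forall (h : hg_alg) x y,
    hg_act h (x * y) = tlift (fun a b => hg_act a x * hg_act b y) (comul h);
  hg_bij : bijective (fun t : tensor L hg_alg =>
    tlift (fun (x : L) (h : hg_alg) =>
             linfun (fun y : L => x * hg_act h y)) t : 'End(L))
}.

Arguments hg_act {K L _}.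

(* Isomorphisms of Hopf algebras compatible with the actions on L; the
   Hopf-Galois structures on L are counted up to such isomorphisms. *)
Definition hg_iso (K : fieldType) (L : fieldExtType K) (S1 S2 : hopf_galois L) :
    Prop :=
  exists f : 'Hom(S1, S2),
    [/\ bijective f,
        f 1 = 1 /\ (forall h k, f (h * k) = f h * f k),
        (forall h, tlift (fun a b => tens (f a) (f b)) (comul h)
                   = comul (f h))
          /\ (forall h, counit (f h) = counit h),
        forall h, f (antipode h) = antipode (f h)
      & forall h x, hg_act (f h) x = hg_act h x].

(* Every finite extension of K is, up to isomorphism, a subfield L of some
   splitting field E over K, in which K is 1%AS. *)
Definition normal_closure (K : fieldType) (E : splittingFieldType K)
    (L : {subfield E}) : Prop :=
  forall M : {subfield E},
    (L <= M)%VS -> normalField 1%AS M -> (M : {vspace E}) = {:E}%VS.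

Definition sep_ext (K : fieldType) (E : splittingFieldType K)
    (L : {subfield E}) : Prop :=
  separable 1%AS L /\ normal_closure L.

Definition Gamma (K : fieldType) (E : splittingFieldType K) :
    {group gal_of {:E}} := 'Gal({:E} / 1%AS)%G.

Definition Gamma' (K : fieldType) (E : splittingFieldType K)
    (L : {subfield E}) : {group gal_of {:E}} := 'Gal({:E} / L)%G.

Definition gal_cosets (K : fieldType) (E : splittingFieldType K)
    (L : {subfield E}) : {set {set gal_of {:E}}} :=
  rcosets (Gamma' L) (Gamma E).

Definition gal_lambda (K : fieldType) (E : splittingFieldType K)
    (L : {subfield E}) (g : gal_of {:E}) : {perm {set gal_of {:E}}} :=
  restr_perm (gal_cosets L) (actperm 'Rs g).

Definition realises (n : nat) (K : fieldType) (E : splittingFieldType K)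
    (L : {subfield E}) (G : {group 'S_n}) : Prop :=
  sep_ext L /\
  exists (x : 'I_n) (f : {morphism G >-> gal_of {:E}}),
    isom G (Gamma E) f /\ f @* 'C_G[x | 'P] = Gamma' L.

Definition almost_classically_galois (K : fieldType)
    (E : splittingFieldType K) (L : {subfield E}) : Prop :=
  exists C : {group gal_of {:E}},
    C <| Gamma E /\ C \in [complements to Gamma' L in Gamma E].

Definition gp_subgroup (K : fieldType) (E : splittingFieldType K)
    (L : {subfield E}) (N : {group {perm {set gal_of {:E}}}}) : Prop :=
  regular_on (gal_cosets L) N /\
  forall g, g \in Gamma E -> gal_lambda L g \in 'N(N).

(* An element sum_eta (c_eta eta) of E[N] is given by its coefficients,
   extended by 0 outside N. It is fixed under the action of Gamma on E by
   evaluation and on N by conjugation through lambda. *)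
Definition gp_fixed (K : fieldType) (E : splittingFieldType K)
    (L : {subfield E}) (N : {group {perm {set gal_of {:E}}}})
    (c : {perm {set gal_of {:E}}} -> E) : Prop :=
  (forall eta, eta \notin N -> c eta = 0) /\
  forall g eta, g \in Gamma E -> eta \in N ->
    c (eta ^ gal_lambda L g)%g = g (c eta).

(* S is the Hopf-Galois structure attached to N by Greither and Pareigis: the
   Hopf algebra E[N]^Gamma, with sum_eta (c_eta eta) acting on L by
   x |-> sum_eta c_eta (eta^-1 (1 Gamma'))(x), where a coset is evaluated on L
   at any of its elements. Here theta is the isomorphism of S onto E[N]^Gamma,
   and theta h eta is the coefficient of eta in theta h. *)
Definition gp_corresponds (K : fieldType) (E : splittingFieldType K)
    (L : {subfield E}) (S : hopf_galois (subvs_of L))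
    (N : {group {perm {set gal_of {:E}}}}) : Prop :=
  exists theta : S -> {perm {set gal_of {:E}}} -> E,
    [/\ forall eta, linear (theta^~ eta),
        (forall h, gp_fixed L N (theta h))
          /\ (forall c, gp_fixed L N c -> exists! h, theta h =1 c),
        (forall eta, theta 1 eta = (eta == 1%g)%:R)
          /\ (forall h k eta, theta (h * k) eta =
                \sum_(s in N) \sum_(t in N | (t * s)%g == eta)
                  theta h s * theta k t),
        [/\ forall h s t,
              tlift (fun a b => theta a s * theta b t) (comul h)
              = if s == t then theta h s else 0,
            forall h, \sum_(eta in N) theta h eta = (counit h : K) *: (1 : E)
          & forall h eta, theta (antipode h) eta = theta h (eta^-1)%g]
      & forall h (x : subvs_of L),
          vsval (hg_act h x)
          = \sum_(eta in N)
              theta h eta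
              * (repr ((eta^-1)%g (Gamma' L : {set _})) : gal_of {:E})
                  (vsval x)].

Definition hg_type (K : fieldType) (E : splittingFieldType K)
    (L : {subfield E}) (gT : finGroupType) (M : {group gT})
    (S : hopf_galois (subvs_of L)) : Prop :=
  exists N : {group {perm {set gal_of {:E}}}},
    [/\ gp_subgroup L N, gp_corresponds S N & N \isog M].

(* L / K has exactly k Hopf-Galois structures of type M. *)
Definition num_hopf_galois (K : fieldType) (E : splittingFieldType K)
    (L : {subfield E}) (gT : finGroupType) (M : {group gT}) (k : nat) : Prop :=
  num_classes (@hg_iso K (subvs_of L)) (@hg_type K E L gT M) k.

Definition realised_by_type (n : nat) (gT : finGroupType) (M : {group gT})
    (G : {group 'S_n}) : Prop :=
  perm_transitive G /\
  exists (K : fieldType) (E : splittingFieldType K) (L : {subfield E}),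
    realises L G /\ exists S : hopf_galois (subvs_of L), hg_type M S.

Arguments realised_by_type n {gT} M G.

(* The cyclic group of order n, for n > 0. *)
Definition cyclic_group (n : nat) : {group 'Z_n} := Zp_group n.

(* Main.v *)
Require Import Defs.
From HB Require Import structures.
From mathcomp Require Import all_boot all_order all_fingroup all_algebra.
From mathcomp Require Import all_solvable all_field.
From mathcomp Require Import zify ring.
From mathcomp.multinomials Require mpoly.

(** Two reductions turn the theorem into one on subgroups of the symmetric
    group of degree n = p q.

    The first is the correspondence of Greither and Pareigis, in the form
    [num_hopf_galois_card]: the structures of a given type on L / K are counted
    by the regular subgroups of that type normalised by lambda (Gamma). The
    K-Hopf algebra attached to N consists of the fixed points of Gamma in the
    group algebra E[N]. Galois descent ([th_free], [th_span]) shows that a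
    K-basis of it is an E-basis of E[N], so that the comultiplication, which is
    diagonal on E[N], descends, and the axioms can be checked in E[N]. That
    L (x) H fills End_K(L) is the independence of the embeddings of L in E,
    which also recovers N from the structure ([gp_corresponds_inj]). If G acts on
    n points and is realised by L / K, the subgroups in question are the regular
    cyclic subgroups of 'S_n normalised by G, which form the set [cyc_norm G].

    The second reduction is that each G is a Galois group
    ([galois_realisation]): 'S_n acts faithfully on the rational functions in n
    variables. Hence G is realised in the cyclic type if and only if [cyc_norm G]
    is not empty.

    There remains the group theory. Fix a regular cyclic N = P x Q with |P| = p
    and |Q| = q, and let H be its normaliser, so that H / N is Aut N, that is
    C_2q x C_(q - 1). Isomorphism of transitive groups is conjugacy in 'S_n, and
    regular cyclic groups are conjugate, so it suffices to consider the
    transitive G inside H. The essential point is that a regular cyclic group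
    which normalises another one is equal to it ([reg_cyc_norm_eq]). Moreover P,
    the normal Sylow p-subgroup of H, lies in G.

    If Q lies in G, then so does N, and [cyc_norm G] is reduced to N. These groups
    correspond to the subgroups of H / N, are pairwise not conjugate because H / N
    is abelian, and number (6 r + 4) sigma_0(s) ([card_between_holo]).

    Otherwise G meets Q trivially, and the crucial fact is that it centralises Q
    ([avoid_q_cent]). Then G / P embeds in Aut P, so that |G| is p q or 2 p q, and
    there is exactly one group of each order up to isomorphism
    ([avoid_q_perm_iso], [avoid_q_exists]); this accounts for the term 2. The
    members of [cyc_norm G] are the products of P with the Sylow q-subgroups of
    the centraliser of G: there is one if |G| = 2 p q, whereas there are p if
    |G| = p q, which is the case of the regular non-abelian group. *)
Set Implicit Arguments.
Unset Strict Implicit.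
Unset Printing Implicit Defensive.

Import GRing.Theory GroupScope.
Local Open Scope ring_scope.

(** * Dual elements for the Galois automorphisms *)

Section GaloisDescent.

Variables (K : fieldType) (E : splittingFieldType K).
Local Notation gT := (gal_of {:E}).

Lemma mem_Gamma (g : gT) : g \in Gamma E.
Proof. by rewrite gal_kHom ?sub1v // k1AHom. Qed.

Lemma galMx (g h : gT) x : (g * h)%g x = h (g x).
Proof. by rewrite galM ?memvf. Qed.

Lemma gal_neqP (g h : gT) : g != h -> exists z, g z != h z.
Proof.
move=> /gal_eqP/eqlfun_inP/subvPn[a _].
by rewrite memv_ker !lfun_simp subr_eq0; exists a.
Qed.

(** The functions of g of the form sum_i a_i g(b_i) are closed under products.
    For each g0 other than the identity one of them is 1 at the identity and 0
    at g0, so their product over g0 is the one required. Such a family of pairs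
    plays the part of a basis with its dual basis for the trace, and descent
    rests on it. *)
Lemma gal_dual : exists s : seq (E * E),
  forall g : gT, \sum_(ab <- s) ab.1 * g ab.2 = (g == 1%g)%:R.
Proof.
pose rep (F : gT -> E) := exists s : seq (E * E),
  forall g : gT, \sum_(ab <- s) ab.1 * g ab.2 = F g.
have repM F1 F2 : rep F1 -> rep F2 -> rep (fun g => F1 g * F2 g).
  case=> s1 h1 [s2 h2].
  exists [seq (a.1 * b.1, a.2 * b.2) | a <- s1, b <- s2] => g.
  rewrite big_allpairs_dep -h1 -h2 mulr_suml; apply: eq_bigr => a _.
  by rewrite mulr_sumr; apply: eq_bigr => b _ /=; rewrite rmorphM mulrACA.
have rep1 : rep (fun=> 1).
  by exists [:: (1, 1)] => g; rewrite big_seq1 mul1r rmorph1.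
have repF (g0 : gT) : g0 != 1%g -> exists F, [/\ rep F, F 1%g = 1 & F g0 = 0].
  move=> /gal_neqP[z]; rewrite gal_id => zP.
  have d0 : z - g0 z != 0 by rewrite subr_eq0 eq_sym.
  exists (fun g => (g z - g0 z) / (z - g0 z)); split.
  - exists [:: ((z - g0 z)^-1, z); (- g0 z / (z - g0 z), 1)] => g.
    by rewrite big_cons big_seq1 /= rmorph1 mulr1 [_ * g z]mulrC -mulrDl.
  - by rewrite gal_id mulfV.
  - by rewrite subrr mul0r.
have [F FP] : exists F : gT -> gT -> E, forall g0, g0 != 1%g ->
    [/\ rep (F g0), F g0 1%g = 1 & F g0 g0 = 0].
  apply: (@fin_all_exists _ _ (fun g0 F => g0 != 1%g -> [/\ rep F, F 1%g = 1 & F g0 = 0])).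
  move=> g0; have [->|/repF[F FP]] := eqVneq g0 1%g; first by exists (fun=> 1).
  by exists F.
pose D g := \prod_(g0 : gT | g0 != 1%g) F g0 g.
have [s sP] : rep D.
  rewrite /D; elim: (index_enum _) => [|g0 r IH].
    by case: rep1 => s sP; exists s => g; rewrite sP big_nil.
  have [g01|g01] := boolP (g0 != 1%g); last first.
    by case: IH => s sP; exists s => g; rewrite sP big_cons (negPf g01).
  have [r0 _ _] := FP _ g01.
  by case: (repM _ _ r0 IH) => s sP; exists s => g; rewrite sP big_cons g01.
exists s => g; rewrite sP /D; have [->|g1] := eqVneq g 1%g.
  by apply: big1 => g0 /FP[].
by rewrite (bigD1 g) //=; have [_ _ ->] := FP _ g1; rewrite mul0r.
Qed.

(** Weighting the vanishing traces by the coefficients of [gal_dual] isolates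
    the term of the identity automorphism. *)
Lemma gal_trace_nondeg (a : E) : (forall b, \sum_(g : gT) g (b * a) = 0) -> a = 0.
Proof.
move=> tr0; have [s sP] := gal_dual.
have: \sum_(ab <- s) ab.1 * (\sum_(g : gT) g (ab.2 * a)) = 0.
  by apply: big1 => ab _; rewrite tr0 mulr0.
under eq_bigr do rewrite mulr_sumr.
rewrite exchange_big /= (eq_bigr (fun g : gT => (g == 1%g)%:R * g a)); last first.
  move=> g _; rewrite -sP mulr_suml; apply: eq_bigr => ab _.
  by rewrite rmorphM mulrA.
rewrite (bigD1 1%g) //= big1 ?addr0 => [|g /negPf->]; last by rewrite mul0r.
by rewrite eqxx mul1r gal_id.
Qed.

Lemma gal_indep (a : gT -> E) :
  (forall x, \sum_g a g * g x = 0) -> forall g, a g = 0.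
Proof. by move=> a0 h; apply: (@gal_independent _ _ _ predT) => // x _. Qed.

Hypothesis galE : galois 1%AS {:E}.

Lemma gal_fixedK (x : E) : (forall g : gT, g x = x) -> exists k : K, x = k%:A.
Proof.
move=> xfix; have [_ _ E1] := and3P galE.
have /galois_fixedField fE := galE.
have: x \in fixedField (Gamma E) by apply/fixedFieldP; rewrite ?memvf.
by rewrite fE => /vlineP.
Qed.

End GaloisDescent.

(** * Linear maps on tensor products *)

Section Linearity.

Variables (K : fieldType).

Lemma lin_sumE (U W : lmodType K) (f : U -> W) (fl : linear f)
    (I : Type) (r : seq I) (P : pred I) (F : I -> U) :
  f (\sum_(i <- r | P i) F i) = \sum_(i <- r | P i) f (F i).
Proof.
pose fL : {linear U -> W} := HB.pack f (GRing.isLinear.Build K U W *:%R f fl).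
exact: (linear_sum fL).
Qed.

Lemma lin_scaleE (U W : lmodType K) (f : U -> W) (fl : linear f) k u :
  f (k *: u) = k *: f u.
Proof.
pose fL : {linear U -> W} := HB.pack f (GRing.isLinear.Build K U W *:%R f fl).
exact: (linearZZ fL).
Qed.

Lemma linfun_of (U V : vectType K) (f : U -> V) (fl : linear f) :
  exists F : 'Hom(U, V), F =1 f.
Proof.
pose fL : {linear U -> V} := HB.pack f (GRing.isLinear.Build K U V *:%R f fl).
by exists (linfun fL) => x; rewrite lfunE.
Qed.

Lemma lin_vbasisE (U : vectType K) (W : lmodType K) (f : U -> W) (fl : linear f) u :
  f u = \sum_i coord (vbasis {:U}) i u *: f (vbasis {:U})`_i.
Proof.
rewrite {1}(coord_vbasis (memvf u)) lin_sumE //.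
by apply: eq_bigr => i _; rewrite lin_scaleE.
Qed.

Lemma vbasis_free0 (U : vectType K) (k : 'I_(\dim {:U}) -> K) :
  \sum_i k i *: (vbasis {:U})`_i = 0 -> forall i, k i = 0.
Proof. by move/freeP: (basis_free (vbasisP {:U})) => /(_ k). Qed.

Section Tlift.

Variables (U V W : vectType K).

Lemma tlift_linear (b : U -> V -> W) : linear (tlift b).
Proof.
move=> k t u; rewrite /tlift scaler_sumr -big_split; apply: eq_bigr => i _ /=.
rewrite scaler_sumr -big_split; apply: eq_bigr => j _ /=.
by rewrite !mxE scalerDl scalerA.
Qed.

Lemma eq_tlift (b c : U -> V -> W) t : (forall u v, b u v = c u v) ->
  tlift b t = tlift c t.
Proof. by move=> bc; apply: eq_bigr => i _; apply: eq_bigr => j _; rewrite bc. Qed.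

Lemma lin_tlift (W' : vectType K) (f : W -> W') (fl : linear f)
    (b : U -> V -> W) t :
  f (tlift b t) = tlift (fun u v => f (b u v)) t.
Proof.
rewrite /tlift lin_sumE //; apply: eq_bigr => i _.
by rewrite lin_sumE //; apply: eq_bigr => j _; rewrite lin_scaleE.
Qed.

End Tlift.

Section FieldValued.

Variable (E : fieldExtType K).

Lemma linear_mulr (W : lmodType K) (f : W -> E) (x : E) :
  linear f -> linear (fun w => f w * x).
Proof. by move=> fl k u v; rewrite fl mulrDl scalerAl. Qed.

Lemma linear_mull (W : lmodType K) (f : W -> E) (x : E) :
  linear f -> linear (fun w => x * f w).
Proof. by move=> fl k u v; rewrite fl mulrDr scalerAr. Qed.

Variables (U V : vectType K) (Y Z : Type) (phi : U -> Y -> E) (psi : V -> Z -> E).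
Hypothesis phi_lin : forall y, linear (phi^~ y).
Hypothesis psi_lin : forall z, linear (psi^~ z).

Lemma tlift_prod_tens u v y z :
  tlift (fun u v => phi u y * psi v z) (tens u v) = phi u y * psi v z.
Proof.
apply: (tlift_tens (b := fun u v => phi u y * psi v z)) => w.
  exact/linear_mulr/phi_lin.
exact/linear_mull/psi_lin.
Qed.

(** A tensor is detected by E-valued products phi_y (x) psi_z as soon as a
    K-basis of U is free over E when seen through phi and the psi_z are jointly
    injective. *)
Lemma tensor_inj :
    (forall a : 'I_(\dim {:U}) -> E,
       (forall y, \sum_i a i * phi (vbasis {:U})`_i y = 0) -> forall i, a i = 0) ->
    (forall v, (forall z, psi v z = 0) -> v = 0) ->
  forall t : tensor U V,
    (forall y z, tlift (fun u v => phi u y * psi v z) t = 0) -> t = 0.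
Proof.
move=> phi_free psi_inj t t0; apply/matrixP=> i j; rewrite !mxE.
pose v i := \sum_j (t : 'M_(_, _)) i j *: (vbasis {:V})`_j.
suffices v0 : v i = 0 by have /vbasis_free0/(_ j) := v0.
apply: psi_inj => z; pose a i := psi (v i) z.
have : a i = 0; last by [].
apply: phi_free => y; rewrite -[RHS](t0 y z) /tlift; apply: eq_bigr => i' _.
rewrite /a /v (lin_sumE (psi_lin z)) mulr_suml; apply: eq_bigr => j' _.
by rewrite (lin_scaleE (psi_lin z)) -scalerAl mulrC.
Qed.

End FieldValued.

End Linearity.

Lemma linfun_linE (K : fieldType) (U V : vectType K) (f : U -> V) :
  linear f -> linfun f =1 f.
Proof.
move=> fl; pose fL : {linear U -> V} := HB.pack f (GRing.isLinear.Build K U V *:%R f fl).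
exact: (lfunE fL).
Qed.

Section TensorEvaluation.

Variable (K : fieldType).

(** The values of the maps to be constructed on the Hopf algebra are pinned down
    by relations stable under linear combinations, so it is enough to choose
    them on a basis. *)
Lemma hom_choice (U W : vectType K) (R : U -> W -> Prop) :
    (forall u, exists w, R u w) -> R 0 0 ->
    (forall k u u' w w', R u w -> R u' w' -> R (k *: u + u') (k *: w + w')) ->
  exists f : 'Hom(U, W), forall u, R u (f u).
Proof.
move=> Rtot R0 Rlin.
have /fin_all_exists[F FP] : forall i : 'I_(\dim {:U}),
  exists w, R (vbasis {:U})`_i w by move=> i; apply: Rtot.
have [|f fP] := @linfun_of K U W
    (fun u => \sum_i coord (vbasis {:U}) i u *: F i).
  move=> k u v; rewrite scaler_sumr -big_split; apply: eq_bigr => i _.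
  by rewrite linearP scalerDl scalerA.
exists f => u; rewrite fP {1}(coord_vbasis (memvf u)).
elim: (index_enum _) => [|i r IH]; first by rewrite !big_nil.
by rewrite !big_cons; apply: Rlin.
Qed.

Lemma tlift_sumf (U V W : vectType K) (I : Type) (r : seq I) (P : pred I)
    (F : I -> U -> V -> W) t :
  tlift (fun u v => \sum_(k <- r | P k) F k u v) t
  = \sum_(k <- r | P k) tlift (F k) t.
Proof.
rewrite /tlift [RHS]exchange_big; apply: eq_bigr => i _ /=.
by rewrite [RHS]exchange_big; apply: eq_bigr => j _; rewrite /= scaler_sumr.
Qed.

Lemma tlift_mull (U V : vectType K) (E : fieldExtType K) (x : E)
    (F : U -> V -> E) t :
  tlift (fun u v => x * F u v) t = x * tlift F t.
Proof.
rewrite /tlift mulr_sumr; apply: eq_bigr => i _.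
by rewrite mulr_sumr; apply: eq_bigr => j _; rewrite scalerAr.
Qed.

Lemma tlift_mulr (U V : vectType K) (E : fieldExtType K) (x : E)
    (F : U -> V -> E) t :
  tlift (fun u v => F u v * x) t = tlift F t * x.
Proof. by rewrite mulrC -tlift_mull; apply: eq_tlift => u v; rewrite mulrC. Qed.

Lemma tlift_tr (U V W : vectType K) (b : U -> V -> W) (t : tensor U V) :
  tlift b t = tlift (fun v u => b u v) ((t : 'M_(_, _))^T : tensor V U).
Proof.
rewrite /tlift exchange_big; apply: eq_bigr => i _.
by apply: eq_bigr => j _; rewrite mxE.
Qed.

(** The equalities in tensor powers of the Hopf algebra are all proved by
    evaluating them in this way at pairs of elements of N. *)
Lemma tensor_eqP (E : fieldExtType K) (U V : vectType K) (Y Z : Type)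
    (phi : U -> Y -> E) (psi : V -> Z -> E) :
    (forall z, linear (psi^~ z)) ->
    (forall a : 'I_(\dim {:U}) -> E,
       (forall y, \sum_i a i * phi (vbasis {:U})`_i y = 0) -> forall i, a i = 0) ->
    (forall v, (forall z, psi v z = 0) -> v = 0) ->
  forall t1 t2 : tensor U V,
    (forall y z, tlift (fun u v => phi u y * psi v z) t1
               = tlift (fun u v => phi u y * psi v z) t2) -> t1 = t2.
Proof.
move=> psil free inj t1 t2 e12.
suff: -1 *: t2 + t1 = 0 by rewrite scaleN1r addrC => /eqP; rewrite subr_eq0 => /eqP.
apply: (tensor_inj psil free inj) => y z.
rewrite (tlift_linear (fun u v => phi u y * psi v z)) e12.
by rewrite scaleN1r addNr.
Qed.

Lemma lker0_bij (U V : vectType K) (f : 'Hom(U, V)) :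
  (forall u, f u = 0 -> u = 0) -> \dim {:U} = \dim {:V} -> bijective f.
Proof.
move=> f0 dUV; have k0 : lker f == 0%VS.
  by apply/lker0P => u v /eqP; rewrite -subr_eq0 -linearB => /eqP/f0/eqP;
     rewrite subr_eq0 => /eqP.
exists (f^-1)%VF; first exact: lker0_lfunK.
move=> v; have: v \in limg f.
  suff -> : limg f = fullv by rewrite memvf.
  apply/eqP; rewrite eqEdim subvf limg_dim_eq ?(eqP k0) ?capv0 //.
  by rewrite /= dUV.
by move/limg_lfunVK.
Qed.

End TensorEvaluation.

(** * The fixed points of the group algebra *)

Section Descended.

Variables (K : fieldType) (E : splittingFieldType K).
Hypothesis galE : galois 1%AS {:E}.
Local Notation gT := (gal_of {:E}).
Local Notation pT := {perm {set gal_of {:E}}}.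
Variables (L : {subfield E}) (N : {group pT}).
Local Notation lam := (gal_lambda L).

Lemma gal_lambda_in_dom g : actperm 'Rs g \in 'N(gal_cosets L | 'P).
Proof.
rewrite !inE; apply/subsetP=> A /rcosetsP[h hG ->]; rewrite inE /= apermE actpermE /=.
rewrite /= -?rcosetM ?rcosetE -?rcosetM; apply/rcosetsP; exists (h * g)%g => //; exact: mem_Gamma.
Qed.

Lemma gal_lambdaM g h : lam (g * h)%g = (lam g * lam h)%g.
Proof. rewrite /gal_lambda [actperm _ _]morphM ?inE //.
by rewrite morphM ?gal_lambda_in_dom. Qed.

Lemma gal_lambda1 : lam 1%g = 1%g.
Proof. by apply: (mulIg (lam 1%g)); rewrite -gal_lambdaM !mul1g. Qed.

Lemma gal_lambdaE g A : A \in gal_cosets L -> lam g A = (A :* g)%g.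
Proof. by move=> AX; rewrite restr_permE ?gal_lambda_in_dom // actpermE /= rcosetE. Qed.

Hypothesis lamN : forall g, g \in Gamma E -> lam g \in 'N(N)%g.

Lemma memJ_lambda g eta : (eta ^ lam g \in N)%g = (eta \in N).
Proof. by rewrite memJ_norm ?lamN ?mem_Gamma. Qed.

(** H stands for a K-space that theta identifies with the fixed points of Gamma in
    E[N]. *)
Variables (H : vectType K) (theta : H -> pT -> E).
Hypothesis th_lin : forall eta, linear (theta^~ eta).
Hypothesis th_fix : forall h, gp_fixed L N (theta h).
Hypothesis th_bij : forall c, gp_fixed L N c -> exists! h, theta h =1 c.

Lemma th_inj h k : theta h =1 theta k -> h = k.
Proof. by move=> hk; have [x [_ u]] := th_bij (th_fix k); rewrite -(u h) // -(u k). Qed.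

Lemma th_inj0 h : (forall eta, theta h eta = 0) -> h = 0.
Proof.
move=> h0; apply: th_inj => eta; rewrite h0.
by have := lin_scaleE (th_lin eta) 0 0; rewrite !scale0r.
Qed.

Lemma th_out h eta : eta \notin N -> theta h eta = 0.
Proof. by have [/(_ eta)] := th_fix h. Qed.

Lemma th_equiv h g eta : theta h (eta ^ lam g)%g = g (theta h eta).
Proof.
have [etaN|etaN] := boolP (eta \in N).
  by have [_ ->] := th_fix h; rewrite ?mem_Gamma.
by rewrite !th_out ?memJ_lambda // rmorph0.
Qed.

Lemma th_surj c : gp_fixed L N c -> exists h, theta h =1 c.
Proof. by case/th_bij=> h [hc _]; exists h. Qed.

Local Notation b i := (vbasis {:H})`_i.

(** For every x in E the traces of the x a_i lie in K. Multiplying the relation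
    by x and summing its conjugates under Gamma shows, by equivariance of the
    coefficients, that they are the coefficients of a K-linear relation between
    basis elements. So these traces vanish, and with them the a_i. *)
Lemma th_free (a : 'I_(\dim {:H}) -> E) :
  (forall eta, \sum_i a i * theta (b i) eta = 0) -> forall i, a i = 0.
Proof.
move=> a0 i; apply: gal_trace_nondeg => // x.
have /fin_all_exists[k kP] : forall j, exists k : K,
    \sum_(g : gT) g (x * a j) = k%:A.
  move=> j; apply: gal_fixedK => // g; rewrite rmorph_sum /=.
  rewrite [RHS](reindex_inj (mulIg g)); apply: eq_bigr => h _.
  by rewrite galMx.
rewrite kP; suff /vbasis_free0-> : \sum_j k j *: b j = 0 by rewrite scale0r.
apply: th_inj0 => eta; rewrite (lin_sumE (th_lin eta)).
transitivity (\sum_(g : gT) g x * g (\sum_j a j * theta (b j) (eta ^ lam g^-1%g)%g)).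
  transitivity (\sum_j \sum_(g : gT) g (x * a j) * theta (b j) eta).
    apply: eq_bigr => j _; rewrite (lin_scaleE (th_lin eta)) -mulr_suml kP.
    by rewrite mulr_algl.
  rewrite exchange_big; apply: eq_bigr => g _ /=.
  rewrite rmorph_sum mulr_sumr; apply: eq_bigr => j _.
  by rewrite !rmorphM /= -mulrA -th_equiv -conjgM -gal_lambdaM mulVg gal_lambda1 conjg1.
by apply: big1 => g _; rewrite a0 rmorph0 mulr0.
Qed.

(** For x in E, the sum of the conjugates of x s under Gamma is a fixed point.
    Combining these sums according to [gal_dual] leaves only the term s. *)
Lemma th_span s : s \in N ->
  exists C : 'I_(\dim {:H}) -> E,
    forall eta, \sum_i C i * theta (b i) eta = (s == eta)%:R.
Proof.
move=> sN; pose T x eta := \sum_(g : gT) (s ^ lam g == eta)%g%:R * g x.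
have TP x : gp_fixed L N (T x).
  split=> [eta etaN|g eta _ _].
    apply: big1 => g _; have [e|_] := eqVneq; last by rewrite mul0r.
    by move: etaN; rewrite -e memJ_lambda sN.
  rewrite /T rmorph_sum (reindex_inj (mulIg g)); apply: eq_bigr => h _ /=.
  by rewrite gal_lambdaM conjgM (inj_eq (conjg_inj _)) galMx rmorphM rmorph_nat.
have [l lP] := gal_dual E.
have [C CP] : exists C : 'I_(\dim {:H}) -> E, forall eta,
    \sum_i C i * theta (b i) eta = \sum_(ab <- l) ab.1 * T ab.2 eta.
  elim: l {lP} => [|ab l [C CP]].
    by exists (fun=> 0) => eta; rewrite big_nil big1 // => i _; rewrite mul0r.
  have [h hP] := th_surj (TP ab.2).
  exists (fun i => ab.1 * (coord (vbasis {:H}) i h)%:A + C i) => eta.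
  rewrite big_cons -CP -hP (lin_vbasisE (th_lin eta)) mulr_sumr -big_split.
  apply: eq_bigr => i _; rewrite mulrDl; congr (_ + _).
  by rewrite -mulrA mulr_algl.
exists C => eta; rewrite CP.
transitivity (\sum_(g : gT) (s ^ lam g == eta)%g%:R * (g == 1%g)%:R : E).
  under eq_bigr do rewrite mulr_sumr.
  rewrite exchange_big /=; apply: eq_bigr => g _; rewrite -lP mulr_sumr.
  by apply: eq_bigr => ab _; rewrite mulrCA.
rewrite (bigD1 1%g) //= big1 => [|g /negPf->]; last by rewrite mulr0.
by rewrite eqxx mulr1 addr0 gal_lambda1 conjg1.
Qed.

(** The coefficients of s on the basis are unique by [th_free]; hence they are
    equivariant as functions of s, that is, they are the coefficients of fixed
    points d_i. *)
Lemma th_dual : exists d : 'I_(\dim {:H}) -> H, forall s, s \in N ->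
  forall eta, \sum_i theta (d i) s * theta (b i) eta = (s == eta)%:R.
Proof.
have /fin_all_exists[C CP] : forall s, exists C : 'I_(\dim {:H}) -> E,
    forall eta, \sum_i C i * theta (b i) eta = ((s \in N) && (s == eta))%:R.
  move=> s; have [/th_span//|sN] := boolP (s \in N).
  by exists (fun=> 0) => eta; rewrite big1 // => i _; rewrite mul0r.
have /fin_all_exists[d dP] : forall i, exists d : H, theta d =1 C^~ i.
  move=> i; apply: th_surj; split=> [s sN|g s _ sN].
    apply: (th_free (a := C s)) => eta.
    by rewrite CP (negPf sN).
  apply/eqP; rewrite -subr_eq0; apply/eqP.
  apply: (th_free (a := fun i => C (s ^ lam g)%g i - g (C s i))) => eta.
  under eq_bigr do rewrite mulrBl.
  have -> : eta = ((eta ^ lam g^-1%g) ^ lam g)%g.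
    by rewrite -conjgM -gal_lambdaM mulVg gal_lambda1 conjg1.
  move: (eta ^ _)%g => {}eta; rewrite sumrB CP memJ_lambda (inj_eq (conjg_inj _)).
  rewrite -(rmorph_nat g) -CP rmorph_sum; apply/eqP; rewrite subr_eq0; apply/eqP.
  by apply: eq_bigr => j _; rewrite rmorphM th_equiv.
exists d => s sN eta; under eq_bigr do rewrite dP.
by rewrite CP sN.
Qed.

(** The matrices of the coefficients of the b_i and of their dual elements are
    inverse to each other. *)
Lemma th_dim : \dim {:H} = #|N|.
Proof.
have [d dP] := th_dual.
pose B : 'M[E]_(\dim {:H}, #|N|) := \matrix_(i, j) theta (b i) (enum_val j).
pose D : 'M[E]_(#|N|, \dim {:H}) := \matrix_(j, i) theta (d i) (enum_val j).
apply/eqP; rewrite eqn_leq; apply/andP; split.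
  apply: (@mulmx1_min _ _ _ B D); apply/matrixP=> i j.
  rewrite !mxE; apply/eqP; rewrite -subr_eq0; apply/eqP.
  apply: (th_free (a := fun j => \sum_k B i k * D k j - (i == j)%:R)) => eta.
  under eq_bigr do rewrite mulrBl.
  rewrite sumrB [X in _ - X](bigD1 i) //= eqxx mul1r.
  rewrite [X in _ - (_ + X)]big1 => [|j' j'i]; last first.
    by rewrite eq_sym (negPf j'i) mul0r.
  rewrite addr0; apply/eqP; rewrite subr_eq0; apply/eqP.
  under eq_bigr do rewrite mulr_suml.
  rewrite exchange_big /=.
  transitivity (\sum_(k < #|N|) theta (b i) (enum_val k) * (enum_val k == eta)%:R).
    apply: eq_bigr => k _; rewrite -dP ?enum_valP // mulr_sumr.
    by apply: eq_bigr => j' _; rewrite !mxE mulrA.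
  rewrite -(big_enum_val (fun s => theta (b i) s * (s == eta)%:R)).
  have [etaN|etaN] := boolP (eta \in N); last first.
    rewrite th_out // big1 // => s sN; have [e|_] := eqVneq; last by rewrite mulr0.
    by rewrite -e sN in etaN.
  rewrite (bigD1 eta) //= eqxx mulr1 big1 ?addr0 // => s /andP[_ /negPf->].
  by rewrite mulr0.
apply: (@mulmx1_min _ _ _ D B); apply/matrixP=> i j; rewrite !mxE.
rewrite -(inj_eq enum_val_inj) -dP ?enum_valP //.
by apply: eq_bigr => k _; rewrite !mxE.
Qed.

End Descended.

(** * Embeddings indexed by a regular subgroup *)

Section Embeddings.

Variables (K : fieldType) (E : splittingFieldType K).
Hypothesis galE : galois 1%AS {:E}.
Local Notation gT := (gal_of {:E}).
Local Notation pT := {perm {set gal_of {:E}}}.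
Variables (L : {subfield E}) (N : {group pT}).
Local Notation lam := (gal_lambda L).
Hypothesis gpN : gp_subgroup L N.

Lemma gp_lamN g : g \in Gamma E -> lam g \in 'N(N)%g.
Proof. by case: gpN => _; apply. Qed.

(** The coset eta^-1 (Gamma') and the embedding of L in E given by any of its
    elements, through which eta acts on L. For eta in a regular subgroup each
    embedding occurs once. *)
Definition coset_at (eta : pT) : {set gT} := (eta^-1)%g (Gamma' L : {set _}).
Definition emb (eta : pT) (x : E) : E := (repr (coset_at eta) : gT) x.

Lemma Gamma'_in_cosets : (Gamma' L : {set gT}) \in gal_cosets L.
Proof. by apply/rcosetsP; exists 1%g; rewrite ?group1 ?rcoset1. Qed.

Lemma gal_cosetsP A : A \in gal_cosets L -> exists g, A = (Gamma' L :* g)%g.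
Proof. by case/rcosetsP=> g _ ->; exists g. Qed.

Lemma regular_stable eta A : eta \in N -> (eta A \in gal_cosets L) = (A \in gal_cosets L).
Proof.
by case: gpN => -[Non _ _] _ /Non/perm_closed.
Qed.

Lemma coset_at_in eta : eta \in N -> coset_at eta \in gal_cosets L.
Proof. by move=> etaN; rewrite regular_stable ?groupV // Gamma'_in_cosets. Qed.

Lemma coset_atE eta : eta \in N -> coset_at eta = (Gamma' L :* repr (coset_at eta))%g.
Proof.
move/coset_at_in/gal_cosetsP=> [g ->].
by rewrite (rcoset_eqP (mem_repr_rcoset _ g)).
Qed.

Lemma mem_coset_at eta g : eta \in N ->
  (g \in coset_at eta) = (g * (repr (coset_at eta))^-1 \in Gamma' L)%g.
Proof. by move=> etaN; rewrite -mem_rcoset -coset_atE. Qed.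

Lemma Gamma'_fix g x : g \in Gamma' L -> x \in L -> g x = x.
Proof. by move=> gL xL; apply: (fixed_gal (subvf L) gL). Qed.

Lemma embE eta g x : coset_at eta = (Gamma' L :* g)%g -> x \in L -> emb eta x = g x.
Proof.
move=> e xL; have: repr (coset_at eta) \in (Gamma' L :* g)%g.
  by rewrite e mem_repr_rcoset.
by rewrite /emb => /rcosetP[h hL ->]; rewrite galMx (Gamma'_fix hL).
Qed.

Lemma coset_at_surj A : A \in gal_cosets L ->
  exists2 eta, eta \in N & coset_at eta = A.
Proof.
case: gpN => -[_ Ntr _] _ AX.
have := atransP2 Ntr Gamma'_in_cosets AX => -[eta etaN ->].
by exists eta^-1%g; rewrite ?groupV // /coset_at invgK.
Qed.

Lemma regular_eq s t A : A \in gal_cosets L -> s \in N -> t \in N ->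
  s A = t A -> s = t.
Proof.
case: gpN => -[_ _ Nst] _ AX sN tN e.
apply/eqP; rewrite eq_mulgV1 -in_set1 -[[set 1%g]](Nst _ AX).
by rewrite inE groupM ?groupV //; apply/astab1P; rewrite /= apermE permM e permK.
Qed.

Lemma coset_at_inj s t : s \in N -> t \in N -> coset_at s = coset_at t -> s = t.
Proof.
move=> sN tN; rewrite /coset_at => e; apply: invg_inj.
by apply: (regular_eq Gamma'_in_cosets) e; rewrite groupV.
Qed.

(** This is why acting twice on L is acting by the product: the embedding of t
    followed by that of s is the embedding of t ^ lam h * s, and equivariance of
    the coefficients absorbs the conjugation. *)
Lemma coset_atM s t h : s \in N -> coset_at s = (Gamma' L :* h)%g -> t \in N ->
  coset_at (t ^ lam h * s)%g = (coset_at t :* h)%g.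
Proof.
move=> sN es tN; rewrite {1}/coset_at invMg permM -/(coset_at s) es.
have Gh : (Gamma' L :* h)%g = lam h (Gamma' L).
  by rewrite gal_lambdaE ?Gamma'_in_cosets.
rewrite Gh -conjVg conjgE -permM mulKVg permM.
by rewrite gal_lambdaE ?coset_at_in.
Qed.

Lemma mem_LP x : (forall g, g \in Gamma' L -> g x = x) -> x \in L.
Proof.
move=> xfix; have galL : galois L {:E} by apply: galoisS galE; rewrite sub1v subvf.
rewrite -(galois_fixedField galL); apply/fixedFieldP; rewrite ?memvf //.
Qed.

(** Applied to the traces to L of the elements of E, the relation becomes one
    between automorphisms of E, in which an automorphism has the coefficient of
    the element of N whose coset contains it. *)
Lemma emb_indep (a : pT -> E) :
    (forall x, x \in L -> \sum_(eta in N) a eta * emb eta x = 0) ->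
  forall eta, eta \in N -> a eta = 0.
Proof.
move=> a0; pose A h := \sum_(eta in N) (h \in coset_at eta)%:R * a eta.
have A0 : forall h : gT, A h = 0.
  apply: gal_indep => y.
  have trL : \sum_(g in Gamma' L) g y \in L.
    apply: mem_LP => h hL; rewrite rmorph_sum /= [RHS](reindex_inj (mulIg h)).
    apply: eq_big => [g|g _]; first by rewrite groupMr.
    by rewrite galMx.
  rewrite -[RHS](a0 _ trL) /A.
  under eq_bigr do rewrite mulr_suml.
  rewrite exchange_big; apply: eq_bigr => eta etaN /=.
  rewrite (embE (coset_atE etaN) trL) rmorph_sum /=.
  rewrite (reindex_inj (mulIg (repr (coset_at eta)))) /= mulr_sumr [RHS]big_mkcond.
  apply: eq_bigr => g _.
  have -> : (g * repr (coset_at eta))%g \in coset_at eta = (g \in Gamma' L).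
    by rewrite mem_coset_at // mulgK.
  rewrite galMx.
  by case: ifP; rewrite ?mul1r // !mul0r.
move=> eta etaN; rewrite -(A0 (repr (coset_at eta))) /A (bigD1 eta) //=.
have -> : repr (coset_at eta) \in coset_at eta.
  by rewrite mem_coset_at // mulgV group1.
rewrite mul1r big1 ?addr0 // => s /andP[sN seta].
have [e|_] := boolP (_ \in _); last by rewrite mul0r.
case/negP: seta; apply/eqP/coset_at_inj => //.
by rewrite (coset_atE etaN) (coset_atE sN); apply/esym/rcoset_eqP; rewrite -coset_atE.
Qed.

(** An element of Gamma' permutes the terms of the sum, by equivariance of the
    coefficients. *)
Lemma act_in_L (c : pT -> E) x : gp_fixed L N c -> x \in L ->
  \sum_(eta in N) c eta * emb eta x \in L.
Proof.
move=> [c0 cfix] xL; apply: mem_LP => g gL; rewrite rmorph_sum /=.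
rewrite [RHS](reindex_inj (conjg_inj (lam g))).
apply: eq_big => [eta|eta etaN]; first by rewrite memJ_norm ?gp_lamN ?mem_Gamma.
rewrite rmorphM cfix ?mem_Gamma //; congr (_ * _).
have eg : coset_at 1 = (Gamma' L :* g)%g by rewrite /coset_at invg1 perm1 rcoset_id.
have := coset_atM (group1 N) eg etaN; rewrite mulg1 (coset_atE etaN) -rcosetM.
by move=> /embE->; rewrite ?galMx // (embE (coset_atE etaN)).
Qed.

Lemma card_gp : #|N| = \dim L.
Proof.
have -> : #|N| = #|gal_cosets L|.
  rewrite -(card_in_imset coset_at_inj); apply: eq_card => A.
  apply/imsetP/idP => [[eta etaN ->]|/coset_at_surj[eta etaN <-]].
    exact: coset_at_in.
  by exists eta.
have galL : galois L {:E} by apply: galoisS galE; rewrite sub1v subvf.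
have := galois_dim galE; have := galois_dim galL; rewrite dimv1 divn1.
rewrite -/(Gamma E) -/(Gamma' L) => dL dE.
have /Lagrange e : Gamma' L \subset Gamma E by apply: galS; apply: sub1v.
rewrite /gal_cosets -/(indexg _ _).
have := field_dimS (subvf L) => /divnK; rewrite dL dE -e => /eqP.
by rewrite eqn_pmul2l ?cardG_gt0 // => /eqP.
Qed.

End Embeddings.

(** * The Hopf-Galois structure on the fixed points *)

Section HopfGaloisOfDescent.

Variables (K : fieldType) (E : splittingFieldType K).
Hypothesis galE : galois 1%AS {:E}.
Local Notation gT := (gal_of {:E}).
Local Notation pT := {perm {set gal_of {:E}}}.
Variables (L : {subfield E}) (N : {group pT}).
Local Notation lam := (gal_lambda L).
Hypothesis gpN : gp_subgroup L N.
Let lamN := gp_lamN gpN.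

Variables (H : falgType K) (theta : H -> pT -> E).
Hypothesis th_lin : forall eta, linear (theta^~ eta).
Hypothesis th_fix : forall h, gp_fixed L N (theta h).
Hypothesis th_bij : forall c, gp_fixed L N c -> exists! h, theta h =1 c.
Hypothesis th_one : forall eta, theta 1 eta = (eta == 1%g)%:R.
Hypothesis th_mul : forall h k eta, theta (h * k) eta =
  \sum_(s : pT) theta h s * theta k (eta * s^-1)%g.

Let inj := th_inj th_fix th_bij.
Let free := th_free galE lamN th_lin th_fix th_bij.
Let inj0 := th_inj0 th_lin th_fix th_bij.
Let tinj2 := tensor_eqP th_lin free inj0.

(* The coefficient of s (x) u in the image of t in E[N] (x) E[N]. *)
Let T2 (t : tensor H H) s u : E := tlift (fun x y => theta x s * theta y u) t.

Let T2_lin s u : linear (fun t => T2 t s u). Proof. exact: tlift_linear. Qed.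

Let T2_tens x y s u : T2 (tens x y) s u = theta x s * theta y u.
Proof. exact: (tlift_prod_tens th_lin th_lin). Qed.

Let t2inj t t' : (forall s u, T2 t s u = T2 t' s u) -> t = t'.
Proof. exact: tinj2. Qed.

Let t2inj0 t : (forall s u, T2 t s u = 0) -> t = 0.
Proof.
move=> t0; apply: t2inj => s u; rewrite t0.
by have := lin_scaleE (T2_lin s u) 0 0; rewrite !scale0r.
Qed.

Let out h eta : eta \notin N -> theta h eta = 0. Proof. exact: th_out th_fix h eta. Qed.

Let sumN (F : pT -> E) h :
  \sum_(eta in N) theta h eta * F eta = \sum_eta theta h eta * F eta.
Proof.
rewrite big_mkcond; apply: eq_bigr => eta _.
by case: ifPn => // etaN; rewrite out ?mul0r.
Qed.

(** The comultiplication is h |-> sum_i b_i (x) p_i, where the coefficients of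
    p_i are the products of those of h with those of the dual element d_i: in
    E[N] (x) E[N] this is the diagonal map. *)
Lemma hopf_comul : exists D : 'Hom(H, tensor H H),
  forall h s u, T2 (D h) s u = if s == u then theta h s else 0.
Proof.
apply: (hom_choice (R := fun h t => forall s u, T2 t s u = if s == u then theta h s else 0)).
- move=> h; have [d dP] := th_dual galE lamN th_lin th_fix th_bij.
  have /fin_all_exists[p pP] : forall i, exists p,
      theta p =1 (fun eta => theta h eta * theta (d i) eta).
    move=> i; apply: (th_surj th_bij); split=> [eta etaN|g eta gG etaN].
      by rewrite out ?mul0r.
    by rewrite !(th_equiv lamN th_fix) rmorphM.
  exists (\sum_(i < \dim {:H}) tens (vbasis {:H})`_i (p i)) => s u.
  rewrite (lin_sumE (T2_lin s u)).
  have [uN|uN] := boolP (u \in N); last first.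
    rewrite big1 => [|i _]; last by rewrite T2_tens [theta (p i) u]out ?mulr0.
    by case: eqP => // ->; rewrite out.
  transitivity (theta h u * \sum_i theta (d i) u * theta (vbasis {:H})`_i s).
    rewrite mulr_sumr; apply: eq_bigr => i _.
    by rewrite T2_tens pP mulrC mulrA.
  rewrite dP // eq_sym; case: eqP => [->|_]; by rewrite ?mulr1 ?mulr0.
- move=> s u; have := lin_scaleE (T2_lin s u) 0 0; rewrite !scale0r => ->.
  by have := lin_scaleE (th_lin s) 0 0; rewrite !scale0r => ->; case: ifP.
- move=> k h h' t t' tP tP' s u; rewrite (T2_lin s u) tP tP' (th_lin s).
  by case: eqP => // _; rewrite scaler0 addr0.
Qed.

Lemma hopf_counit : exists e : 'Hom(H, K^o),
  forall h, (e h : K)%:A = \sum_eta theta h eta :> E.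
Proof.
apply: (hom_choice (R := fun h (k : K^o) => (k : K)%:A = \sum_eta theta h eta :> E)).
- move=> h; have [|k kP] := gal_fixedK galE (x := \sum_eta theta h eta); last by exists k.
  move=> g; rewrite rmorph_sum [RHS](reindex_inj (conjg_inj (lam g))).
  by apply: eq_bigr => eta _; rewrite /= (th_equiv lamN th_fix).
- rewrite scale0r big1 // => eta _.
  by have := lin_scaleE (th_lin eta) 0 0; rewrite !scale0r.
- move=> k h h' l l' lP lP'; rewrite scalerDl -scalerA lP lP' scaler_sumr -big_split.
  by apply: eq_bigr => eta _; rewrite th_lin.
Qed.

Lemma hopf_antipode : exists S : 'End(H),
  forall h eta, theta (S h) eta = theta h (eta^-1)%g.
Proof.
apply: (hom_choice (R := fun h h' => forall eta, theta h' eta = theta h (eta^-1)%g)).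
- move=> h; apply: (th_surj th_bij); split=> [eta etaN|g eta gG etaN].
    by rewrite out ?groupV.
  by rewrite -conjVg (th_equiv lamN th_fix).
- by move=> eta; have := lin_scaleE (th_lin eta) 0 0;
    have := lin_scaleE (th_lin eta^-1%g) 0 0; rewrite !scale0r => -> ->.
- by move=> k h h' l l' lP lP' eta; rewrite !th_lin lP lP'.
Qed.

Lemma hopf_act : exists A : 'Hom(H, 'End(subvs_of L)),
  forall h x, vsval (A h x) = \sum_eta theta h eta * emb L eta (vsval x).
Proof.
apply: (hom_choice (R := fun h (f : 'End(subvs_of L)) =>
  forall x, vsval (f x) = \sum_eta theta h eta * emb L eta (vsval x))).
- move=> h; apply: (hom_choice (R := fun (x y : subvs_of L) =>
    vsval y = \sum_eta theta h eta * emb L eta (vsval x))).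
  + move=> x; have := act_in_L galE gpN (th_fix h) (valP x); rewrite sumN => yL.
    by exists (Subvs yL).
  + by rewrite !linear0 big1 // => eta _; rewrite /emb rmorph0 mulr0.
  + move=> k x x' y y' yP yP'; rewrite linearP /= yP yP' scaler_sumr -big_split.
    by apply: eq_bigr => eta _; rewrite /emb !linearP /= mulrDr scalerAr.
- move=> x; rewrite zero_lfunE linear0 big1 // => eta _.
  by have := lin_scaleE (th_lin eta) 0 0; rewrite !scale0r => ->; rewrite mul0r.
- move=> k h h' f f' fP fP' x; rewrite !lfun_simp linearP /= fP fP'.
  rewrite scaler_sumr -big_split; apply: eq_bigr => eta _.
  by rewrite th_lin mulrDl scalerAl.
Qed.

(** After evaluation at elements of N every axiom is an identity between sums over
    N in which the comultiplication is diagonal. For the bijection, a tensor in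
    L (x) H that acts as zero has vanishing coefficient at each embedding of L,
    by [emb_indep], hence is zero by [th_free]; and the dimensions agree because
    \dim H = |N| = [L : K]. *)
Lemma hopf_galois_exists : exists S : hopf_galois (subvs_of L), gp_corresponds S N.
Proof.
have [D DP] := hopf_comul; have [e eP] := hopf_counit.
have [S SP] := hopf_antipode; have [A AP] := hopf_act.
have thZ k h s : theta (k *: h) s = k *: theta h s by rewrite (lin_scaleE (th_lin s)).
have scA (k : K) (x : E) : k *: x = k%:A * x by rewrite mulr_algl.
have kinj (k k' : K) : k%:A = k'%:A :> E -> k = k'.
  by move/eqP; rewrite -subr_eq0 -scalerBl scaler_eq0 oner_eq0 orbF subr_eq0 => /eqP.
have D2 h s u : tlift (fun a b => theta a s * theta b u) (D h)
    = if s == u then theta h s else 0 by apply: DP.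
have sum_diag h (F : pT -> pT -> E) :
    \sum_s \sum_u (if s == u then theta h s else 0) * F s u
    = \sum_s theta h s * F s s.
  apply: eq_bigr => s _; rewrite (bigD1 s) //= eqxx big1 ?addr0 // => u.
  by rewrite eq_sym => /negPf->; rewrite mul0r.
(* The form in which all the axioms use that the comultiplication is diagonal. *)
have DF h (F : pT -> pT -> E) :
    tlift (fun a b => \sum_s \sum_u (theta a s * theta b u) * F s u) (D h)
    = \sum_s theta h s * F s s.
  rewrite -sum_diag tlift_sumf; apply: eq_bigr => s _.
  by rewrite tlift_sumf; apply: eq_bigr => u _; rewrite tlift_mulr D2.
have c_assoc h : tlift (fun a b => tens a (D b)) (D h)
    = tlift (fun a b => tlift (fun c d => tens c (tens d b)) (D a)) (D h).
  apply: (tensor_eqP (psi := fun t (z : pT * pT) => T2 t z.1 z.2) _ free).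
  - by move=> z; apply: T2_lin.
  - by move=> t t0; apply: t2inj0 => s u; apply: (t0 (s, u)).
  move=> s [u v] /=.
  have T2l (z : pT * pT) : linear (fun t => T2 t z.1 z.2) by apply: T2_lin.
  rewrite !(lin_tlift (tlift_linear (fun u0 v0 => theta u0 s * T2 v0 u v))).
  transitivity (tlift (fun a b => (theta a s * theta b u) * (u == v)%:R) (D h)).
    apply: eq_tlift => a b.
    rewrite (tlift_prod_tens th_lin T2l a (D b) s (u, v)) /= DP -mulrA.
    by case: eqP => _; rewrite ?mulr1 ?mulr0.
  rewrite tlift_mulr D2.
  transitivity (tlift (fun a b => (s == u)%:R * (theta a s * theta b v)) (D h)).
    rewrite tlift_mull D2; have [<-|su] := eqVneq s u.
      by rewrite mul1r; case: eqP => _; rewrite ?mulr1 ?mulr0.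
    by rewrite !mul0r.
  apply: eq_tlift => a b.
  rewrite (lin_tlift (tlift_linear (fun u0 v0 => theta u0 s * T2 v0 u v))).
  transitivity (tlift (fun c d => (theta c s * theta d u) * theta b v) (D a)).
    by rewrite tlift_mulr D2; case: eqP => _; rewrite ?mul1r ?mul0r // mulrC.
  apply: eq_tlift => c d.
  by rewrite (tlift_prod_tens th_lin T2l c (tens d b) s (u, v)) /= T2_tens mulrA.
have c_l h : tlift (fun a b => (e a : K) *: b) (D h) = h.
  apply: inj => eta; rewrite (lin_tlift (th_lin eta)).
  transitivity (tlift (fun a b => \sum_s (theta a s * theta b eta)) (D h)).
    by apply: eq_tlift => a b; rewrite thZ scA eP mulr_suml.
  rewrite tlift_sumf (bigD1 eta) //= D2 eqxx big1 ?addr0 // => s /negPf.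
  by rewrite D2 => ->.
have c_r h : tlift (fun a b => (e b : K) *: a) (D h) = h.
  apply: inj => eta; rewrite (lin_tlift (th_lin eta)).
  transitivity (tlift (fun a b => \sum_s (theta a eta * theta b s)) (D h)).
    by apply: eq_tlift => a b; rewrite thZ scA eP mulrC mulr_sumr.
  rewrite tlift_sumf (bigD1 eta) //= D2 eqxx big1 ?addr0 // => s.
  by rewrite eq_sym D2 => /negPf->.
have c_one : D 1 = tens 1 1.
  apply: t2inj => s u; rewrite DP T2_tens !th_one.
  by case: eqP => [<-|su]; case: eqP => [s1|_]; rewrite ?mul1r ?mul0r //;
     case: eqP => // u1; case: su; rewrite s1 u1.
have c_mul h k : D (h * k)
    = tlift (fun a b => tlift (fun c d => tens (a * c) (b * d)) (D k)) (D h).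
  apply: t2inj => s u; rewrite (lin_tlift (T2_lin s u)) DP.
  transitivity (\sum_x theta h x *
      (if s == u then theta k (s * x^-1)%g else 0)).
    case: eqP => _; first by rewrite th_mul.
    by rewrite big1 // => x _; rewrite mulr0.
  transitivity (tlift (fun a b => \sum_x \sum_y (theta a x * theta b y) *
      (if (s * x^-1)%g == (u * y^-1)%g then theta k (s * x^-1)%g else 0)) (D h)).
    by rewrite DF; apply: eq_bigr => x _; rewrite (inj_eq (mulIg _)).
  apply: eq_tlift => a b; rewrite (lin_tlift (T2_lin s u)).
  transitivity (\sum_x \sum_y (theta a x * theta b y) *
      tlift (fun c d => theta c (s * x^-1)%g * theta d (u * y^-1)%g) (D k)).
    by apply: eq_bigr => x _; apply: eq_bigr => y _; rewrite D2.
  rewrite -[RHS](@eq_tlift _ _ _ _ (fun c d => \sum_x \sum_y (theta a x * theta b y)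
      * (theta c (s * x^-1)%g * theta d (u * y^-1)%g))) => [|c d].
    rewrite tlift_sumf; apply: eq_bigr => x _.
    by rewrite tlift_sumf; apply: eq_bigr => y _; rewrite tlift_mull.
  rewrite T2_tens !th_mul mulr_suml; apply: eq_bigr => x _.
  by rewrite mulr_sumr; apply: eq_bigr => y _; rewrite mulrACA.
have e_one : e 1 = 1.
  apply: kinj; rewrite eP scale1r (bigD1 1%g) //= th_one eqxx big1 ?addr0 // => s.
  by rewrite th_one => /negPf->.
have e_mul h k : e (h * k) = e h * e k.
  apply: kinj; rewrite eP -[RHS]scalerA eP scA eP mulr_suml.
  under eq_bigr do rewrite th_mul.
  rewrite exchange_big; apply: eq_bigr => s _ /=; rewrite -mulr_sumr.
  by congr (_ * _); rewrite [RHS](reindex_inj (mulIg s^-1%g)).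
have e_theta (h : H) eta : theta (e h)%:A eta = \sum_s theta h s * (eta == 1%g)%:R.
  by rewrite thZ scA eP th_one mulr_suml.
have S_l h : tlift (fun a b => S a * b) (D h) = (e h)%:A.
  apply: inj => eta; rewrite (lin_tlift (th_lin eta)) e_theta.
  transitivity (tlift (fun a b => \sum_s \sum_u (theta a s * theta b u)
      * (u == eta * s)%g%:R) (D h)); last first.
    rewrite DF; apply: eq_bigr => s _; congr (_ * _%:R).
    have -> // : (s == eta * s)%g = (eta == 1%g).
    by rewrite -{1}[s]mul1g (inj_eq (mulIg s)) eq_sym.
  apply: eq_tlift => a b; rewrite th_mul [RHS](reindex_inj invg_inj).
  apply: eq_bigr => s _; rewrite SP (bigD1 (eta * s^-1)%g) //= eqxx mulr1 big1 ?addr0 //.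
  by move=> u /negPf->; rewrite mulr0.
have S_r h : tlift (fun a b => a * S b) (D h) = (e h)%:A.
  apply: inj => eta; rewrite (lin_tlift (th_lin eta)) e_theta.
  transitivity (tlift (fun a b => \sum_s \sum_u (theta a s * theta b u)
      * (u == s * eta^-1)%g%:R) (D h)); last first.
    rewrite DF; apply: eq_bigr => s _; congr (_ * _%:R).
    have -> // : (s == s * eta^-1)%g = (eta == 1%g).
    by rewrite -{1}[s]mulg1 (inj_eq (mulgI s)) eq_sym eq_invg1.
  apply: eq_tlift => a b; rewrite th_mul.
  apply: eq_bigr => s _; rewrite SP invMg invgK.
  rewrite (bigD1 (s * eta^-1)%g) //= eqxx mulr1 big1 ?addr0 //.
  by move=> u /negPf->; rewrite mulr0.
pose HH : hopf_algebra K := @HopfAlgebra K H D e S c_assoc c_l c_r c_one c_mul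
  e_one e_mul S_l S_r.
have coc : cocommutative HH.
  move=> h; apply: t2inj => s u; rewrite (lin_tlift (T2_lin s u)) DP.
  transitivity (tlift (fun a b => theta a u * theta b s) (D h)).
    by apply: eq_tlift => a b; rewrite T2_tens mulrC.
  by rewrite D2 eq_sym; case: eqP => [->|].
have A1 x : A 1 x = x.
  apply: val_inj; rewrite /= AP (bigD1 1%g) //= th_one eqxx mul1r big1 ?addr0; last first.
    by move=> s /negPf s1; rewrite th_one s1 mul0r.
  rewrite (@embE _ _ _ 1%g 1%g) ?gal_id ?(valP x) //.
  by rewrite /coset_at invg1 perm1 rcoset1.
have AM (h k : H) x : A (h * k) x = A h (A k x).
  apply: val_inj; rewrite /= !AP.
  transitivity (\sum_s theta h s * \sum_t theta k t * emb L (t * s)%g (vsval x)).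
    under eq_bigr do rewrite th_mul mulr_suml.
    rewrite exchange_big; apply: eq_bigr => s _; rewrite mulr_sumr.
    rewrite (reindex_inj (mulIg s)); apply: eq_bigr => t _.
    by rewrite /= mulgK mulrA.
  apply: eq_bigr => s _.
  have [sN|sN] := boolP (s \in N); last by rewrite out ?mul0r.
  congr (_ * _); have sE := coset_atE gpN sN.
  set g : gT := repr _ in sE.
  transitivity (g (\sum_t theta k t * emb L t (vsval x))); last by [].
  rewrite rmorph_sum (reindex_inj (conjg_inj (lam g))); apply: eq_bigr => t _.
  rewrite rmorphM /= (th_equiv lamN th_fix).
  have [tN|tN] := boolP (t \in N); last by rewrite out // rmorph0 !mul0r.
  have := coset_atM gpN sN sE tN; rewrite (coset_atE gpN tN) -rcosetM.
  by move/embE->; rewrite ?galMx // (valP x).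
have A_one (h : H) : A h 1 = (e h : K)%:A.
  apply: val_inj; rewrite /= AP algid1 eP; apply: eq_bigr => s _.
  by rewrite /emb /= algid1 rmorph1 mulr1.
have A_mul (h : H) x y : A h (x * y) = tlift (fun a b => A a x * A b y) (D h).
  apply: val_inj; rewrite /= AP (lin_tlift (f := vsval)); last exact: linearP.
  transitivity (tlift (fun a b => \sum_s \sum_u (theta a s * theta b u) *
      (emb L s (vsval x) * emb L u (vsval y))) (D h)).
    by rewrite DF; apply: eq_bigr => s _; rewrite /emb rmorphM.
  apply: eq_tlift => a b; rewrite /= !AP mulr_suml; apply: eq_bigr => s _.
  by rewrite mulr_sumr; apply: eq_bigr => u _; rewrite mulrACA.
have bij : bijective (fun t : tensor (subvs_of L) H =>
    tlift (fun (x : subvs_of L) (h : H) => linfun (fun y => x * A h y)) t : 'End(subvs_of L)).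
  have [f fE] := linfun_of (tlift_linear
    (fun (x : subvs_of L) (h : H) => linfun (fun y => x * A h y) : 'End(subvs_of L))).
  apply: (fun b => eq_bij b fE); apply: lker0_bij => [t|].
    rewrite fE => t0; pose a eta := tlift (fun x h => vsval x * theta h eta) t.
    have a_out eta : eta \notin N -> a eta = 0.
      move=> etaN; rewrite -(mul0r (tlift (fun=> fun=> 0 : E) t)) -tlift_mull.
      by apply: eq_tlift => x h; rewrite out ?mulr0.
    have a0 eta : a eta = 0.
      have [etaN|/a_out//] := boolP (eta \in N).
      apply: (emb_indep galE gpN (a := a)) etaN => y yL.
      pose Y : subvs_of L := Subvs yL.
      have vYl : linear (fun f : 'End(subvs_of L) => vsval (f Y)).
        by move=> k u v; rewrite !lfun_simp linearP.
      have := congr1 (fun f : 'End(subvs_of L) => vsval (f Y)) t0.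
      rewrite (lin_tlift vYl) zero_lfunE linear0 => t0Y.
      rewrite -[RHS]t0Y big_mkcond.
      transitivity (\sum_eta0 a eta0 * emb L eta0 y).
        by apply: eq_bigr => eta0 _; case: ifPn => // /a_out->; rewrite mul0r.
      under eq_bigr do rewrite -tlift_mulr.
      rewrite -tlift_sumf; apply: eq_tlift => x h.
      rewrite linfun_linE => [|k u v]; last by rewrite linearP mulrDr scalerAr.
      by rewrite /= AP mulr_sumr; apply: eq_bigr => eta0 _; rewrite mulrA.
    suff : ((t : 'M_(_, _))^T : tensor H (subvs_of L)) = 0.
      by move/(congr1 trmx); rewrite trmxK trmx0.
    apply: (tensor_inj (phi := theta) (psi := fun x (_ : unit) => vsval x) _ free).
    - by move=> _; apply: linearP.
    - by move=> v /(_ tt) v0; apply: val_inj.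
    move=> eta _; rewrite -[RHS](a0 eta) /a [RHS]tlift_tr.
    by apply: eq_tlift => h x; rewrite mulrC.
  have dH := th_dim galE lamN th_lin th_fix th_bij.
  rewrite (card_gp galE gpN) in dH.
  have dL : \dim {:subvs_of L} = \dim L by rewrite dimvf.
  rewrite [LHS]dimvf [RHS]dimvf.
  transitivity (\dim {:subvs_of L} * \dim {:H})%N; first by [].
  by rewrite dH dL.
pose S0 := @HopfGalois K (subvs_of L) HH A coc A1 AM A_one A_mul bij.
exists S0, theta; split=> //.
- split=> // h k eta; rewrite th_mul [RHS]big_mkcond; apply: eq_bigr => s _.
  case: ifPn => [sN|sN]; last by rewrite out ?mul0r.
  have [tN|tN] := boolP (eta * s^-1 \in N)%g.
    rewrite (bigD1 (eta * s^-1)%g) /= ?tN ?mulgKV ?eqxx // big1 ?addr0 //.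
    by move=> t /andP[/andP[_ /eqP<-]]; rewrite mulgK eqxx.
  rewrite [theta k _]out // mulr0 big1 // => t /andP[tN' /eqP ets].
  by rewrite -ets mulgK tN' in tN.
- split=> // h; transitivity (\sum_eta theta h eta); last by rewrite -eP.
  by rewrite big_mkcond; apply: eq_bigr => eta _; case: ifPn => // /out->.
- by move=> h x; rewrite /= AP -sumN.
Qed.

End HopfGaloisOfDescent.

(** * The correspondence of Greither and Pareigis *)

Section GroupAlgebra.

Variables (K : fieldType) (E : fieldExtType K) (gT : finGroupType).

(** The group algebra of gT over E, in which the product of the elements s and t
    of gT is the element t * s: this is the order of functional composition when
    permutations are multiplied in diagrammatic order. *)
Definition galgebra := {ffun gT -> E}.

HB.instance Definition _ := Vector.on galgebra.

Implicit Types x y z : galgebra.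

Definition gconv x y : galgebra := [ffun eta => \sum_s x s * y (eta * s^-1)%g].
Definition gconv1 : galgebra := [ffun eta => (eta == 1%g)%:R].

Fact gconvA : associative gconv.
Proof.
move=> x y z; apply/ffunP=> eta; rewrite !ffunE.
transitivity (\sum_s \sum_t x s * y t * z (eta * s^-1 * t^-1)%g).
  by apply: eq_bigr => s _; rewrite ffunE mulr_sumr; apply: eq_bigr => t _; rewrite mulrA.
transitivity (\sum_s \sum_u x s * y (u * s^-1)%g * z (eta * u^-1)%g).
  apply: eq_bigr => s _; rewrite (reindex_inj (mulIg s^-1%g)).
  by apply: eq_bigr => t _; rewrite /= invMg invgK -mulgA mulKg.
rewrite exchange_big; apply: eq_bigr => u _ /=.
by rewrite ffunE mulr_suml.
Qed.

Fact gconv1x : left_id gconv1 gconv.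
Proof.
move=> x; apply/ffunP=> eta; rewrite ffunE (bigD1 1%g) //= ffunE eqxx mul1r invg1 mulg1.
by rewrite big1 ?addr0 // => s /negPf s1; rewrite ffunE s1 mul0r.
Qed.

Fact gconvx1 : right_id gconv1 gconv.
Proof.
move=> x; apply/ffunP=> eta; rewrite ffunE (bigD1 eta) //= ffunE mulgV eqxx mulr1.
by rewrite big1 ?addr0 // => s s1; rewrite ffunE -eq_mulgV1 eq_sym (negPf s1) mulr0.
Qed.

Fact gconvDl : left_distributive gconv +%R.
Proof.
move=> x y z; apply/ffunP=> eta; rewrite !ffunE -big_split.
by apply: eq_bigr => s _; rewrite ffunE mulrDl.
Qed.

Fact gconvDr : right_distributive gconv +%R.
Proof.
move=> x y z; apply/ffunP=> eta; rewrite !ffunE -big_split.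
by apply: eq_bigr => s _; rewrite ffunE mulrDr.
Qed.

Fact gconv1_neq0 : gconv1 != 0.
Proof. by apply/eqP => /ffunP/(_ 1%g)/eqP; rewrite !ffunE eqxx oner_eq0. Qed.

HB.instance Definition _ := GRing.Zmodule_isNzRing.Build galgebra
  gconvA gconv1x gconvx1 gconvDl gconvDr gconv1_neq0.

Fact gconvZl (k : K) x y : k *: (x * y) = (k *: x) * y.
Proof.
apply/ffunP=> eta; rewrite !ffunE scaler_sumr.
by apply: eq_bigr => s _; rewrite ffunE scalerAl.
Qed.

HB.instance Definition _ := GRing.Lmodule_isLalgebra.Build K galgebra gconvZl.

Fact gconvZr (k : K) x y : k *: (x * y) = x * (k *: y).
Proof.
apply/ffunP=> eta; rewrite !ffunE scaler_sumr.
by apply: eq_bigr => s _; rewrite ffunE scalerAr.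
Qed.

HB.instance Definition _ := GRing.Lalgebra_isAlgebra.Build K galgebra gconvZr.
HB.instance Definition _ := Algebra_isFalgebra.Build K galgebra.

Lemma galgebra1E eta : (1 : galgebra) eta = (eta == 1%g)%:R.
Proof. by rewrite ffunE. Qed.

Lemma galgebraME x y eta : (x * y) eta = \sum_s x s * y (eta * s^-1)%g.
Proof. by rewrite ffunE. Qed.

End GroupAlgebra.

Section GreitherPareigis.

Variables (K : fieldType) (E : splittingFieldType K).
Hypothesis galE : galois 1%AS {:E}.
Local Notation gT := (gal_of {:E}).
Local Notation pT := {perm {set gal_of {:E}}}.
Variables (L : {subfield E}).
Local Notation lam := (gal_lambda L).
Local Notation EP := (galgebra E pT).

Section Existence.

Variable N : {group pT}.
Hypothesis gpN : gp_subgroup L N.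
Let lamN := gp_lamN gpN.

Lemma fixed_subspace : exists V : {vspace EP},
  forall c : EP, c \in V <-> gp_fixed L N c.
Proof.
have [f fE] : exists f : 'Hom(EP, {ffun gT * pT -> E} : vectType K), forall c,
    f c = [ffun ge => if ge.2 \in N then c (ge.2 ^ lam ge.1)%g - ge.1 (c ge.2)
                      else c ge.2].
  apply: linfun_of => k c d; apply/ffunP=> -[g eta]; rewrite !ffunE /=.
  case: ifP => // _; rewrite linearP /= scalerBr.
  by rewrite addrACA opprD.
exists (lker f) => c; rewrite memv_ker fE; split=> [/eqP/ffunP c0|[c0 cfix]].
  split=> [eta etaN|g eta _ etaN].
    by have := c0 (1%g, eta); rewrite !ffunE /= (negPf etaN).
  by have /eqP := c0 (g, eta); rewrite !ffunE /= etaN subr_eq0 => /eqP.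
apply/eqP/ffunP=> -[g eta]; rewrite !ffunE /=.
case: ifPn => [etaN|/c0//]; by rewrite cfix ?mem_Gamma ?subrr.
Qed.

Lemma gp_fixed_equiv (c : pT -> E) g eta :
  gp_fixed L N c -> c (eta ^ lam g)%g = g (c eta).
Proof.
case=> c0 cfix; have [etaN|etaN] := boolP (eta \in N).
  by rewrite cfix ?mem_Gamma.
by rewrite !c0 ?memJ_lambda // rmorph0.
Qed.

(** The fixed points form a subalgebra of the group algebra of all the
    permutations of the subsets of the Galois group. *)
Lemma hopf_galois_of_subgroup : exists S : hopf_galois (subvs_of L),
  gp_corresponds S N.
Proof.
have [V VP] := fixed_subspace.
have V1 : 1 \in V.
  apply/VP; split=> [eta etaN|g eta gG _]; rewrite !galgebra1E.
    by case: eqP => // eta1; rewrite eta1 group1 in etaN.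
  by rewrite conjg_eq1 rmorph_nat.
have VM : {in V &, forall x y, x * y \in V}.
  move=> x y /VP xV /VP yV; apply/VP; have [x0 _] := xV; have [y0 _] := yV.
  split=> [eta etaN|g eta gG _]; rewrite !galgebraME.
    apply: big1 => s _; have [sN|/x0->] := boolP (s \in N); last by rewrite mul0r.
    by rewrite y0 ?mulr0 // groupMr ?groupV.
  rewrite rmorph_sum (reindex_inj (conjg_inj (lam g))); apply: eq_bigr => s _ /=.
  by rewrite rmorphM /= -conjVg -conjMg !(gp_fixed_equiv _ _ xV, gp_fixed_equiv _ _ yV).
have VA : is_aspace V by rewrite /is_aspace has_algid1 //; apply/prodvP.
pose A : {aspace EP} := ASpace VA.
pose theta (h : subvs_of A) (eta : pT) : E := (vsval h : EP) eta.
apply: (hopf_galois_exists galE gpN (H := subvs_of A) (theta := theta)).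
- by move=> eta k h h'; rewrite /theta linearP /= !ffunE.
- by move=> h; apply/VP; apply: (valP h).
- move=> c cP; have cV : ([ffun eta => c eta] : EP) \in A.
    apply/VP; have [c0 cfix] := cP.
    by split=> [eta etaN|g eta gG etaN]; rewrite !ffunE; [apply: c0|apply: cfix].
  exists (Subvs cV); split=> [eta|h hP]; first by rewrite /theta ffunE.
  by apply: val_inj; apply/ffunP=> eta; rewrite ffunE -hP.
- move=> eta; rewrite /theta (_ : vsval 1 = 1) ?galgebra1E //.
  by apply/eqP; rewrite [vsval 1]/(algid A) algid_eq1.
- by move=> h k eta; rewrite /theta /= galgebraME.
Qed.

(** Both Hopf algebras are identified with the same fixed points, and all the
    operations are expressed by the coefficients. *)
Lemma gp_corresponds_unique (S1 S2 : hopf_galois (subvs_of L)) :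
  gp_corresponds S1 N -> gp_corresponds S2 N -> hg_iso S1 S2.
Proof.
case=> th1 [lin1 [fix1 bij1] [one1 mul1] [com1 eps1 ant1] act1].
case=> th2 [lin2 [fix2 bij2] [one2 mul2] [com2 eps2 ant2] act2].
have inj1 := th_inj fix1 bij1; have inj2 := th_inj fix2 bij2.
have [f fP] : exists f : 'Hom(S1, S2), forall h, th2 (f h) =1 th1 h.
  apply: (hom_choice (R := fun h k => th2 k =1 th1 h)).
  - by move=> h; apply: (th_surj bij2).
  - move=> eta; have := lin_scaleE (lin1 eta) 0 0; have := lin_scaleE (lin2 eta) 0 0.
    by rewrite !scale0r => -> ->.
  - by move=> k h h' l l' hP hP' eta; rewrite lin1 lin2 hP hP'.
exists f; split.
- have [g gP] : exists g : 'Hom(S2, S1), forall h, th1 (g h) =1 th2 h.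
    apply: (hom_choice (R := fun h k => th1 k =1 th2 h)).
    + by move=> h; apply: (th_surj bij1).
    + move=> eta; have := lin_scaleE (lin1 eta) 0 0; have := lin_scaleE (lin2 eta) 0 0.
      by rewrite !scale0r => -> ->.
    + by move=> k h h' l l' hP hP' eta; rewrite lin1 lin2 hP hP'.
  exists g => h; first by apply: inj1 => eta; rewrite gP fP.
  by apply: inj2 => eta; rewrite fP gP.
- split=> [|h k]; apply: inj2 => eta; first by rewrite fP one1 one2.
  rewrite fP mul1 mul2; apply: eq_bigr => s _; apply: eq_bigr => t _.
  by rewrite !fP.
- split=> h; last first.
    have := eps1 h; under eq_bigr do rewrite -fP.
    rewrite eps2 => /eqP; rewrite -subr_eq0 -scalerBl scaler_eq0 oner_eq0 orbF.
    by rewrite subr_eq0 => /eqP.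
  apply: (tensor_eqP lin2 (th_free galE lamN lin2 fix2 bij2) (th_inj0 lin2 fix2 bij2)).
  move=> s u; rewrite com2 fP -com1.
  rewrite (lin_tlift (tlift_linear (fun x y => th2 x s * th2 y u))).
  by apply: eq_tlift => a b; rewrite (tlift_prod_tens lin2 lin2) !fP.
- by move=> h; apply: inj2 => eta; rewrite fP ant1 ant2 fP.
- by move=> h x; apply: val_inj; rewrite /= act1 act2; apply: eq_bigr => eta _; rewrite fP.
Qed.

End Existence.

(** Let phi : N1 -> N2 match the elements giving the same embedding of L. An
    isomorphism compatible with the actions preserves coefficients along phi, by
    independence of the embeddings. As the fixed points span E[N1] over E, it
    follows that phi is multiplicative; and then s and phi s permute the cosets
    in the same way. *)
Lemma gp_corresponds_inj N1 N2 (S1 S2 : hopf_galois (subvs_of L)) :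
    gp_subgroup L N1 -> gp_subgroup L N2 ->
    gp_corresponds S1 N1 -> gp_corresponds S2 N2 -> hg_iso S1 S2 ->
  N1 = N2.
Proof.
wlog suff: N1 N2 S1 S2 / gp_subgroup L N1 -> gp_subgroup L N2 ->
    gp_corresponds S1 N1 -> gp_corresponds S2 N2 -> hg_iso S1 S2 -> N1 \subset N2.
  move=> th g1 g2 c1 c2 [f [[g fK gK] [f1 fM] [fD fe] fS fA]].
  have s12 : N1 \subset N2 by apply: th c2 _ => //; [exact: c1 | exists f; split=> //; exists g].
  apply/val_inj/eqP; rewrite eqEcard s12 /=.
  by rewrite (card_gp galE g1) (card_gp galE g2).
move=> g1 g2.
case=> th1 [lin1 [fix1 bij1] [one1 mul1] [com1 eps1 ant1] act1].
case=> th2 [lin2 [fix2 bij2] [one2 mul2] [com2 eps2 ant2] act2].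
case=> f [_ [f1 fM] _ _ fA].
have [phi phiP] : exists phi : pT -> pT, forall eta, eta \in N1 ->
    phi eta \in N2 /\ coset_at L (phi eta) = coset_at L eta.
  apply: (@fin_all_exists _ _ (fun eta y => eta \in N1 -> y \in N2 /\ coset_at L y = coset_at L eta)).
  move=> eta; have [etaN|_] := boolP (eta \in N1); last by exists 1%g.
  by have [y yN ye] := coset_at_surj g2 (coset_at_in g1 etaN); exists y.
have phiN eta : eta \in N1 -> phi eta \in N2 by move=> /phiP[].
have phic eta : eta \in N1 -> coset_at L (phi eta) = coset_at L eta by move=> /phiP[].
have phi_inj : {in N1 &, injective phi}.
  move=> s t sN tN e; apply: (coset_at_inj g1) => //.
  by rewrite -(phic s) // e phic.
have phi_im : phi @: N1 = N2.
  apply/eqP; rewrite eqEcard card_in_imset // (card_gp galE g1) (card_gp galE g2) leqnn.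
  by rewrite andbT; apply/subsetP=> _ /imsetP[eta etaN ->]; apply: phiN.
have thE h eta : eta \in N1 -> th2 (f h) (phi eta) = th1 h eta.
  move=> etaN; apply/eqP; rewrite -subr_eq0; apply/eqP.
  apply: (emb_indep galE g1 (a := fun eta => th2 (f h) (phi eta) - th1 h eta)) etaN.
  move=> x xL; pose X : subvs_of L := Subvs xL.
  under eq_bigr do rewrite mulrBl.
  rewrite sumrB; apply/eqP; rewrite subr_eq0; apply/eqP.
  have := congr1 vsval (fA h X); rewrite act1 act2 /= => <-.
  rewrite -phi_im big_imset //=; apply: eq_bigr => eta' eta'N.
  by congr (_ * gal_repr (repr _) x); apply: esym (phic _ _).
have phiM s t : s \in N1 -> t \in N1 -> phi (t * s)%g = (phi t * phi s)%g.
  move=> sN tN.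
  (* The obstruction to phi (t * s) = phi t * phi s: it is killed by the products of
     the coefficients of fixed points, hence vanishes by [th_span]. *)
  pose w s' t' : E := (t' * s' == t * s)%g%:R - (phi t' * phi s' == phi (t * s))%g%:R.
  have tsN : (t * s)%g \in N1 by rewrite groupM.
  have w0 h k : \sum_(s' in N1) \sum_(t' in N1) th1 h s' * th1 k t' * w s' t' = 0.
    transitivity (th1 (h * k) (t * s)%g - th2 (f h * f k) (phi (t * s)%g)); last first.
      by rewrite -fM thE // subrr.
    rewrite mul1 mul2 -phi_im big_imset //= -sumrB; apply: eq_bigr => s' s'N.
    rewrite [X in _ - X]big_mkcondr [X in _ - X]big_imset //= big_mkcondr -sumrB.
    apply: eq_bigr => t' t'N; rewrite !thE // /w.
    by do 2!case: eqP => _; rewrite ?subrr ?mulr0 ?subr0 ?sub0r ?mulr1 ?mulrN1.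
  have [C CP] := th_span (gp_lamN g1) lin1 bij1 sN.
  have [D DP] := th_span (gp_lamN g1) lin1 bij1 tN.
  have : w s t = 0.
    transitivity (\sum_i \sum_j C i * D j * \sum_(s' in N1) \sum_(t' in N1)
        th1 (vbasis {:S1})`_i s' * th1 (vbasis {:S1})`_j t' * w s' t'); last first.
      by apply: big1 => i _; apply: big1 => j _; rewrite w0 mulr0.
    transitivity (\sum_(s' in N1) \sum_(t' in N1) (s == s')%:R * (t == t')%:R * w s' t').
      rewrite (bigD1 s) //= [X in _ + X]big1 => [|s' /andP[_ /negPf]]; last first.
        by rewrite eq_sym => ->; apply: big1 => t' _; rewrite !mul0r.
      rewrite addr0 (bigD1 t) //= [X in _ + X]big1 => [|t' /andP[_ /negPf]]; last first.
        by rewrite eq_sym => ->; rewrite mulr0 mul0r.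
      by rewrite !eqxx !mul1r addr0.
    rewrite [RHS](eq_bigr (fun i => \sum_(s' in N1) \sum_(t' in N1)
        C i * th1 (vbasis {:S1})`_i s' * (t == t')%:R * w s' t')) => [|i _].
      rewrite [RHS]exchange_big; apply: eq_bigr => s' _; rewrite [RHS]exchange_big.
      by apply: eq_bigr => t' _; rewrite -CP !mulr_suml.
    under eq_bigr do rewrite mulr_sumr.
    rewrite exchange_big; apply: eq_bigr => s' _ /=.
    under eq_bigr do rewrite mulr_sumr.
    rewrite exchange_big; apply: eq_bigr => t' _ /=.
    rewrite -DP mulr_sumr mulr_suml; apply: eq_bigr => j _.
    by rewrite !mulrA; congr (_ * _ * _); rewrite mulrAC.
  rewrite /w eqxx; case: eqP => // _ /eqP.
  by rewrite subr0 oner_eq0.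
apply/subsetP=> t tN; suff -> : t = phi t by apply: phiN.
apply/permP=> A; have [AX|AX] := boolP (A \in gal_cosets L); last first.
  have [[on1 _ _] _] := g1; have [[on2 _ _] _] := g2.
  by rewrite (out_perm (on1 _ tN)) // (out_perm (on2 _ (phiN _ tN))).
have [s sN <-] := coset_at_surj g1 AX.
have ets (u v : pT) : v (coset_at L u) = coset_at L (v^-1 * u)%g.
  by rewrite /coset_at invMg invgK permM.
have tsN : (t^-1 * s)%g \in N1 by rewrite groupM ?groupV.
rewrite ets -(phic _ tsN) -(phic _ sN) ets; congr (coset_at L _).
by apply: (mulgI (phi t)); rewrite -phiM // !mulKVg.
Qed.

Lemma num_hopf_galois_card (hT : finGroupType) (M : {group hT})
    (A : {set {group pT}}) :
    (forall N, N \in A <-> gp_subgroup L N /\ N \isog M) ->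
  num_hopf_galois L M #|A|.
Proof.
move=> AP; have AN (i : 'I_#|A|) := proj1 (AP _) (enum_valP i).
have /fin_all_exists[S SP] : forall i : 'I_#|A|, exists S : hopf_galois (subvs_of L),
    gp_corresponds S (enum_val i).
  by move=> i; apply: hopf_galois_of_subgroup; case: (AN i).
exists S; split=> [i|i j Sij|S' [N [gN cN NM]]].
- by exists (enum_val i); have [] := AN i.
- apply: enum_val_inj.
  exact: (gp_corresponds_inj (proj1 (AN i)) (proj1 (AN j)) (SP i) (SP j) Sij).
have NA : N \in A by apply/AP.
exists (enum_rank_in NA N); apply: (gp_corresponds_unique gN cN).
by have := SP (enum_rank_in NA N); rewrite enum_rankK_in.
Qed.

End GreitherPareigis.

(** * Every permutation group is a Galois group *)

(** A finite group of automorphisms of a field, with an element whose conjugates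
    under the group are distinct: such an element generates the field over the
    invariants. *)
Record field_action := FieldAction {
  fa_field : fieldType;
  fa_type : finGroupType;
  fa_group : {group fa_type};
  fa_act : fa_type -> {rmorphism fa_field -> fa_field};
  fa_actM : forall g h x, fa_act (g * h)%g x = fa_act h (fa_act g x);
  fa_act1 : forall x, fa_act 1%g x = x;
  fa_gen : fa_field;
  fa_gen_inj : {in fa_group &, injective (fun g => fa_act g fa_gen)}
}.

Section Artin.

Variable A : field_action.
Local Notation F := (fa_field A).
Local Notation G := (fa_group A).
Local Notation act := (@fa_act A).
Local Notation x0 := (fa_gen A).
Local Notation m := #|G|.

Definition inv_pred : {pred F} := fun x => [forall g in G, act g x == x].

Lemma inv_predP x : reflect (forall g, g \in G -> act g x = x) (x \in inv_pred).
Proof. exact: 'forall_in_eqP. Qed.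

Fact inv_divring_closed : divring_closed inv_pred.
Proof.
split=> [|x y /inv_predP xG /inv_predP yG|x y /inv_predP xG /inv_predP yG].
- by apply/inv_predP=> g _; rewrite rmorph1.
- by apply/inv_predP=> g gG; rewrite rmorphB /= xG ?yG.
- by apply/inv_predP=> g gG; rewrite fmorph_div /= xG ?yG.
Qed.

HB.instance Definition _ := GRing.isDivringClosed.Build F inv_pred inv_divring_closed.

Record inv_field := InvField { inv_val : F; inv_valP : inv_val \in inv_pred }.
HB.instance Definition _ := [isSub for inv_val].
HB.instance Definition _ := [Choice of inv_field by <:].
HB.instance Definition _ := [SubChoice_isSubIntegralDomain of inv_field by <:].
HB.instance Definition _ := [SubIntegralDomain_isSubField of inv_field by <:].

(** A copy of F, to carry its structure over the field of invariants. *)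
Definition inv_ext : Type := F.
HB.instance Definition _ := GRing.Field.on inv_ext.

Local Notation K := inv_field.
Local Notation E := inv_ext.

Definition inv_scale (a : K) (u : E) : E := inv_val a * u.

Fact inv_scaleA a b u : inv_scale a (inv_scale b u) = inv_scale (a * b) u.
Proof. exact: mulrA. Qed.
Fact inv_scale1 u : inv_scale 1 u = u.
Proof. exact: mul1r. Qed.
Fact inv_scaleDr a u v : inv_scale a (u + v) = inv_scale a u + inv_scale a v.
Proof. exact: mulrDr. Qed.
Fact inv_scaleDl v a b : inv_scale (a + b) v = inv_scale a v + inv_scale b v.
Proof. exact: mulrDl. Qed.
HB.instance Definition _ := GRing.Zmodule_isLmodule.Build K E
  inv_scaleA inv_scale1 inv_scaleDr inv_scaleDl.

Lemma inv_scaleE a (u : E) : a *: u = inv_val a * u :> F. Proof. by []. Qed.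

Fact inv_scaleAl a (u v : E) : a *: (u * v) = (a *: u) * v.
Proof. exact: mulrA. Qed.
HB.instance Definition _ := GRing.Lmodule_isLalgebra.Build K E inv_scaleAl.
Fact inv_scaleAr a (u v : E) : a *: (u * v) = u * (a *: v).
Proof. exact: mulrCA. Qed.
HB.instance Definition _ := GRing.Lalgebra_isAlgebra.Build K E inv_scaleAr.

(* An element y is the value at x0 of the polynomial of degree less than m which
   takes the value g y at g x0 for every g in G. By uniqueness of the interpolation
   its coefficients are invariant. So the first m powers of x0 are a basis. *)
Let V : 'M[F]_m := Vandermonde m (\row_i act (enum_val i) x0).

Let V_unit : V \in unitmx.
Proof.
rewrite unitmxE det_Vandermonde unitfE; apply/prodf_neq0 => i _.
apply/prodf_neq0 => j ij; rewrite subr_eq0 !mxE.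
apply: contraTneq ij => /(fa_gen_inj (enum_valP j) (enum_valP i))/enum_val_inj->.
by rewrite ltnn.
Qed.

Let VE (c : 'rV[F]_m) i :
  (c *m V) 0 i = \sum_(j < m) c 0 j * act (enum_val i) x0 ^+ j.
Proof. by rewrite mxE; apply: eq_bigr => j _; rewrite !mxE. Qed.

Let V_inj (c d : 'rV[F]_m) :
    (forall g, g \in G -> \sum_(j < m) c 0 j * act g x0 ^+ j
                       = \sum_(j < m) d 0 j * act g x0 ^+ j) -> c = d.
Proof.
move=> cd; rewrite -[c](mulmxK V_unit) -[d](mulmxK V_unit); congr (_ *m _).
by apply/rowP=> i; rewrite !VE cd ?enum_valP.
Qed.

Let r2v (v : 'rV[K]_m) : E := \sum_(j < m) v 0 j *: (x0 ^+ j : E).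

Let r2vE (v : 'rV[K]_m) g : g \in G ->
  act g (r2v v) = \sum_(j < m) (map_mx inv_val v) 0 j * act g x0 ^+ j.
Proof.
move=> gG; rewrite rmorph_sum; apply: eq_bigr => j _ /=.
by rewrite inv_scaleE rmorphM rmorphXn /= mxE (inv_predP _ (inv_valP _)).
Qed.

Let r2v_surj (y : E) : exists v : 'rV[K]_m, y = r2v v.
Proof.
have [c cP] : exists c : 'rV[F]_m, forall g, g \in G ->
    \sum_(j < m) c 0 j * act g x0 ^+ j = act g y.
  exists ((\row_i act (enum_val i) y) *m invmx V) => g gG.
  by rewrite -(enum_rankK_in gG gG) -VE mulmxKV // mxE.
have c_inv j : c 0 j \in inv_pred.
  apply/inv_predP=> h hG; pose d := map_mx (act h) c.
  suff dc : d = c by rewrite -[in RHS]dc /d mxE.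
  apply: V_inj => g gG; rewrite cP // -[in LHS](mulgKV h g) -[in RHS](mulgKV h g).
  rewrite [RHS]fa_actM -cP ?groupM ?groupV // rmorph_sum; apply: eq_bigr => i _.
  by rewrite rmorphM rmorphXn /= -fa_actM /d mxE.
exists (\row_j InvField (c_inv j)); rewrite -[y]fa_act1 -cP //.
by apply: eq_bigr => j _; rewrite mxE fa_act1.
Qed.

Fact inv_ext_vect : Lmodule_hasFinDim K E.
Proof.
have r2v_lin: linear r2v.
  move=> a u v; rewrite /r2v scaler_sumr -big_split /=; apply: eq_bigr => i _.
  by rewrite scalerA -scalerDl !mxE.
pose r2vL : {linear _ -> _} := HB.pack r2v (GRing.isLinear.Build _ _ _ _ r2v r2v_lin).
pose v2r x := sval (sig_eqW (r2v_surj x)).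
have v2rK: cancel v2r r2vL by rewrite /v2r => x; case: (sig_eqW _).
suffices r2vK: cancel r2v v2r.
  by exists m, v2r; [apply: can2_linear v2rK | exists r2v].
move=> r; have e : r2v (v2r (r2v r)) = r2v r by apply: v2rK.
apply/rowP=> j; apply: val_inj.
have : map_mx inv_val (v2r (r2v r)) = map_mx inv_val r.
  by apply: V_inj => g gG; rewrite -!r2vE // e.
by move=> /matrixP/(_ 0 j); rewrite !mxE.
Qed.

HB.instance Definition _ := inv_ext_vect.
HB.instance Definition _ := GRing.UnitAlgebra.on inv_ext.

Lemma inv_ext_base (c : F) : c \in inv_pred -> (c : E) \in 1%VS.
Proof. by move=> cP; apply/vlineP; exists (InvField cP); apply: esym; apply: mulr1. Qed.

Definition gen_poly : {poly E} := \prod_(g in G) ('X - (act g x0)%:P).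

Lemma gen_poly_inv (h : fa_type A) : h \in G ->
  map_poly (act h) (gen_poly : {poly F}) = (gen_poly : {poly F}).
Proof.
move=> hG; rewrite /gen_poly rmorph_prod [RHS](reindex_inj (mulIg h)) /=.
apply: eq_big => [g|g gG]; first by rewrite groupMr.
by rewrite rmorphB /= map_polyX map_polyC /= fa_actM.
Qed.

Lemma gen_poly_over : gen_poly \is a polyOver 1%VS.
Proof.
apply/polyOverP=> i; apply: inv_ext_base; apply/inv_predP=> h hG.
by rewrite -[in RHS](gen_poly_inv hG) coef_map.
Qed.

Let gen_roots : seq E := [seq act g x0 | g in G].

Let gen_polyE : gen_poly = \prod_(y <- gen_roots) ('X - y%:P).
Proof. by rewrite big_image. Qed.

Lemma gen_poly_splits : splittingFieldFor 1 gen_poly {:E}.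
Proof.
exists gen_roots; first by rewrite gen_polyE eqpxx.
apply/eqP; rewrite eqEsubv subvf; apply/subvP=> y _.
have [v ->] := r2v_surj y; apply: rpred_sum => j _; apply/rpredZ/rpredX.
apply: seqv_sub_adjoin; apply/imageP; exists 1%g; rewrite ?group1 //.
by rewrite fa_act1.
Qed.

Lemma gen_poly_separable : separable_poly gen_poly.
Proof.
rewrite gen_polyE separable_prod_XsubC map_inj_in_uniq ?enum_uniq // => g h.
by rewrite !mem_enum; apply: fa_gen_inj.
Qed.

Fact inv_ext_splitting : splitting_field_axiom E.
Proof. by exists gen_poly; [apply: gen_poly_over | apply: gen_poly_splits]. Qed.

HB.instance Definition _ := FieldExt_isSplittingField.Build K E inv_ext_splitting.

Lemma inv_ext_galois : galois 1%AS {:E}.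
Proof.
apply/splitting_galoisField; exists gen_poly.
by split; [apply: gen_poly_over | apply: gen_poly_separable | apply: gen_poly_splits].
Qed.

Lemma inv_ext_gal (g : fa_type A) : g \in G ->
  exists y : gal_of {:E}, forall x : E, y x = act g x.
Proof.
move=> gG.
have [f fE] : exists f : 'End(E), f =1 (act g : E -> E).
  apply: linfun_of => a u v; rewrite rmorphD /=; congr (_ + _).
  by rewrite !inv_scaleE rmorphM /= (inv_predP _ (inv_valP a)).
have fH : kAut 1 {:E} f.
  rewrite kAutfE; apply/kHom_monoid_morphism.
  by split=> [|x y]; rewrite !fE ?rmorph1 ?rmorphM.
have [y _ yE] := kAut_to_gal fH.
by exists y => x; rewrite -yE ?memvf.
Qed.

(** An automorphism over the invariants maps x0 to a root of [gen_poly], that is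
    to g x0 for some g in G, and it is determined by this image. *)
Lemma inv_ext_isom : exists f : {morphism G >-> gal_of {:E}}, isom G (Gamma E) f.
Proof.
have /fin_all_exists[phi phiE] : forall g : fa_type A, exists y : gal_of {:E},
    g \in G -> forall x : E, y x = act g x.
  move=> g; have [gG|_] := boolP (g \in G); last by exists 1%g.
  by have [y yE] := inv_ext_gal gG; exists y.
have phiM : {in G &, {morph phi : g h / (g * h)%g}}.
  move=> g h gG hG; apply/eqP/gal_eqP=> x _.
  by rewrite galMx !phiE ?groupM // fa_actM.
exists (Morphism phiM); apply/isomP; split.
  apply/injmP=> g h gG hG /= e; apply: (fa_gen_inj gG hG) => /=.
  by rewrite -!phiE // e.
apply/setP=> y; rewrite mem_Gamma; apply/imsetP.
have : root gen_poly (y (x0 : E)).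
  have pE : map_poly y gen_poly = gen_poly.
    exact: (fixedPoly_gal (sub1v {:E}) (mem_Gamma y) gen_poly_over).
  rewrite -[X in root X _]pE /root horner_map fmorph_eq0 -/(root _ _).
  rewrite /gen_poly (bigD1 1%g) //= rootM root_XsubC fa_act1 eqxx //.
rewrite /root /gen_poly horner_prod => /prodf_eq0[g gG].
rewrite hornerXsubC subr_eq0 => /eqP yg.
exists g; rewrite ?setIid //=; apply/eqP/gal_eqP=> z _; rewrite phiE //.
have [v ->] := r2v_surj z; rewrite r2vE // /r2v linear_sum; apply: eq_bigr => j _.
by rewrite linearZ /= inv_scaleE rmorphXn /= yg mxE.
Qed.

End Artin.

Section FractionMap.

Variable R : idomainType.

Lemma fractionP (x : {fraction R}) :
  x = FracField.tofrac \n_(generic_quotient.repr x) / FracField.tofrac \d_(generic_quotient.repr x).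
Proof.
have d0 : FracField.tofrac \d_(generic_quotient.repr x) != 0 by rewrite tofrac_eq0 denom_ratioP.
apply: (mulIf d0); rewrite mulfVK //.
rewrite -[X in X * _]generic_quotient.reprK; unlock FracField.tofrac; rewrite -[LHS]FracField.pi_mul.
apply/eqmodP; rewrite /= FracField.equivfE /FracField.mulf.
by rewrite !numden_Ratio ?mulf_neq0 ?oner_eq0 ?denom_ratioP // !mulr1 mulrC.
Qed.

Local Notation fr := (@FracField.tofrac R).
Variables (f : {rmorphism R -> R}) (f_inj : injective f).

Lemma fraction_map : exists g : {rmorphism {fraction R} -> {fraction R}},
  forall a, g (FracField.tofrac a) = FracField.tofrac (f a).
Proof.
pose g (x : {fraction R}) := fr (f \n_(generic_quotient.repr x)) / fr (f \d_(generic_quotient.repr x)).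
have f0 a : a != 0 -> fr (f a) != 0.
  by move=> a0; rewrite tofrac_eq0 -(rmorph0 f) (inj_eq f_inj).
have gE a b : b != 0 -> g (fr a / fr b) = fr (f a) / fr (f b).
  move=> b0; rewrite /g; set x := fr a / fr b.
  have d0 := denom_ratioP (generic_quotient.repr x).
  apply/eqP; rewrite eqr_div ?f0 // -!tofracM tofrac_eq -!rmorphM (inj_eq f_inj).
  rewrite -tofrac_eq !tofracM -eqr_div ?tofrac_eq0 //.
  by rewrite -fractionP.
have g1E a : g (fr a) = fr (f a).
  by rewrite -[fr a]divr1 -[1]tofrac1 gE ?oner_eq0 // !rmorph1 divr1.
have gB : zmod_morphism g.
  move=> x y; rewrite (fractionP x) (fractionP y).
  have dx := denom_ratioP (generic_quotient.repr x); have dy := denom_ratioP (generic_quotient.repr y).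
  rewrite -mulNr !addf_div ?tofrac_eq0 // -!tofracN -!tofracM -tofracD.
  rewrite !gE ?mulf_neq0 // -mulNr addf_div ?f0 //.
  by rewrite !(rmorphM, rmorphN, rmorphD).
have gM : monoid_morphism g.
  split=> [|x y]; first by rewrite -[1]tofrac1 g1E !rmorph1.
  rewrite (fractionP x) (fractionP y).
  have dx := denom_ratioP (generic_quotient.repr x); have dy := denom_ratioP (generic_quotient.repr y).
  rewrite mulf_div -!tofracM !gE ?mulf_neq0 // mulf_div.
  by rewrite !rmorphM.
pose gR : {rmorphism {fraction R} -> {fraction R}} := HB.pack g
  (GRing.isZmodMorphism.Build _ _ g gB) (GRing.isMonoidMorphism.Build _ _ g gM).
by exists gR; apply: g1E.
Qed.

End FractionMap.

Lemma fraction_morph_eq (R : idomainType) (S : fieldType)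
    (f g : {rmorphism {fraction R} -> S}) :
  (forall a, f (FracField.tofrac a) = g (FracField.tofrac a)) -> f =1 g.
Proof. by move=> fg x; rewrite (fractionP x) !fmorph_div !fg. Qed.

Section GenericRealisation.

Import mpoly.

(** The group acts on the rational functions in n variables by permuting the
    variables. *)
Lemma galois_realisation (n : nat) (G : {group 'S_n}) :
  exists (K : fieldType) (E : splittingFieldType K)
    (f : {morphism G >-> gal_of {:E}}), galois 1%AS {:E} /\ isom G (Gamma E) f.
Proof.
pose R : idomainType := {mpoly rat[n]}.
pose fr := @FracField.tofrac R.
have /fin_all_exists[act actE] : forall s : 'S_n,
    exists h : {rmorphism {fraction R} -> {fraction R}},
    forall a, h (fr a) = fr (msym s a).
  move=> s; exact: (fraction_map (f := msym s) (@inj_msym _ _ s)).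
have actM s t x : act (s * t)%g x = act t (act s x).
  apply: (fraction_morph_eq (g := act t \o act s)) => a /=.
  by rewrite !actE msymMm.
have act1 x : act 1%g x = x.
  by apply: (fraction_morph_eq (g := idfun)) => a /=; rewrite actE msym1m.
(* The monomial with exponents 0, 1, ..., n - 1 is moved by every permutation of
   the variables other than the identity. *)
pose m0 : multinom n := Multinom [tuple (i : nat) | i < n].
pose X m : R := mpolyX rat m.
have X_inj : injective X.
  move=> m1 m2 /(congr1 (mcoeff m1))/eqP.
  by rewrite !mcoeffX eqxx; case: (m2 =P m1) => //; rewrite oner_eq0.
have gen_inj : {in G &, injective (fun s => act s (fr (X m0)))}.
  move=> s t _ _ /=; rewrite !actE !msymX => /eqP.
  rewrite tofrac_eq => /eqP/X_inj e; apply: invg_inj; apply/permP=> i.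
  apply: val_inj; have := congr1 (fun m : multinom n => m i) e.
  by rewrite !mnmE.
pose A := FieldAction actM act1 gen_inj.
exists (inv_field A), (inv_ext A); have [f f_iso] := inv_ext_isom A.
by exists f; split; first exact: inv_ext_galois.
Qed.

End GenericRealisation.

(** * From coset spaces to symmetric groups *)

(** The elements of E separable over K form a normal subfield, which contains L,
    and hence is E. *)
Lemma sep_ext_galois (K : fieldType) (E : splittingFieldType K) (L : {subfield E}) :
  sep_ext L -> galois 1%AS {:E}.
Proof.
case=> sepL ncL; pose S := <<1; separable_generator 1%AS {:E}>>%AS.
have SP x : separable_element 1%AS x -> x \in S.
  move=> sepx; rewrite /S -separable_inseparable_element.
  have /purely_inseparableP-> := separable_generator_maximal {:E} 1; last exact: memvf.
  by rewrite (separable_elementS (sub1v _) sepx).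
have sepS : separable 1%AS S.
  by rewrite -adjoin_separable_eq separable_generatorP.
have LS : (L <= S)%VS.
  by apply/subvP=> x xL; apply: SP; apply: (separableP sepL).
have nS : normalField 1%AS S.
  apply/forall_inP=> f _.
  suff sub (g : 'AEnd(E)) : (g @: S <= S)%VS.
    by rewrite eqEdim sub limg_dim_eq ?leqnn // (eqP (AEnd_lker0 f)) capv0.
  apply/subvP=> _ /memv_imgP[y yS ->]; apply: SP.
  have gH : kHom 1 {:E} g by rewrite k1AHom.
  apply/separable_elementP; exists (minPoly 1 y); rewrite minPolyOver.
  split; [by []|apply: (kHom_root_id (sub1v {:E}) gH) | exact: (separableP sepS)].
  - exact: minPolyOver.
  - exact: memvf.
  - exact: root_minPoly.
have <- : (S : {vspace E}) = {:E}%VS by apply: ncL.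
by rewrite /galois sub1v sepS nS.
Qed.

Lemma perm_onT (T : finType) (s : {perm T}) : perm_on [set: T] s.
Proof. by apply/subsetP=> x _; rewrite inE. Qed.

Lemma regular_onTP n (N : {group 'S_n.+1}) :
  regular_on [set: 'I_n.+1] N <->
  [transitive N, on [set: 'I_n.+1] | 'P] && (#|N| == n.+1).
Proof.
have cardT : #|[set: 'I_n.+1]| = n.+1 by rewrite cardsT card_ord.
split=> [[_ tr st]|/andP[tr /eqP cN]].
  rewrite tr /= -(card_orbit_stab 'P N ord0) (atransP tr) ?inE // st ?inE //.
  by rewrite cardT cards1 muln1.
split=> // [s _|x _]; first exact: perm_onT.
have := card_orbit_stab 'P N x; rewrite (atransP tr) ?inE // cardT cN => /eqP.
by rewrite -[X in _ == X]muln1 eqn_pmul2l // => /eqP/card1_trivg.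
Qed.

Section PermTransport.

Variables (T1 T2 : finType) (phi : T1 -> T2) (phi_inj : injective phi).

(** The permutation s carried over by phi, extended by the identity outside the
    image of phi. *)
Definition perm_push_fun (s : {perm T1}) (y : T2) : T2 :=
  if [pick i | phi i == y] is Some i then phi (s i) else y.

Lemma perm_push_funE s i : perm_push_fun s (phi i) = phi (s i).
Proof.
rewrite /perm_push_fun; case: pickP => [j /eqP/phi_inj->//|/(_ i)].
by rewrite eqxx.
Qed.

Lemma perm_push_fun_out s y : y \notin phi @: setT -> perm_push_fun s y = y.
Proof.
move=> yphi; rewrite /perm_push_fun; case: pickP => // j /eqP yj.
by case/imsetP: yphi; exists j.
Qed.

Lemma perm_push_fun_inj s : injective (perm_push_fun s).
Proof.
apply: (can_inj (g := perm_push_fun s^-1)) => y.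
have [/imsetP[i _ ->]|yphi] := boolP (y \in phi @: setT).
  by rewrite !perm_push_funE permK.
by rewrite !perm_push_fun_out.
Qed.

Definition perm_push s : {perm T2} := perm (@perm_push_fun_inj s).

Lemma perm_pushE s i : perm_push s (phi i) = phi (s i).
Proof. by rewrite permE perm_push_funE. Qed.

Lemma perm_push_out s y : y \notin phi @: setT -> perm_push s y = y.
Proof. by move=> yphi; rewrite permE perm_push_fun_out. Qed.

Lemma perm_pushM : {in setT &, {morph perm_push : s t / (s * t)%g}}.
Proof.
move=> s t _ _; apply/permP=> y; rewrite permM.
have [/imsetP[i _ ->]|yphi] := boolP (y \in phi @: setT).
  by rewrite !perm_pushE permM.
by rewrite !perm_push_out.
Qed.
Canonical perm_push_morphism := Morphism perm_pushM.

Lemma perm_push_injm : 'injm perm_push.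
Proof.
apply/injmP=> s t _ _ e; apply/permP=> i; apply: phi_inj.
by rewrite -!perm_pushE [perm_push s]e.
Qed.

Lemma perm_push_on s : perm_on (phi @: setT) (perm_push s).
Proof.
apply/subsetP=> y; rewrite inE; apply: contraNT => /perm_push_out->.
by rewrite eqxx.
Qed.

Lemma perm_push_eq t (s : {perm T1}) : perm_on (phi @: setT) t ->
  (forall i, t (phi i) = phi (s i)) -> t = perm_push s.
Proof.
move=> ton ts; apply/permP=> y.
have [/imsetP[i _ ->]|yphi] := boolP (y \in phi @: setT).
  by rewrite ts perm_pushE.
by rewrite perm_push_out // (out_perm ton).
Qed.

Lemma perm_push_surj t : perm_on (phi @: setT) t -> exists s, t = perm_push s.
Proof.
move=> ton.
have /fin_all_exists[f fP] : forall i, exists j, t (phi i) = phi j.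
  move=> i; have : t (phi i) \in phi @: setT by rewrite (perm_closed _ ton) imset_f ?inE.
  by case/imsetP=> j _ ->; exists j.
have f_inj : injective f.
  by move=> i j /(congr1 phi); rewrite -!fP => /perm_inj/phi_inj.
by exists (perm f_inj); apply: perm_push_eq => // i; rewrite fP permE.
Qed.

Lemma perm_push_regular (N : {group {perm T1}}) :
  regular_on [set: T1] N <-> regular_on (phi @: setT) (perm_push @* N)%G.
Proof.
split=> [[_ tr st]|[_ tr st]]; split.
- by move=> _ /morphimP[s _ sN ->]; apply: perm_push_on.
- have [i0 _ i0tr] := imsetP tr; apply/imsetP; exists (phi i0); rewrite ?imset_f ?inE //.
  apply/setP=> y; apply/imsetP/imsetP => [[i _ ->]|[_ /morphimP[s _ sN ->] ->]].
    have : i \in orbit 'P N i0 by rewrite -i0tr inE.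
    case/orbitP=> s sN <-; exists (perm_push s); first by rewrite mem_morphim ?inE.
    by rewrite /= !apermE perm_pushE.
  by exists (s i0); rewrite ?inE //= apermE perm_pushE.
- move=> _ /imsetP[i _ ->]; apply/trivgP/subsetP=> t /setIP[/morphimP[s _ sN ->]].
  move/astab1P; rewrite /= apermE perm_pushE => /phi_inj si.
  have : s \in 'C_N[i | 'P] by rewrite inE sN; apply/astab1P.
  by rewrite st ?inE // => /eqP->; rewrite morph1.
- by move=> s _; apply: perm_onT.
- have [_ /imsetP[i0 _ ->] i0tr] := imsetP tr; apply/imsetP; exists i0; rewrite ?inE //.
  apply/setP=> i; rewrite inE; apply/esym/orbitP.
  have : phi i \in orbit 'P (perm_push @* N)%G (phi i0) by rewrite -i0tr imset_f ?inE.
  case/orbitP=> _ /morphimP[s _ sN ->]; rewrite /= apermE perm_pushE => /phi_inj si.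
  by exists s.
- move=> i _; apply/trivgP/subsetP=> s /setIP[sN /astab1P]; rewrite /= apermE => si.
  have : perm_push s \in 'C_(perm_push @* N)[phi i | 'P].
    apply/setIP; split; first by rewrite mem_morphim ?inE.
    apply/astab1P.
    by rewrite /= apermE perm_pushE si.
  rewrite st ?imset_f // => /set1P e.
  by apply/set1P/(injmP perm_push_injm); rewrite ?inE // [RHS]morph1.
Qed.

End PermTransport.

Lemma equivariant_bijection (n : nat) (G : {group 'S_n}) (K : fieldType)
    (E : splittingFieldType K) (L : {subfield E}) (x : 'I_n)
    (f : {morphism G >-> gal_of {:E}}) :
    perm_transitive G -> isom G (Gamma E) f -> f @* 'C_G[x | 'P] = Gamma' L ->
  exists phi : 'I_n -> {set gal_of {:E}},
    [/\ injective phi, phi @: setT = gal_cosets L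
      & forall g i, g \in G -> phi (g i) = gal_lambda L (f g) (phi i)].
Proof.
move=> tr /isomP[f_inj f_im] f_stab.
have /fin_all_exists[t tP] : forall i, exists g : 'S_n, g \in G /\ g x = i.
  move=> i; have [g gG ->] := atransP2 tr (in_setT x) (in_setT i).
  by exists g.
have tG i : t i \in G by case: (tP i).
have tx i : t i x = i by case: (tP i).
(* As (s * t) x = t (s x), the elements of G that send x to i form a right coset
   of the stabiliser of x. *)
pose phi i : {set gal_of {:E}} := (Gamma' L :* f (t i))%g.
have mem_stab g : g \in G -> (f g \in Gamma' L) = (g x == x).
  move=> gG; rewrite -f_stab; apply/idP/eqP=> [/morphimP[h hG]|gx].
    by case/setIP=> _ /astab1P hx /(injmP f_inj)-> //.
  by rewrite mem_morphim // inE gG; apply/astab1P.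
have phiE g i : g \in G -> g x = i -> phi i = (Gamma' L :* f g)%g.
  move=> gG gi; apply/rcoset_eqP; rewrite mem_rcoset -morphV // -morphM ?groupV //.
  by rewrite mem_stab ?groupM ?groupV // permM tx -gi permK.
exists phi; split=> [i j e||g i gG].
- have : f (t i) \in phi j by rewrite -e rcoset_refl.
  rewrite mem_rcoset -morphV // -morphM ?groupV // mem_stab ?groupM ?groupV //.
  by rewrite permM tx => /eqP/(canRL (permKV _)); rewrite tx.
- apply/setP=> A; apply/imsetP/rcosetsP => [[i _ ->]|[y]].
    by exists (f (t i)); rewrite ?mem_Gamma.
  rewrite -f_im => /morphimP[g _ gG ->] ->; exists (g x); rewrite ?inE //.
  by apply/esym/phiE.
rewrite gal_lambdaE; last by apply/rcosetsP; exists (f (t i)); rewrite ?mem_Gamma.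
by rewrite (phiE (t i * g)%g) ?groupM ?permM ?tx // morphM // rcosetM.
Qed.

Lemma injm_mem_norm (aT rT : finGroupType) (f : {morphism [set: aT] >-> rT})
  (A : {group aT}) s : 'injm f -> (f s \in 'N(f @* A)) = (s \in 'N(A)).
Proof.
move=> f_inj; apply/normP/normP=> [|As]; last by rewrite -morphimJ ?inE ?As.
rewrite -morphimJ ?inE // => /(injm_morphim_inj f_inj).
by apply; apply: subsetT.
Qed.

(** These subgroups correspond to the Hopf-Galois structures of cyclic type on an
    extension realising G. *)
Definition cyc_norm (n : nat) (G : {group 'S_n}) : {set {group 'S_n}} :=
  [set N : {group 'S_n} | [&& [transitive N, on [set: 'I_n] | 'P], #|N| == n,
     cyclic N & G \subset 'N(N)]].

Lemma isog_cyclic_group (n : nat) (gT : finGroupType) (N : {group gT}) : (1 < n)%N ->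
  (N \isog cyclic_group n) = cyclic N && (#|N| == n).
Proof.
move=> n1; have cZ : cyclic (cyclic_group n).
  by apply/cyclicP; exists Zp1; rewrite /= /Zp n1 Zp_cycle.
have oZ : #|cyclic_group n| = n by rewrite /= card_Zp // ltnW.
apply/idP/andP=> [iN|[cN /eqP oN]].
  by rewrite (isog_cyclic iN) cZ (card_isog iN) oZ.
by rewrite isog_cyclic_card // cZ oZ oN eqxx.
Qed.

Section Realisation.

Variables (n : nat) (G : {group 'S_n.+2}) (K : fieldType)
  (E : splittingFieldType K) (L : {subfield E}).
Hypothesis Gtr : perm_transitive G.
Hypothesis LG : realises L G.

Let galE : galois 1%AS {:E}.
Proof. by case: LG => /sep_ext_galois. Qed.

Lemma regular_transport : exists psi : {morphism [set: 'S_n.+2] >-> {perm {set gal_of {:E}}}},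
  'injm psi /\ forall N, gp_subgroup L N <->
    exists N0 : {group 'S_n.+2}, [/\ N = psi @* N0 :> {set _},
      regular_on [set: 'I_n.+2] N0 & G \subset 'N(N0)].
Proof.
have [_ [x [f [f_iso f_stab]]]] := LG.
have [phi [phi_inj phi_im phi_eq]] := equivariant_bijection Gtr f_iso f_stab.
have [f_inj f_im] := isomP f_iso.
exists (perm_push_morphism phi_inj); split=> [|N]; first exact: perm_push_injm.
have lamE g : g \in G -> gal_lambda L (f g) = perm_push_morphism phi_inj g.
  move=> gG; apply: perm_push_eq => [|i]; last by rewrite phi_eq.
  by rewrite phi_im; apply: restr_perm_on.
have lam_norm (N0 : {group 'S_n.+2}) : (forall g, g \in Gamma E ->
    gal_lambda L g \in 'N(perm_push phi_inj @* N0)) <-> G \subset 'N(N0).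
  have mem_norm g := injm_mem_norm N0 g (perm_push_injm phi_inj).
  split=> [lamN|/subsetP GN g].
    by apply/subsetP=> g gG; rewrite -mem_norm -lamE // lamN ?mem_Gamma.
  by rewrite -f_im => /morphimP[h _ hG ->]; rewrite lamE // mem_norm GN.
split=> [[Nreg Nlam]|[N0 [eN N0reg GN0]]].
  have Non s : s \in N -> perm_on (phi @: setT) s by rewrite phi_im; case: Nreg => + _ _; apply.
  pose N0 := (perm_push phi_inj @*^-1 N)%G.
  have eN : N = (perm_push phi_inj @* N0)%G.
    apply/val_inj; rewrite /= morphpreK //; apply/subsetP=> s /Non/(perm_push_surj phi_inj).
    by case=> t ->; rewrite mem_morphim ?inE.
  exists N0; split; first by rewrite {1}eN.
    by apply/(perm_push_regular phi_inj); rewrite phi_im -eN.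
  by apply/lam_norm => g gG; rewrite -[_ @* _]/(gval (_ @* N0)%G) -eN Nlam.
have -> : N = (perm_push phi_inj @* N0)%G by apply: val_inj.
split; last by apply/lam_norm.
by rewrite -phi_im; apply/perm_push_regular.
Qed.

Lemma realises_num_hopf_galois :
  num_hopf_galois L (cyclic_group n.+2) #|cyc_norm G|.
Proof.
have [psi [psi_inj psiP]] := regular_transport.
pose push (N0 : {group 'S_n.+2}) := (psi @* N0)%G.
have push_inj : injective push.
  move=> N1 N2 /(congr1 val) /= e; apply: val_inj.
  exact: (injm_morphim_inj psi_inj (subsetT _) (subsetT _) e).
rewrite -(card_imset _ push_inj); apply: num_hopf_galois_card => // N.
split=> [/imsetP[N0 N0A ->]|[/psiP[N0 [eN reg GN]] iso]].
  move: N0A; rewrite inE => /and4P[tr oN cN GN]; split.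
    by apply/psiP; exists N0; split=> //; apply/regular_onTP; rewrite tr.
  apply: isog_trans (_ : N0 \isog _); first by rewrite isog_sym sub_isog ?subsetT.
  by rewrite isog_cyclic_group // cN.
apply/imsetP; exists N0; last exact: val_inj.
have /regular_onTP/andP[tr oN] := reg; rewrite inE tr oN GN andbT /=.
have : N0 \isog cyclic_group n.+2.
  by apply: isog_trans iso; rewrite eN sub_isog ?subsetT.
by rewrite isog_cyclic_group // => /andP[].
Qed.

(** A regular normal subgroup of G is a normal complement of each point
    stabiliser. *)
Lemma realises_almost_classical (C : {group 'S_n.+2}) :
    [transitive C, on [set: 'I_n.+2] | 'P] -> #|C| = n.+2 -> C <| G ->
  almost_classically_galois L.
Proof.
move=> tr oC /andP[CG GC]; have [_ [x [f [f_iso f_stab]]]] := LG.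
have [f_inj f_im] := isomP f_iso.
have [_ _ st] : regular_on [set: 'I_n.+2] C by apply/regular_onTP; rewrite tr oC eqxx.
have cC : ('C_G[x | 'P] * C)%g = G.
  by apply/(subgroup_transitiveP (in_setT x) CG Gtr).
exists (f @* C)%G; split; first by rewrite -f_im morphim_normal //; apply/andP.
apply/complP; rewrite /= -f_stab -f_im; split.
  rewrite -injmI ?subsetIl //; first by rewrite setIAC (setIidPr CG) st ?inE // morphim1.
by rewrite -morphimMl ?subsetIl // cC.
Qed.

End Realisation.

(** Take for L the fixed field of a point stabiliser. Its normal closure is the
    whole field because a normal subgroup of a transitive group is trivial as
    soon as it fixes a point. *)
Lemma realisable (n : nat) (G : {group 'S_n}) (x : 'I_n) : perm_transitive G ->
  exists (K : fieldType) (E : splittingFieldType K) (L : {subfield E}), realises L G.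
Proof.
move=> tr; have [K [E [f [galE f_iso]]]] := galois_realisation G.
have [f_inj f_im] := isomP f_iso.
pose S := (f @* 'C_G[x | 'P])%G; pose L := [aspace of fixedField S] : {subfield E}.
have LS : Gamma' L = S by apply: val_inj; apply: gal_fixedField.
exists K, E, L; split; last by exists x, f; split=> //; rewrite LS.
have [_ sepE _] := and3P galE.
split; first by apply: separableSr sepE; apply: subvf.
move=> M LM nM.
have galM : galois M {:E} by apply: galoisS galE; rewrite sub1v subvf.
suff H1 : 'Gal({:E} / M)%g = 1%g.
  apply/eqP; rewrite eqEsubv subvf -(galois_fixedField galM) H1.
  apply/subvP=> y _; apply/fixedFieldP; rewrite ?memvf // => g /set1P->.
  by rewrite gal_id.
apply/trivgP/subsetP=> h hM.
have /morphimP[g _ gG eg] : h \in f @* G by rewrite f_im mem_Gamma.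
have nH : 'Gal({:E} / M)%g <| Gamma E by apply: (normalField_normal _ nM); rewrite sub1v subvf.
suff : g = 1%g by rewrite eg => ->; rewrite morph1 group1.
apply/permP=> i; rewrite perm1.
have [k kG ->] := atransP2 tr (in_setT x) (in_setT i).
have : f (g ^ k^-1)%g \in S.
  rewrite -LS (subsetP (galS {:E} LM)) // morphJ ?groupV // memJ_norm -?eg //.
  by apply: (subsetP (normal_norm nH)); apply: mem_Gamma.
case/morphimP=> k' k'G /setIP[_ /astab1P]; rewrite /= apermE => k'x.
move/(injmP f_inj)=> ek; rewrite -ek ?groupJ ?groupV // in k'x.
move: k'x; rewrite conjgE invgK !permM => /(canRL (permKV _)).
by rewrite /= !apermE.
Qed.

(** The number of structures of cyclic type is the same on all the extensions
    realising G, and by [realisable] there is one. *)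
Lemma realised_by_cyclicP (n : nat) (G : {group 'S_n.+2}) :
  realised_by_type n.+2 (cyclic_group n.+2) G <-> perm_transitive G /\ cyc_norm G != set0.
Proof.
have key K (E : splittingFieldType K) (L : {subfield E}) : perm_transitive G ->
    realises L G -> (cyc_norm G != set0 <->
    exists S : hopf_galois (subvs_of L), hg_type (cyclic_group n.+2) S).
  move=> tr LG; have [x [S1 S2 S3]] := realises_num_hopf_galois tr LG.
  split=> [|[S /S3[i _]]]; last by rewrite -card_gt0; apply: leq_ltn_trans (ltn_ord i).
  by rewrite -card_gt0 => c0; exists (x (Ordinal c0)).
split=> [[tr [K [E [L [LG LS]]]]]|[tr n0]]; first by split=> //; apply/(key _ _ _ tr LG).
have [K [E [L LG]]] := realisable ord0 tr.
by split=> //; exists K, E, L; split=> //; apply/(key _ _ _ tr LG).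
Qed.

(** * Subgroups of an abelian group with a cyclic subgroup of index two *)

Local Close Scope ring_scope.

Lemma size_divisors_coprime_pfactor (l r u : nat) : prime l -> 0 < u -> ~~ (l %| u) ->
  size (divisors (l ^ r * u)) = (r.+1 * size (divisors u))%N.
Proof.
move=> l_pr u0 lu; have l0 := prime_gt0 l_pr.
have m0 : 0 < l ^ r * u by rewrite muln_gt0 expn_gt0 l0.
pose s := [seq (l ^ i * d)%N | i <- iota 0 r.+1, d <- divisors u].
have <- : size s = (r.+1 * size (divisors u))%N by rewrite size_allpairs size_iota.
have ld d : d \in divisors u -> ~~ (l %| d).
  by rewrite -dvdn_divisors // => du; apply: contra lu => /dvdn_trans; apply.
apply/perm_size/uniq_perm; first exact: divisors_uniq.
  apply: allpairs_uniq; rewrite ?iota_uniq ?divisors_uniq //.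
  move=> [i d] [j e] /allpairsP[[i1 d1] [_ du [-> ->]]].
  move=> /allpairsP[[j1 e1] [_ eu [-> ->]]] ide; rewrite /= in du eu ide *.
  have d0 : 0 < d1 by move: (ld _ du); case: (d1) => //; rewrite dvdn0.
  have e0 : 0 < e1 by move: (ld _ eu); case: (e1) => //; rewrite dvdn0.
  have := congr1 (logn l) ide.
  rewrite !lognM ?expn_gt0 ?l0 // !pfactorK // (lognE l d1) (lognE l e1).
  rewrite (negPf (ld _ du)) (negPf (ld _ eu)) !andbF !addn0 => ij.
  by move: ide; rewrite ij => /eqP; rewrite eqn_pmul2l ?expn_gt0 ?l0 // => /eqP->.
move=> d; rewrite -dvdn_divisors //; apply/idP/allpairsP => [dm|[[i e] [+ + ->]]].
  have d0 := dvdn_gt0 m0 dm.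
  have [m lm dE] := pfactor_coprime l_pr d0.
  exists (logn l d, m); split; last by rewrite /= mulnC.
    rewrite mem_iota add0n ltnS; have := dvdn_leq_log l m0 dm.
    by rewrite lognM ?expn_gt0 ?l0 // pfactorK // (lognE l u) (negPf lu) !andbF addn0.
  rewrite -dvdn_divisors //.
  have : m %| l ^ r * u by apply: dvdn_trans dm; rewrite [in X in _ %| X]dE; apply: dvdn_mulr; apply: dvdnn.
  by rewrite Gauss_dvdr // coprimeXr // coprime_sym.
rewrite mem_iota add0n ltnS => ir; rewrite -dvdn_divisors // => eu.
by apply: dvdn_mul => //; apply: dvdn_exp2l.
Qed.

Lemma card_subgroups_cyclic (gT : finGroupType) (B : {group gT}) : cyclic B ->
  #|[set H : {group gT} | H \subset B]| = size (divisors #|B|).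
Proof.
move=> cB; set S := [set H : {group gT} | _].
have [b bB] := cyclicP cB.
have card_inj : {in S &, injective (fun H : {group gT} => #|H|)}.
  move=> H1 H2; rewrite !inE => H1B H2B /eqP e; apply/val_inj/eqP.
  by rewrite (eq_subG_cyclic cB).
rewrite cardE -(size_map (fun H : {group gT} => #|H|)); apply/perm_size/uniq_perm.
- by rewrite map_inj_in_uniq ?enum_uniq // => H1 H2; rewrite !mem_enum; apply: card_inj.
- exact: divisors_uniq.
move=> d; rewrite -dvdn_divisors ?cardG_gt0 //; apply/mapP/idP => [[H + ->]|dB].
  by rewrite mem_enum inE; apply: cardSg.
have ob : #|B| = #[b] by rewrite bB.
rewrite ob in dB; exists <[b ^+ (#[b] %/ d)]>%G; last first.
  by rewrite /= -orderE orderXdiv ?dvdn_div // divnA // mulKn ?order_gt0.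
by rewrite mem_enum inE /= bB cycle_subG groupX // cycle_id.
Qed.

Section SubgroupCount.

Variables (gT : finGroupType) (A : {group gT}) (b t : gT).
Hypotheses (cAA : abelian A) (bA : b \in A) (tA : t \in A).
Hypotheses (t_ord : #[t] = 2) (tb : t \notin <[b]>) (oA : #|A| = (2 * #[b])%N).
Hypothesis b_even : 2 %| #[b].
Local Notation B := <[b]>.
Local Notation B2 := <[b ^+ 2]>.

Let BA : B \subset A. Proof. by rewrite cycle_subG. Qed.
Let tt : t * t = 1. Proof. by rewrite -expg2 -t_ord expg_order. Qed.
Let comA x y : x \in A -> y \in A -> x * y = y * x.
Proof. by move=> xA yA; apply: (centsP cAA). Qed.

(* The subgroups H of A = <[t]> x B are sorted according to whether they lie in B,
   contain t, or neither. In each case H is determined by its intersection with B. *)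
Let A_split h : h \in A -> h \notin B -> exists2 c, c \in B & h = t * c.
Proof.
have iB : #|A : B| = 2 by rewrite -divgS // oA -orderE mulnK.
move=> hA hB; exists (t * h); last by rewrite mulgA tt mul1g.
have nB : B <| A by rewrite -sub_abelian_normal.
have oq : #|A / B| = 2 by rewrite card_quotient ?normal_norm.
have tN : t \in 'N(B) by apply: (subsetP (normal_norm nB)).
have hN : h \in 'N(B) by apply: (subsetP (normal_norm nB)).
have t1 : coset B t != 1 by apply: contra tb => /eqP/(coset_idr tN).
have h1 : coset B h != 1 by apply: contra hB => /eqP/(coset_idr hN).
apply: coset_idr; rewrite ?groupM // morphM //.
have : 1 |: [set coset B t; coset B h] \subset A / B.
  by rewrite !subUset !sub1set group1 !mem_quotient.
move/subset_leq_card; rewrite oq cardsU1 cards2 !inE.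
rewrite ![1 == _]eq_sym (negPf t1) (negPf h1) /=.
have [<- _|] := eqVneq (coset B t) (coset B h); last by [].
by rewrite -morphM // tt morph1.
Qed.

Let S0 := [set H : {group gT} | H \subset B].
Let S1 := [set H : {group gT} | (H \subset A) && (t \in H)].
Let S2 := [set H : {group gT} | [&& H \subset A, t \notin H & ~~ (H \subset B)]].

Let card_S1 : #|S1| = #|S0|.
Proof.
have f_inj : {in S1 &, injective (fun H : {group gT} => (H :&: B)%G)}.
  suff sub (H1 H2 : {group gT}) : H1 \in S1 -> H2 \in S1 ->
      (H1 :&: B = H2 :&: B) -> H1 \subset H2.
    move=> H1 H2 h1 h2 /(congr1 val) /= e.
    by apply/val_inj/eqP; rewrite eqEsubset !sub.
  rewrite !inE => /andP[H1A tH1] /andP[H2A tH2] e; apply/subsetP=> h hH.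
  have [hB|hB] := boolP (h \in B).
    have : h \in H1 :&: B by rewrite inE hH.
    by rewrite e inE => /andP[].
  have [c cB eh] := A_split (subsetP H1A _ hH) hB.
  have : c \in H1 :&: B.
    have ec : c = t * h by rewrite eh mulgA tt mul1g.
    by rewrite inE cB andbT ec groupM.
  by rewrite e eh inE => /andP[cH _]; rewrite groupM.
rewrite -(card_in_imset f_inj); apply: eq_card => K; rewrite inE.
apply/imsetP/idP => [[H _ ->]|KB]; first exact: subsetIr.
have tN : <[t]> \subset 'N(K).
  by rewrite (subset_trans _ (sub_abelian_norm cAA _)) ?cycle_subG // (subset_trans KB).
exists (<[t]> <*> K)%G.
  rewrite inE join_subG cycle_subG tA (subset_trans KB BA) /=.
  by rewrite (subsetP (joing_subl _ _)) ?cycle_id.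
apply/val_inj => /=; rewrite (norm_joinEl tN) setIC -group_modr // [B :&: _]setIC.
by rewrite prime_TIg ?mul1g // -?orderE ?t_ord // cycle_subG.
Qed.

(* If H neither lies in B nor contains t, it contains some t c with c in B, where c
   is not in H but c ^+ 2 is. As B / (H :&: B) is cyclic, it has a single element of
   order 2, namely the class of c; hence H :&: B determines H. Such a c exists if
   and only if the index of H :&: B in B is even, that is, H :&: B lies in B2. *)
Let card_S2 : #|S2| = #|[set H : {group gT} | H \subset B2]|.
Proof.
have B2B : B2 \subset B by rewrite cycle_subG groupX ?cycle_id.
have oB2 : #|B2| = #[b] %/ 2 by rewrite -orderE orderXdiv.
have sq (H : {group gT}) h : H \in S2 -> h \in H -> h \notin B -> exists c,
    [/\ c \in B, h = t * c, c \notin H & c ^+ 2 \in H].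
  rewrite inE => /and3P[HA tH _] hH hB.
  have [c cB eh] := A_split (subsetP HA _ hH) hB; exists c; split=> //.
    by apply: contra tH => cH; rewrite -(groupMr _ cH) -eh.
  have cA := subsetP BA _ cB.
  have -> : c ^+ 2 = h ^+ 2.
    by rewrite eh expgMn; [rewrite [t ^+ 2]expg2 tt mul1g | apply: comA].
  by rewrite groupX.
have norm (K : {group gT}) : K \subset B -> B \subset 'N(K).
  by move=> KB; apply: sub_abelian_norm => //; apply: cycle_abelian.
have ord2 (H : {group gT}) c : c \in B -> c \notin H -> c ^+ 2 \in H ->
    #[coset (H :&: B) c] = 2.
  move=> cB cH c2H; have cN : c \in 'N(H :&: B) by apply: (subsetP (norm _ (subsetIr _ _))).
  apply: nt_prime_order => //; last first.
    by apply: contra cH => /eqP/(coset_idr cN); rewrite inE => /andP[].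
  by rewrite -morphX //= coset_id // inE c2H groupX.
have f_inj : {in S2 &, injective (fun H : {group gT} => (H :&: B)%G)}.
  suff sub (H1 H2 : {group gT}) : H1 \in S2 -> H2 \in S2 ->
      (H1 :&: B = H2 :&: B) -> H1 \subset H2.
    move=> H1 H2 h1 h2 /(congr1 val) /= e.
    by apply/val_inj/eqP; rewrite eqEsubset !sub.
  move=> H1S H2S e; apply/subsetP=> h hH.
  have [hB|hB] := boolP (h \in B).
    have : h \in H1 :&: B by rewrite inE hH.
    by rewrite e inE => /andP[].
  have [c [cB eh cH c2H]] := sq _ _ H1S hH hB.
  have [h2 h2H h2B] : exists2 h2, h2 \in H2 & h2 \notin B.
    by move: H2S; rewrite inE => /and3P[_ _ /subsetPn[h2]]; exists h2.
  have [d [dB eh2 dH d2H]] := sq _ _ H2S h2H h2B.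
  have oc := ord2 _ _ cB cH c2H; have od := ord2 _ _ dB dH d2H.
  rewrite -e in od.
  have cN : c \in 'N(H1 :&: B) by apply: (subsetP (norm _ (subsetIr _ _))).
  have dN : d \in 'N(H1 :&: B) by apply: (subsetP (norm _ (subsetIr _ _))).
  have cyq : cyclic (B / (H1 :&: B)) by rewrite quotient_cyclic ?cycle_cyclic.
  have cd : coset (H1 :&: B) c = coset (H1 :&: B) d.
    have : <[coset (H1 :&: B) c]> == <[coset (H1 :&: B) d]>.
      by rewrite (eq_subG_cyclic cyq) ?cycle_subG ?mem_quotient // -!orderE oc od.
    move/eqP=> ecd; have : coset (H1 :&: B) c \in <[coset (H1 :&: B) d]>.
      by rewrite -ecd cycle_id.
    rewrite (cycle2g od) => /set2P[c1|//].
    by move: oc; rewrite c1 order1.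
  have : c * d^-1 \in H1 :&: B.
    by apply: coset_idr; rewrite ?groupM ?groupV // morphM ?groupV // morphV //= cd mulgV.
  rewrite e inE => /andP[cdH _].
  have -> : h = c * d^-1 * h2.
    have cA := subsetP BA _ cB; have dA := subsetP BA _ dB.
    by rewrite eh eh2 (comA tA cA) (comA tA dA) mulgA mulgKV.
  by rewrite groupM.
rewrite -(card_in_imset f_inj); apply: eq_card => K; rewrite inE.
apply/imsetP/idP => [[H HS ->]|KB2] /=.
  have [h hH hB] : exists2 h, h \in H & h \notin B.
    by move: HS; rewrite inE => /and3P[_ _ /subsetPn[h]]; exists h.
  have [c [cB eh cH c2H]] := sq _ _ HS hH hB.
  have o2 : 2 %| #|B / (H :&: B)| by rewrite -(ord2 _ _ cB cH c2H) order_dvdG ?mem_quotient.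
  rewrite -(cardSg_cyclic (cycle_cyclic b)) ?subsetIr // oB2.
  have := Lagrange (subsetIr H B); rewrite -card_quotient ?norm ?subsetIr // -orderE => <-.
  by rewrite -muln_divA // dvdn_mulr.
have KB := subset_trans KB2 B2B.
have [k kK] : exists k, K :=: <[k]> by apply/cyclicP; apply: cyclicS KB (cycle_cyclic b).
have /cycleP[j ej] : k \in B2 by rewrite -cycle_subG -kK.
have K_ord : (2 * #|K|) %| #[b].
  have := cardSg KB2; rewrite oB2 => /(dvdn_mul (dvdnn 2)).
  by rewrite [X in _ %| X]mulnC divnK.
have [c cB oc] : exists2 c, c \in B & #[c] = (2 * #|K|)%N.
  exists (b ^+ (#[b] %/ (2 * #|K|))); first by rewrite groupX ?cycle_id.
  by rewrite orderXdiv ?dvdn_div // divnA // mulKn // order_gt0.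
have cA := subsetP BA _ cB.
have Kc : K :=: <[c ^+ 2]>.
  apply/eqP; rewrite (eq_subG_cyclic (cycle_cyclic b)) ?cycle_subG ?groupX //.
  by rewrite -orderE orderXdiv oc ?dvdn_mulr // mulKn.
have cK : c \notin K.
  apply/negP=> ck; have := dvdn_leq (cardG_gt0 K) (order_dvdG ck).
  by rewrite oc; have := cardG_gt0 K; lia.
have tc2 : (t * c) ^+ 2 = c ^+ 2.
  by rewrite expgMn; [rewrite [t ^+ 2]expg2 tt mul1g | apply: comA].
have memtc h : h \in <[t * c]> -> h \in K \/ exists2 k', k' \in K & h = t * c * k'.
  case/cycleP=> i ->; rewrite -(odd_double_half i) expgD -mul2n expgM tc2.
  have kiK : (c ^+ 2) ^+ i./2 \in K by rewrite Kc mem_cycle.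
  case: (odd i); rewrite ?expg0 ?mul1g ?expg1; last by left.
  by right; exists ((c ^+ 2) ^+ i./2).
have tcB k' : k' \in K -> t * c * k' \notin B.
  by move=> k'K; rewrite -mulgA groupMr // groupM // (subsetP KB).
exists <[t * c]>%G.
  rewrite inE cycle_subG groupM //=; apply/andP; split; last first.
    by rewrite cycle_subG -[t * c]mulg1 tcB.
  apply/negP=> /memtc[/(subsetP KB)|[k' k'K e]]; first by apply/negP.
  have : c * k' = 1 by apply: (mulgI t); rewrite mulgA -e mulg1.
  by move/eqP; rewrite mulg_eq1 => /eqP e'; rewrite e' groupV k'K in cK.
apply/val_inj/eqP; rewrite /= eqEsubset subsetI KB Kc -tc2 cycle_subG mem_cycle /=.
apply/subsetP=> h; rewrite inE => /andP[/memtc[hK|[k' k'K ->]] hB].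
  by rewrite tc2 -Kc.
by rewrite (negPf (tcB _ k'K)) in hB.
Qed.

Lemma card_subgroups_index2 :
  #|[set H : {group gT} | H \subset A]|
  = (2 * size (divisors #[b]) + size (divisors (#[b] %/ 2)))%N.
Proof.
have -> : [set H : {group gT} | H \subset A] = S0 :|: (S1 :|: S2).
  apply/setP=> H; rewrite !inE.
  have [HB|HB] := boolP (H \subset B); first by rewrite (subset_trans HB BA).
  by rewrite andbT; case: (H \subset A) => //=; case: (t \in H).
have d1 : S0 :&: (S1 :|: S2) = set0.
  apply/setP=> H; rewrite !inE; apply/negbTE/negP=> /andP[HB].
  rewrite HB !andbF orbF => /andP[_ /(subsetP HB)].
  by apply/negP.
have d2 : S1 :&: S2 = set0.
  by apply/setP=> H; rewrite !inE; case: (t \in H); rewrite ?andbF.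
rewrite !cardsU d1 d2 !cards0 !subn0 card_S1 card_S2.
rewrite !card_subgroups_cyclic ?cycle_cyclic // -!orderE orderXdiv //.
by rewrite mul2n -addnn addnA.
Qed.

End SubgroupCount.

(** * Transitive permutation groups *)

Section TransitiveGroups.

Variable n : nat.
Implicit Types (G H N : {group 'S_n}) (x y : 'I_n) (s : 'S_n).

Lemma transP G x i : perm_transitive G -> exists2 g, g \in G & g x = i.
Proof.
by move=> tr; have [g gG ->] := atransP2 tr (in_setT x) (in_setT i); exists g.
Qed.

Lemma mem_stab G x g : (g \in 'C_G[x | 'P]) = (g \in G) && (g x == x).
Proof. by rewrite inE; congr (_ && _); apply/astab1P/eqP. Qed.

Lemma perm_transitiveP G x : (forall i, exists2 g, g \in G & g x = i) ->
  perm_transitive G.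
Proof.
move=> tr; apply/imsetP; exists x; rewrite ?inE //; apply/setP=> i.
rewrite inE; apply/esym/orbitP; have [g gG gx] := tr i.
by exists g.
Qed.

Lemma perm_transitiveS G H x : perm_transitive G -> G \subset H -> perm_transitive H.
Proof.
move=> tr /subsetP GH; apply: (perm_transitiveP (x := x)) => i.
by have [g /GH gH gx] := transP x i tr; exists g.
Qed.

Lemma perm_transitiveJ G s x : perm_transitive G -> perm_transitive (G :^ s)%G.
Proof.
move=> tr; apply: (perm_transitiveP (x := s x)) => i.
have [g gG gx] := transP x (s^-1 i) tr; exists (g ^ s); first by rewrite memJ_conjg.
by rewrite permJ gx permKV.
Qed.

Lemma card_trans_stab G x : perm_transitive G -> #|G| = (n * #|'C_G[x | 'P]|)%N.
Proof.
move=> tr; have := card_orbit_stab 'P G x.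
by rewrite (atransP tr) ?inE // cardsT card_ord => ->.
Qed.

Lemma regular_stab G x : perm_transitive G -> #|G| = n -> 'C_G[x | 'P] = 1.
Proof.
move=> tr oG; have := card_trans_stab x tr; rewrite oG => /eqP.
rewrite -[X in X == _]muln1 eqn_pmul2l; last by case: (n) x => // -[].
by move/eqP/esym/card1_trivg.
Qed.

Lemma cent_trans_free G x c : perm_transitive G -> c \in 'C(G) -> c x = x -> c = 1.
Proof.
move=> tr /centP cG cx; apply/permP=> i; rewrite perm1.
have [g gG <-] := transP x i tr.
by rewrite -permM -(cG _ gG) permM cx.
Qed.

Lemma cent_trans_abelian G x : perm_transitive G -> abelian G -> 'C(G) = G.
Proof.
move=> tr aG; apply/eqP; rewrite eqEsubset andbC; apply/andP; split; first exact: aG.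
apply/subsetP=> c cC.
have [g gG gx] := transP x (c x) tr.
have : c * g^-1 = 1.
  apply: (cent_trans_free tr (x := x)); last by rewrite permM -gx permK.
  by rewrite groupM // groupV (subsetP aG).
by move/eqP; rewrite mulg_eq1 invgK => /eqP->.
Qed.

(** The permutation sought maps g x to f g y, for all g in G1. *)
Lemma conj_of_isom G1 G2 x y (f : {morphism G1 >-> 'S_n}) :
    perm_transitive G1 -> perm_transitive G2 -> isom G1 G2 f ->
    f @* 'C_G1[x | 'P] = 'C_G2[y | 'P] ->
  exists2 s : 'S_n, s x = y & forall g, g \in G1 -> f g = g ^ s.
Proof.
move=> tr1 tr2 /isomP[f_inj f_im] f_stab.
have /fin_all_exists[t tP] : forall i, exists g : 'S_n, g \in G1 /\ g x = i.
  by move=> i; have [g gG gx] := transP x i tr1; exists g.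
have tG i : t i \in G1 by case: (tP i).
have tx i : t i x = i by case: (tP i).
have fix_iff g : g \in G1 -> (f g y == y) = (g x == x).
  move=> gG; have fG : f g \in G2 by rewrite -f_im mem_morphim.
  have := mem_stab G2 y (f g); rewrite fG /= => <-.
  have := mem_stab G1 x g; rewrite gG /= => <-.
  rewrite -f_stab; apply/idP/idP => [/morphimP[h hG hs]|gs]; last by rewrite mem_morphim.
  by move/(injmP f_inj)->.
pose phi i := f (t i) y.
have phiE g i : g \in G1 -> g x = i -> phi i = f g y.
  move=> gG gi; apply/eqP; rewrite -(inj_eq (@perm_inj _ (f g)^-1)) permK -permM.
  rewrite -morphV // -morphM ?groupV // fix_iff ?groupM ?groupV //.
  by rewrite permM tx -gi permK.
have phi_inj : injective phi.
  move=> i j /eqP; rewrite -(inj_eq (@perm_inj _ (f (t j))^-1)) permK -permM.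
  rewrite -morphV // -morphM ?groupV // fix_iff ?groupM ?groupV // permM tx.
  by move/eqP/(canRL (permKV _)); rewrite tx.
exists (perm phi_inj); first by rewrite permE (phiE 1) ?perm1 // morph1 perm1.
move=> g gG; apply/permP=> i.
have [j ->] : exists j, i = perm phi_inj j by exists ((perm phi_inj)^-1 i); rewrite permKV.
have e : phi (g j) = f (t j * g) y by apply: phiE; rewrite ?groupM // permM tx.
by rewrite permJ !permE e morphM // permM.
Qed.

Lemma perm_isoP G1 G2 x : perm_transitive G1 -> perm_transitive G2 ->
  perm_iso G1 G2 <-> exists s, G2 = (G1 :^ s)%G.
Proof.
move=> tr1 tr2; split=> [[y [z [f [f_iso f_stab]]]]|[s ->]].
  have [s _ fE] := conj_of_isom tr1 tr2 f_iso f_stab; exists s; apply: val_inj => /=.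
  have [_ <-] := isomP f_iso; rewrite morphimEdom.
  by apply/setP=> g; apply/imsetP/imsetP=> -[h hG ->]; exists h; rewrite ?fE.
exists x, (s x), (conjgm_morphism G1 s); split; first exact: conj_isom.
apply/setP=> g; rewrite mem_stab; apply/morphimP/andP => [[h hG + ->]|[]].
  rewrite mem_stab => /andP[_ /eqP hx].
  by rewrite /= conjgmE memJ_conjg hG permJ hx.
case/imsetP=> h hG ->; rewrite permJ (inj_eq perm_inj) => hx.
by exists h => //; rewrite mem_stab hG.
Qed.

Lemma perm_iso_sym G1 G2 x : perm_transitive G1 -> perm_transitive G2 ->
  perm_iso G1 G2 -> perm_iso G2 G1.
Proof.
move=> tr1 tr2 /(perm_isoP x tr1 tr2)[s ->]; apply/(perm_isoP x) => //.
  exact: perm_transitiveJ.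
by exists s^-1; apply: val_inj; rewrite /= conjsgK.
Qed.

Lemma perm_iso_trans G1 G2 G3 x :
    perm_transitive G1 -> perm_transitive G2 -> perm_transitive G3 ->
  perm_iso G1 G2 -> perm_iso G2 G3 -> perm_iso G1 G3.
Proof.
move=> tr1 tr2 tr3 /(perm_isoP x tr1 tr2)[s ->] /perm_isoP-/(_ x)[//|//|t ->].
  exact: perm_transitiveJ.
apply/(perm_isoP x) => //; first exact/perm_transitiveJ/perm_transitiveJ.
by exists (s * t); apply: val_inj; rewrite /= conjsgM.
Qed.

Lemma perm_isoJ G s x : perm_transitive G -> perm_iso G (G :^ s)%G.
Proof.
by move=> tr; apply/(perm_isoP x) => //; [apply: perm_transitiveJ | exists s].
Qed.

Lemma cyc_normP G N : N \in cyc_norm G <->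
  [/\ perm_transitive N, #|N| = n, cyclic N & G \subset 'N(N)].
Proof.
by rewrite inE; split=> [/and4P[tr /eqP]|[tr oN cN GN]] //; apply/and4P; split=> //; apply/eqP.
Qed.

Lemma cyc_normJ G N s x : N \in cyc_norm G -> (N :^ s)%G \in cyc_norm (G :^ s)%G.
Proof.
case/cyc_normP=> tr oN cN GN; apply/cyc_normP; split.
- exact: perm_transitiveJ.
- by rewrite cardJg.
- by rewrite /= cyclicJ.
by rewrite /= normJ conjSg.
Qed.

Lemma card_cyc_normJ G s x : #|cyc_norm (G :^ s)%G| = #|cyc_norm G|.
Proof.
wlog suff: G s / #|cyc_norm G| <= #|cyc_norm (G :^ s)%G|.
  move=> le; apply/eqP; rewrite eqn_leq le andbT.
  have := le (G :^ s)%G s^-1; congr (_ <= #|cyc_norm _|).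
  by apply: val_inj; rewrite /= conjsgK.
have inj : injective (fun N : {group 'S_n} => (N :^ s)%G).
  by move=> N1 N2 /(congr1 val) /= /conjsg_inj e; apply: val_inj.
rewrite -(card_imset _ inj); apply/subset_leq_card/subsetP=> _ /imsetP[N NG ->].
exact: cyc_normJ.
Qed.

(** As point stabilisers are trivial, any isomorphism of abstract groups is one of
    permutation groups. *)
Lemma regular_cyclic_conj N1 N2 x :
    perm_transitive N1 -> perm_transitive N2 -> #|N1| = n -> #|N2| = n ->
    cyclic N1 -> cyclic N2 ->
  exists s, N2 = (N1 :^ s)%G.
Proof.
move=> tr1 tr2 o1 o2 c1 c2; apply/(perm_isoP x) => //.
have : N1 \isog N2 by rewrite isog_cyclic_card // c2 o1 o2 /=.
case/isogP=> f f_inj f_im; exists x, x, f; split; first exact/isomP.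
by rewrite !regular_stab // morphim1.
Qed.

(** The centraliser of a transitive group acts freely on the points. *)
Lemma card_cent_dvd G x : perm_transitive G -> #|'C(G)| %| n.
Proof.
move=> tr; have st y : 'C_('C(G))[y | 'P] = 1.
  apply/trivgP/subsetP=> c /setIP[cG /astab1P]; rewrite /= apermE => cy.
  by rewrite (cent_trans_free tr cG cy).
have act : [acts 'C(G), on [set: 'I_n] | 'P].
  by apply/actsP=> c _ i; rewrite !inE.
have := acts_sum_card_orbit act; rewrite cardsT card_ord => e.
rewrite -[X in _ %| X]e (eq_bigr (fun=> #|'C(G)|)) ?sum_nat_const ?dvdn_mull //.
move=> _ /imsetP[y _ ->].
by have := card_orbit_stab 'P ('C(G)) y; rewrite st cards1 muln1.
Qed.

Lemma semiregular_trans G x : (forall y, 'C_G[y | 'P] = 1) -> #|G| = n -> perm_transitive G.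
Proof.
move=> st oG; apply: (perm_transitiveP (x := x)) => i.
have : i \in orbit 'P G x.
  suff -> : orbit 'P G x = setT by rewrite inE.
  apply/eqP; rewrite eqEcard subsetT cardsT card_ord /=.
  by have := card_orbit_stab 'P G x; rewrite st cards1 muln1 => ->; rewrite oG.
by case/orbitP=> g gG gx; exists g.
Qed.

(** The identity of G matches the trivial stabilisers of x and of i, so it is
    induced by a permutation that maps x to i; and this permutation centralises
    G. *)
Lemma regular_cent_trans G x : perm_transitive G -> #|G| = n -> perm_transitive 'C(G).
Proof.
move=> tr oG; apply: (perm_transitiveP (x := x)) => i.
have idstab : idm G @* 'C_G[x | 'P] = 'C_G[i | 'P].
  by rewrite morphim_idm ?subsetIl // !regular_stab.
have [s sx sE] := conj_of_isom tr tr (idm_isom G) idstab.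
exists s => //; apply/centP=> g gG.
by rewrite /commute [RHS]conjgC -sE.
Qed.

End TransitiveGroups.

Lemma num_classes_card (T : finType) (R : T -> T -> Prop) (P : T -> Prop) (D : {set T}) :
    (forall G, G \in D -> P G) ->
    {in D &, forall G1 G2, R G1 G2 -> G1 = G2} ->
    (forall G, P G -> exists2 G', G' \in D & R G G') ->
  num_classes R P #|D|.
Proof.
move=> DP Dinj Dcov; exists (fun i : 'I_#|D| => enum_val i); split.
- by move=> i; apply/DP/enum_valP.
- by move=> i j /(Dinj _ _ (enum_valP i) (enum_valP j))/enum_val_inj.
move=> G /Dcov[G' G'D RG]; exists (enum_rank_in G'D G').
by rewrite enum_rankK_in.
Qed.

Lemma reg_cyc_exists n : 0 < n -> exists N : {group 'S_n},
  [/\ perm_transitive N, #|N| = n & cyclic N].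
Proof.
move=> n0; pose x0 := Ordinal n0.
have ordS_inj : injective (@ordS n) by apply: can_inj (@ordSK n).
pose c : 'S_n := perm ordS_inj.
have cX k : k < n -> ((c ^+ k) x0 : nat) = k.
  elim: k => [|k IH] kn; first by rewrite expg0 perm1.
  by rewrite expgSr permM permE /= IH ?modn_small // ltnW.
have tr : perm_transitive <[c]>.
  apply: (perm_transitiveP (x := x0)) => i; exists (c ^+ i); first exact: mem_cycle.
  by apply: val_inj; rewrite /= cX.
exists <[c]>%G; split=> //; last exact: cycle_cyclic.
have st : 'C_<[c]>[x0 | 'P] = 1.
  apply/trivgP/subsetP=> g /setIP[gc /astab1P]; rewrite /= apermE => gx.
  apply/set1P/(cent_trans_free tr) => //; last exact: gx.
  by apply: subsetP gc; apply: cycle_abelian.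
by rewrite (card_trans_stab x0 tr) st cards1 muln1.
Qed.

Lemma index_cent_Aut (gT : finGroupType) (G A : {group gT}) : G \subset 'N(A) ->
  #|G : 'C_G(A)| %| #|Aut A|.
Proof.
move=> GA; have -> : #|G : 'C_G(A)| = #|conj_aut A @* G|.
  by rewrite card_morphim (setIidPr GA) ker_conj_aut indexgI.
exact: cardSg (Aut_conj_aut A G).
Qed.

(** * Transitive groups of degree pq normalising a regular cyclic group *)

Lemma cyclic_mod_cent (gT : finGroupType) (K A : {group gT}) :
  prime #|A| -> K \subset 'N(A) -> cyclic (K / 'C_K(A)).
Proof.
move=> pA KA; have := first_isog_loc (conj_aut_morphism A) KA.
rewrite ker_conj_aut => /isog_cyclic->.
exact: cyclicS (Aut_conj_aut A K) (Aut_prime_cyclic pA).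
Qed.

Section SophieGermain.

Variables p q : nat.
Hypotheses (p_pr : prime p) (q_pr : prime q) (q_ge3 : 3 <= q) (p_def : p = (2 * q + 1)%N).
Local Notation Sn := {perm 'I_(p * q)}.
Implicit Types (G N : {group Sn}).

Definition reg_cyc N := [/\ perm_transitive N, #|N| = (p * q)%N & cyclic N].

Let p_gt0 : 0 < p. Proof. exact: prime_gt0. Qed.
Let q_gt0 : 0 < q. Proof. exact: prime_gt0. Qed.
Let pq_neq : p != q. Proof. by lia. Qed.
Let point0 : 'I_(p * q). Proof. by exists 0; rewrite muln_gt0 p_gt0. Qed.

Let q_p : q \in p^'. Proof. by rewrite !inE eq_sym. Qed.
Let p_q : p \in q^'. Proof. by rewrite !inE. Qed.

Let p1E : p.-1 = (2 * q)%N. Proof. by lia. Qed.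

Let q_ndvd2 : ~~ (q %| 2). Proof. by apply/negP => /dvdn_leq; lia. Qed.
Let q_ndvd_q1 : ~~ (q %| q.-1). Proof. by apply/negP => /dvdn_leq; lia. Qed.
Let q_ndvd_p : ~~ (q %| p). Proof. by rewrite dvdn_prime2 // eq_sym. Qed.

Let p_ndvd_q1 : ~~ (p %| q.-1). Proof. by apply/negP => /dvdn_leq; lia. Qed.

Let p_neq2 : p != 2. Proof. by lia. Qed.
Let q_lt_p : q < p. Proof. by lia. Qed.
Let q_odd : odd q. Proof. by have [|//] := even_prime q_pr; lia. Qed.

Let odd_pq : 2^'.-nat (p * q)%N.
Proof.
rewrite p'natE // Euclid_dvdM // negb_or !dvdn_prime2 // [2 == p]eq_sym p_neq2.
by apply: contraTneq q_odd => <-.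
Qed.

Let q1_q : q^'.-nat q.-1.
Proof. by rewrite p'natE //; apply/negP => /dvdn_leq; lia. Qed.

Let p1_p : p^'.-nat (p.-1 * q.-1)%N.
Proof.
rewrite p'natE // Euclid_dvdM // negb_or; apply/andP.
by split; apply/negP => /dvdn_leq; lia.
Qed.

Lemma cyc_norm_reg G N : N \in cyc_norm G -> reg_cyc N.
Proof. by case/cyc_normP. Qed.

Lemma card_Aut_prime (gT : finGroupType) (A : {group gT}) l : prime l -> #|A| = l ->
  #|Aut A| = l.-1.
Proof.
move=> l_pr oA; have cA : cyclic A by apply: prime_cyclic; rewrite oA.
by rewrite card_Aut_cyclic // oA totient_prime.
Qed.

Section RegularCyclic.

Variable N : {group Sn}.
Hypothesis rcN : reg_cyc N.
Local Notation P := 'O_p(N).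
Local Notation Q := 'O_q(N).
Local Notation H := 'N(N).

Let trN : perm_transitive N. Proof. by case: rcN. Qed.
Let oN : #|N| = (p * q)%N. Proof. by case: rcN. Qed.
Let cN : cyclic N. Proof. by case: rcN. Qed.

Lemma card_pcore_p : #|P| = p.
Proof.
rewrite (card_Hall (nilpotent_pcore_Hall p (abelian_nil (cyclic_abelian cN)))) oN.
by rewrite partnM // part_pnat_id ?pnat_id // part_p'nat ?muln1 // pnatE.
Qed.

Lemma card_pcore_q : #|Q| = q.
Proof.
rewrite (card_Hall (nilpotent_pcore_Hall q (abelian_nil (cyclic_abelian cN)))) oN.
by rewrite partnM // part_p'nat ?pnatE // part_pnat_id ?pnat_id // mul1n.
Qed.

Lemma pcoreI : P :&: Q = 1.
Proof. by apply: coprime_TIg; rewrite card_pcore_p card_pcore_q prime_coprime // dvdn_prime2. Qed.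

Lemma pcoreMul : P * Q = N.
Proof.
apply/eqP; rewrite eqEcard mul_subG ?pcore_sub //= TI_cardMg ?pcoreI //.
by rewrite card_pcore_p card_pcore_q oN.
Qed.

Lemma cent_reg_cyc : 'C(N) = N.
Proof. exact: (cent_trans_abelian point0 trN (cyclic_abelian cN)). Qed.

Lemma sub_norm_reg : N \subset H. Proof. exact: normG. Qed.

Lemma pcore_holo l : 'O_l(N) <| H.
Proof. exact: char_normal_trans (pcore_char l N) (normalG N). Qed.

Lemma cent_pcores : 'C(P) :&: 'C(Q) = N.
Proof. by rewrite -centM pcoreMul cent_reg_cyc. Qed.

(** Here N is its own centraliser, so that its normaliser acts on it modulo N. *)
Lemma index_norm_dvd : #|H : N| %| (p.-1 * q.-1)%N.
Proof.
have -> : #|H : N| = #|H : 'C_H(N)|.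
  by congr #|_ : _|; rewrite cent_reg_cyc; apply/esym/setIidPr/normG.
apply: dvdn_trans (index_cent_Aut (subxx H)) _.
rewrite card_Aut_cyclic // oN totient_coprime; last by rewrite prime_coprime // dvdn_prime2.
by rewrite !totient_prime.
Qed.

Lemma pcore_p_Sylow : p.-Sylow(H) P.
Proof.
rewrite pHallE normal_sub ?pcore_holo //= card_pcore_p.
rewrite -(Lagrange sub_norm_reg) oN !partnM ?muln_gt0 ?p_gt0 ?indexg_gt0 //.
rewrite part_pnat_id ?pnat_id // part_p'nat ?pnatE //.
by rewrite part_p'nat ?muln1 // (pnat_dvd index_norm_dvd).
Qed.

Lemma p_group_sub (K : {group Sn}) : K \subset H -> p.-group K -> K \subset P.
Proof. by move=> KH; rewrite (sub_normal_Hall pcore_p_Sylow) ?pcore_holo. Qed.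

Lemma sub_cent_pcore l : N \subset 'C('O_l(N)).
Proof. by rewrite sub_abelian_cent ?pcore_sub ?cyclic_abelian. Qed.

(** In H the q-part of the index of N is not trivial, since q divides p - 1 = |Aut P|.
    But in the centraliser of P the index of N divides |Aut Q| = q - 1. *)
Lemma pcore_q_Sylow : q.-Sylow('C_H(P)) Q.
Proof.
have NC : N \subset 'C_H(P) by rewrite subsetI normG sub_cent_pcore.
have CQ : 'C_H(P) \subset 'N(Q) by rewrite subIset // normal_norm ?pcore_holo.
have iN : #|'C_H(P) : N| %| q.-1.
  rewrite -(card_Aut_prime q_pr card_pcore_q).
  have -> : #|'C_H(P) : N| = #|'C_H(P) : 'C_('C_H(P))(Q)|.
    congr #|_ : _|; rewrite -setIA cent_pcores; exact/esym/setIidPr/normG.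
  exact: index_cent_Aut.
rewrite pHallE (subset_trans (pcore_sub _ _) NC) /= card_pcore_q.
rewrite -(Lagrange NC) oN !partnM ?muln_gt0 ?p_gt0 ?indexg_gt0 //.
rewrite (part_p'nat (n := p)) ?pnatE // mul1n part_pnat_id ?pnat_id //.
by rewrite part_p'nat ?muln1 // (pnat_dvd iN).
Qed.

Lemma q_group_sub (K : {group Sn}) : K \subset 'C_H(P) -> q.-group K -> K \subset Q.
Proof.
move=> KC; rewrite (sub_normal_Hall pcore_q_Sylow) //.
rewrite /normal (pHall_sub pcore_q_Sylow) subIset // normal_norm ?pcore_holo //.
Qed.

(** H / N embeds in Aut N, which is abelian because N is cyclic. *)
Lemma comm_norm_reg g h : g \in H -> h \in H -> [~ g, h] \in N.
Proof.
move=> gH hH; suff : [~ g, h] \in 'ker (conj_aut N) by rewrite ker_conj_aut cent_reg_cyc.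
apply/kerP; first by rewrite groupR.
rewrite morphR //; apply/eqP/commgP.
have AutH k : k \in H -> conj_aut N k \in Aut N.
  by move=> kH; rewrite (subsetP (Aut_conj_aut N H)) ?mem_morphim.
by apply: (centsP (Aut_cyclic_abelian cN)); apply: AutH.
Qed.

Section PointStabiliser.

Variable x : 'I_(p * q).
Local Notation Hx := 'C_H[x | 'P].
Local Notation A := 'C_Hx(Q).
Local Notation B := 'C_Hx(P).

Lemma stab_capN : Hx :&: N = 1.
Proof. by rewrite setIAC (setIidPr (normG N)) (regular_stab x trN oN). Qed.

Lemma stab_mulN : Hx * N = H.
Proof.
apply/(subgroup_transitiveP (in_setT x) (normG N)) => //.
exact: (perm_transitiveS x trN (normG N)).
Qed.

Lemma stab_sub : Hx \subset H. Proof. exact: subsetIl. Qed.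

(** Every automorphism of a regular group is induced by a permutation that fixes
    x, so that the stabiliser of x in H is isomorphic to Aut N. *)
Lemma card_stab : #|Hx| = (2 * q * q.-1)%N.
Proof.
have inj : 'injm (restrm stab_sub (conj_aut N)).
  rewrite ker_restrm ker_conj_aut cent_reg_cyc; apply/trivgP.
  by rewrite /= stab_capN.
have <- : #|Aut N| = (2 * q * q.-1)%N.
  rewrite card_Aut_cyclic // oN totient_coprime; last by rewrite prime_coprime // dvdn_prime2.
  by rewrite !totient_prime // p1E.
rewrite -(card_injm inj (subxx _)) morphim_restrm setIid.
apply/eqP; rewrite eqn_leq subset_leq_card ?Aut_conj_aut //=.
apply/subset_leq_card/subsetP=> a aN.
have fix_triv : autm aN @* 'C_N[x | 'P] = 'C_N[x | 'P].
  by rewrite (regular_stab x trN oN) morphim1.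
have aiso : isom N N (autm aN) by apply/isomP; rewrite injm_autm im_autm.
have [s sx sE] := conj_of_isom trN trN aiso fix_triv.
have sH : s \in H.
  rewrite inE; apply/subsetP=> _ /imsetP[g gN ->].
  by rewrite -sE //= -{2}(im_autm aN) mem_morphim.
apply/morphimP; exists s => //; first by rewrite mem_stab sH sx eqxx.
apply: (eq_Aut aN); first by rewrite (subsetP (Aut_conj_aut N H)) ?mem_morphim.
by move=> g gN; rewrite /= norm_conj_autE // -sE.
Qed.

Lemma stab_abelian : abelian Hx.
Proof.
apply/centsP=> g gH h hH; apply/commgP; rewrite -in_set1 -[[set 1]]stab_capN inE.
by rewrite groupR //= comm_norm_reg // (subsetP stab_sub).
Qed.

Lemma stabA_faithful : 'C_A(P) = 1.
Proof.
apply/trivgP/subsetP=> g /setIP[/setIP[gx gQ] gP].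
have gN : g \in 'C(P) :&: 'C(Q) by rewrite inE gP.
by rewrite cent_pcores in gN; have := stab_capN => <-; rewrite inE gx.
Qed.

Lemma stabB_faithful : 'C_B(Q) = 1.
Proof. by rewrite setIAC stabA_faithful. Qed.

Let Hx_norm l : Hx \subset 'N('O_l(N)).
Proof. by rewrite (subset_trans stab_sub) // normal_norm ?pcore_holo. Qed.

Let A_norm l : A \subset 'N('O_l(N)). Proof. by rewrite subIset ?Hx_norm. Qed.
Let B_norm l : B \subset 'N('O_l(N)). Proof. by rewrite subIset ?Hx_norm. Qed.

(** A acts faithfully on P and B on Q, which bounds their orders above by 2 q and
    q - 1, and likewise their indices in Hx by q - 1 and 2 q; as |Hx| is
    2 q (q - 1), equality holds. *)
Lemma card_stabAB : #|A| = (2 * q)%N /\ #|B| = q.-1.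
Proof.
have dA : #|A| %| 2 * q.
  rewrite -p1E -(card_Aut_prime p_pr card_pcore_p).
  by apply: dvdn_trans (index_cent_Aut (A_norm p)); rewrite stabA_faithful indexg1.
have dB : #|B| %| q.-1.
  rewrite -(card_Aut_prime q_pr card_pcore_q).
  by apply: dvdn_trans (index_cent_Aut (B_norm q)); rewrite stabB_faithful indexg1.
have iA : #|Hx : A| %| q.-1.
  by rewrite -(card_Aut_prime q_pr card_pcore_q) index_cent_Aut ?Hx_norm.
have iB : #|Hx : B| %| 2 * q.
  by rewrite -p1E -(card_Aut_prime p_pr card_pcore_p) index_cent_Aut ?Hx_norm.
have q1 : 0 < q.-1 by rewrite -ltnS prednK // ltnW.
have q2 : 0 < 2 * q by rewrite muln_gt0.
split; apply/eqP; rewrite eqn_leq dvdn_leq //=.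
  rewrite -(leq_pmul2r q1) -card_stab -(Lagrange (subsetIl Hx 'C(Q))).
  by rewrite leq_mul2l dvdn_leq ?orbT.
rewrite -(leq_pmul2l q2) -card_stab -(Lagrange (subsetIl Hx 'C(P))) mulnC.
by rewrite leq_mul2r dvdn_leq ?orbT.
Qed.

Lemma stabA_cyclic : cyclic A.
Proof.
have := cyclic_mod_cent _ (A_norm p); rewrite card_pcore_p => /(_ p_pr).
by rewrite stabA_faithful -(isog_cyclic (quotient1_isog _)).
Qed.

Lemma stabB_cyclic : cyclic B.
Proof.
have := cyclic_mod_cent _ (B_norm q); rewrite card_pcore_q => /(_ q_pr).
by rewrite stabB_faithful -(isog_cyclic (quotient1_isog _)).
Qed.

End PointStabiliser.

End RegularCyclic.

(** The p-part of N1 lies in the normal Sylow p-subgroup of 'N(N2), which is the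
    p-part of N2. Then the q-part of N1 centralises this common p-part, hence
    lies in the normal Sylow q-subgroup of its centraliser in 'N(N2), which is
    the q-part of N2. *)
Lemma reg_cyc_norm_eq N1 N2 : reg_cyc N1 -> reg_cyc N2 -> N1 \subset 'N(N2) -> N1 = N2.
Proof.
move=> rc1 rc2 n12; have sub l : 'O_l(N1) \subset 'N(N2) := subset_trans (pcore_sub l N1) n12.
have eP : 'O_p(N1) = 'O_p(N2).
  apply/eqP; rewrite eqEcard p_group_sub ?pcore_pgroup //=.
  by rewrite !card_pcore_p.
have eQ : 'O_q(N1) = 'O_q(N2).
  apply/eqP; rewrite eqEcard q_group_sub ?pcore_pgroup //=.
    by rewrite !card_pcore_q.
  by rewrite subsetI sub -eP (subset_trans (pcore_sub _ _)) ?sub_cent_pcore.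
by apply: val_inj; rewrite /= -(pcoreMul rc1) -(pcoreMul rc2) eP eQ.
Qed.

Section TransitiveInHolomorph.

Variables N G : {group Sn}.
Hypotheses (rcN : reg_cyc N) (trG : perm_transitive G) (GN : G \subset 'N(N)).
Local Notation P := 'O_p(N).
Local Notation Q := 'O_q(N).
Local Notation H := 'N(N).

Let pq_dvd : (p * q)%N %| #|G|.
Proof. by rewrite (card_trans_stab point0 trG) dvdn_mulr. Qed.

Lemma pcore_p_sub : P \subset G.
Proof.
have [S sylS] := Sylow_exists p G.
have SP : S \subset P.
  by rewrite p_group_sub ?(pHall_pgroup sylS) // (subset_trans (pHall_sub sylS)).
suff <- : S = P :> {set _} by apply: pHall_sub sylS.
apply/eqP; rewrite eqEcard SP /= card_pcore_p //.
have : p %| #|S|.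
  rewrite (card_Hall sylS) -[X in X %| _](part_pnat_id (pnat_id p_pr)) partn_dvd //.
  by apply: dvdn_trans pq_dvd; rewrite dvdn_mulr.
by apply: dvdn_leq.
Qed.

(** Each member of [cyc_norm G] is normalised by N, which is contained in G. *)
Lemma cyc_norm_super : Q \subset G -> cyc_norm G = [set N].
Proof.
move=> QG; have NG : N \subset G by rewrite -(pcoreMul rcN) mul_subG ?pcore_p_sub.
apply/setP=> N'; rewrite [RHS]inE; apply/idP/eqP => [N'G|->]; last first.
  by apply/cyc_normP; case: rcN => *; split.
have /cyc_normP[_ _ _ GN'] := N'G.
apply/esym/reg_cyc_norm_eq => //; first exact: cyc_norm_reg N'G.
exact: subset_trans NG GN'.
Qed.

Hypothesis QG : ~~ (Q \subset G).

Lemma avoid_q_TI : G :&: Q = 1.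
Proof. by rewrite setIC prime_TIg // card_pcore_q. Qed.

Lemma avoid_q_capN : G :&: N = P.
Proof. by rewrite -[X in _ :&: X](pcoreMul rcN) setIC -group_modl ?pcore_p_sub // setIC avoid_q_TI mulg1. Qed.

Local Notation Hx := 'C_H[point0 | 'P].
Local Notation A := 'C_Hx(Q).

Let GH g : g \in G -> g \in H. Proof. exact: (subsetP GN). Qed.

(** Take W = P A. If G W did not contain Q it would meet Q trivially. The point
    stabiliser of G W contains A, of order 2 q, so that q^2 would divide |G W|
    and q^3 would divide |G W Q|. But |H| = 2 p q^2 (q - 1). *)
Lemma avoid_q_complement : exists W : {group Sn},
  [/\ W <| H, P \subset W, W :&: Q = 1 & Q \subset G * W].
Proof.
have HxP l : Hx \subset 'N('O_l(N)).
  by rewrite (subset_trans (stab_sub N point0)) // normal_norm ?pcore_holo.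
have AP : A \subset 'N(P) by rewrite subIset ?HxP.
have [oA _] := card_stabAB rcN point0.
have nPA : P \subset 'N(P <*> A) by rewrite (subset_trans _ (normG _)) ?joing_subl.
have cQ : Q \subset 'C(P <*> A).
  rewrite centY subsetI (sub_abelian_cent2 (cyclic_abelian (let: And3 _ _ c := rcN in c))) ?pcore_sub //=.
  by rewrite centsC subsetIr.
have HxA : Hx \subset 'N(A).
  by apply: sub_abelian_norm; [exact: stab_abelian | exact: subsetIl].
have HxW : Hx \subset 'N(P <*> A) by rewrite normsY ?HxP.
have NW : N \subset 'N(P <*> A).
  have := mul_subG nPA (cents_norm cQ).
  by rewrite [P * Q](pcoreMul rcN).
have nP l : 'O_l(N) <| H := pcore_holo N l.
have nW : P <*> A <| H.
  apply/andP; split.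
    rewrite join_subG (normal_sub (nP p)).
    by rewrite (subset_trans (subsetIl _ _) (stab_sub N point0)).
  by have := mul_subG HxW NW; rewrite [Hx * N](stab_mulN rcN point0).
have WN : (P <*> A) :&: N = P.
  rewrite (norm_joinEr AP) -group_modl ?pcore_sub //.
  rewrite (_ : A :&: N = 1) ?mulg1 //; apply/trivgP.
  by rewrite -(stab_capN rcN point0) setSI ?subsetIl.
exists (P <*> A)%G; split=> //=; first exact: joing_subl.
  apply/trivgP; rewrite -(pcoreI rcN) subsetI subsetIr andbT.
  by apply: subset_trans (setIS _ (pcore_sub q N)) _; rewrite WN.
have GW : G \subset 'N(P <*> A) by apply: subset_trans GN (normal_norm nW).
rewrite -(norm_joinEl GW); set J := G <*> _; apply/idPn=> QJ.
have trJ : perm_transitive (G <*> (P <*> A))%G.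
  by apply: (perm_transitiveS point0 trG); apply: joing_subl.
have JH : J \subset H by rewrite join_subG GN (normal_sub nW).
have QT : J :&: Q = 1 by rewrite setIC prime_TIg // card_pcore_q.
have QnJ : J \subset 'N(Q) by apply: subset_trans JH (normal_norm (nP q)).
have AJ : A \subset 'C_J[point0 | 'P].
  rewrite subsetI (subset_trans (joing_subr _ _) (joing_subr _ _)) /=.
  by rewrite (subset_trans (subsetIl _ _)) ?subsetIr.
have q3 : q * q * q %| #|J * Q|.
  rewrite TI_cardMg // card_pcore_q // dvdn_pmul2r // (card_trans_stab point0 trJ).
  rewrite mulnAC dvdn_mul // dvdn_mull //.
  by apply: dvdn_trans (cardSg AJ); rewrite oA dvdn_mull.
have : q * q * q %| #|H|.
  apply: dvdn_trans q3 _; rewrite -norm_joinEl //; apply: cardSg.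
  by rewrite join_subG JH (normal_sub (nP q)).
have [_ oN _] := rcN.
rewrite -(stab_mulN rcN point0) TI_cardMg ?stab_capN // card_stab // oN.
have -> : (2 * q * q.-1 * (p * q) = (q * q) * (2 * q.-1 * p))%N by ring.
rewrite dvdn_pmul2l ?muln_gt0 ?q_gt0 // !Euclid_dvdM //.
by rewrite (negPf q_ndvd2) (negPf q_ndvd_q1) (negPf q_ndvd_p).
Qed.

(** An element s of Q is congruent modulo W to some r in G. For g in G the
    commutator of r and g lies in G :&: N = P, hence in W; so that of s and g lies
    in W :&: Q = 1. *)
Lemma avoid_q_cent : G \subset 'C(Q).
Proof.
have [W [nW PW WQ QGW]] := avoid_q_complement.
have nQ : Q <| H := pcore_holo N q.
rewrite centsC; apply/centsP=> s sQ g gG; apply/commgP; rewrite -in_set1.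
rewrite -[[set 1]]WQ inE; apply/andP; split; last first.
  have gQ : g \in 'N(Q) by rewrite (subsetP (normal_norm nQ)) ?GH.
  by rewrite commgEl groupM ?groupV // memJ_norm.
have [r w rG wW es] := mulsgP (subsetP QGW _ sQ).
have gN : g \in 'N(W) by rewrite (subsetP (normal_norm nW)) ?GH.
have rN : r \in 'N(W) by rewrite (subsetP (normal_norm nW)) ?GH.
have wN : w \in 'N(W) by rewrite (subsetP (normG W)).
have sN : s \in 'N(W) by rewrite es groupM.
apply: coset_idr; first by rewrite groupR.
have cs : coset W s = coset W r by rewrite es morphM //= (coset_id wW) mulg1.
rewrite morphR //= cs -morphR //=; apply: coset_id; apply: (subsetP PW).
by rewrite -avoid_q_capN inE groupR //= comm_norm_reg ?GH.
Qed.

Lemma avoid_q_centP : 'C_G(P) = P.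
Proof.
apply/eqP; rewrite eqEsubset; apply/andP; split.
  apply: subset_trans (_ : G :&: N \subset _); last by rewrite avoid_q_capN.
  rewrite subsetI subsetIl /=.
  have := subset_trans (subsetIl G 'C(P)) avoid_q_cent.
  move=> GQ; have : 'C_G(P) \subset 'C(P) :&: 'C(Q) by rewrite subsetI subsetIr.
  by rewrite cent_pcores.
rewrite subsetI pcore_p_sub // (subset_trans (pcore_sub p N)) //.
by rewrite sub_cent_pcore.
Qed.

(** By [avoid_q_centP], G / P embeds in Aut P, of order 2 q; and q divides its order
    because p q divides |G|. *)
Lemma avoid_q_card : #|G| = (p * q)%N \/ #|G| = (2 * p * q)%N.
Proof.
have PG := pcore_p_sub.
have oG := Lagrange PG; rewrite card_pcore_p // in oG.
have d2q : #|G : P| %| 2 * q.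
  rewrite -p1E -(card_Aut_prime p_pr (card_pcore_p rcN)) -[in X in X %| _]avoid_q_centP.
  by apply: index_cent_Aut; rewrite (subset_trans GN) ?normal_norm ?pcore_holo.
have dq : q %| #|G : P|.
  by move: pq_dvd; rewrite -oG dvdn_pmul2l.
case/dvdnP: dq => k ek; rewrite ek dvdn_pmul2r // in d2q.
have : k \in divisors 2 by rewrite -dvdn_divisors.
rewrite -oG ek !inE => /orP[]/eqP->; first by left; rewrite mul1n.
by right; rewrite mulnCA mulnA.
Qed.

Lemma cent_q_part : (#|'C(G)|`_q)%N = q.
Proof.
have pq_q : ((p * q)`_q)%N = q.
  by rewrite partnM // part_p'nat ?pnatE // part_pnat_id ?pnat_id // mul1n.
have dC := card_cent_dvd point0 trG.
apply/eqP; rewrite eqn_leq -[X in _ <= X]pq_q; apply/andP; split.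
  by rewrite dvdn_leq // partn_dvd // muln_gt0 p_gt0.
have : q %| #|'C(G)|.
  by rewrite -{1}(card_pcore_q rcN) cardSg // centsC avoid_q_cent.
move/(partn_dvd q (cardG_gt0 _)); rewrite part_pnat_id ?pnat_id //.
exact: dvdn_leq.
Qed.

Lemma avoid_q_pcore_q_Sylow : q.-Sylow('C(G)) Q.
Proof. by rewrite pHallE card_pcore_q // cent_q_part centsC avoid_q_cent eqxx. Qed.

End TransitiveInHolomorph.

Section AvoidingQCount.

Variables N G : {group Sn}.
Hypotheses (rcN : reg_cyc N) (trG : perm_transitive G) (GN : G \subset 'N(N)).
Hypothesis QG : ~~ ('O_q(N) \subset G).

Lemma avoid_q_cyc_norm_pcore N' : N' \in cyc_norm G ->
  'O_p(N') = 'O_p(N) /\ ~~ ('O_q(N') \subset G).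
Proof.
move=> N'G; have rcN' := cyc_norm_reg N'G; have /cyc_normP[_ _ _ GN'] := N'G.
split.
  apply/esym/eqP; rewrite eqEcard p_group_sub ?pcore_pgroup //=.
    by rewrite !card_pcore_p.
  by rewrite (subset_trans _ GN') // pcore_p_sub.
apply: contra QG => Q'G; have N'N : N' = N.
  apply: reg_cyc_norm_eq => //; apply: subset_trans GN.
  by rewrite -(pcoreMul rcN') mul_subG // pcore_p_sub.
by rewrite -N'N.
Qed.

(** The p-part of a member of [cyc_norm G] is P, and its q-part is a Sylow
    q-subgroup of 'C(G). All these Sylow subgroups occur, as they are conjugate to
    Q in 'C(G), and conjugation by an element of 'C(G) preserves G. *)
Lemma avoid_q_card_cyc_norm : #|cyc_norm G| = #|'Syl_q('C(G))|.
Proof.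
have inj : {in cyc_norm G &, injective (fun N' : {group Sn} => 'O_q(N')%G)}.
  move=> N1 N2 N1G N2G /(congr1 val) /= eQ; apply: val_inj => /=.
  rewrite -(pcoreMul (cyc_norm_reg N1G)) -(pcoreMul (cyc_norm_reg N2G)) eQ.
  by rewrite (proj1 (avoid_q_cyc_norm_pcore N1G)) (proj1 (avoid_q_cyc_norm_pcore N2G)).
rewrite -(card_in_imset inj); apply: eq_card => S; rewrite inE.
apply/imsetP/idP => [[N' N'G ->]|sylS].
  have [_ Q'G] := avoid_q_cyc_norm_pcore N'G.
  have /cyc_normP[_ _ _ GN'] := N'G.
  exact: avoid_q_pcore_q_Sylow (cyc_norm_reg N'G) trG GN' Q'G.
have sylQ := avoid_q_pcore_q_Sylow rcN trG GN QG.
have [c cC eS] := Sylow_trans sylQ sylS.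
have Gc : (G :^ c)%G = G.
  by apply: val_inj => /=; apply: normP; apply: subsetP cC; apply: cent_sub.
exists (N :^ c)%G; last by apply: val_inj; rewrite /= eS pcoreJ.
rewrite -Gc; apply: cyc_normJ point0 _.
by apply/cyc_normP; case: rcN.
Qed.

(** Here 'C(G) has order q. Its order divides p q, and were it p q, then 'C(G)
    would be transitive, and |G| would divide the order of the centraliser of
    'C(G), hence p q. *)
Lemma avoid_q_large_cyc_norm : #|G| = (2 * p * q)%N -> #|cyc_norm G| = 1%N.
Proof.
move=> oG; rewrite avoid_q_card_cyc_norm.
have sylQ := avoid_q_pcore_q_Sylow rcN trG GN QG.
have dC := card_cent_dvd point0 trG.
have dq : q %| #|'C(G)|.
  by rewrite -{1}(card_pcore_q rcN) cardSg ?(pHall_sub sylQ).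
have oC : #|'C(G)| = q.
  case/dvdnP: dq => k ek; rewrite ek dvdn_pmul2r // in dC.
  case/primeP: p_pr => _ /(_ _ dC)/orP[/eqP k1|/eqP kp]; first by rewrite ek k1 mul1n.
  have trC : perm_transitive 'C(G).
    apply: (semiregular_trans point0) => [y|]; last by rewrite ek kp.
    apply/trivgP/subsetP=> c /setIP[cG /astab1P]; rewrite /= apermE => cy.
    by rewrite (cent_trans_free trG cG cy).
  have : #|G| %| p * q.
    apply: dvdn_trans (card_cent_dvd point0 trC); apply: cardSg.
    by rewrite centsC.
  rewrite oG => /dvdn_leq; rewrite muln_gt0 p_gt0 q_gt0 => /(_ isT).
  by rewrite -mulnA -[X in _ <= X]mul1n leq_pmul2r ?muln_gt0 ?p_gt0.
suff -> : 'Syl_q('C(G)) = [set 'C(G)%G] by rewrite cards1.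
apply/setP=> S; rewrite !inE; apply/idP/eqP => [sylS|->].
  apply/val_inj/eqP; rewrite eqEcard (pHall_sub sylS) /= oC.
  by rewrite (card_Hall sylS) (cent_q_part rcN).
by rewrite pHallE subxx oC part_pnat_id ?pnat_id //=.
Qed.

Lemma avoid_q_not_abelian : ~~ abelian G.
Proof.
apply: contra QG => aG; rewrite -(cent_trans_abelian point0 trG aG).
by rewrite centsC (avoid_q_cent rcN).
Qed.

(** Now 'C(G) is regular, of order p q, and the number of its Sylow q-subgroups is
    1 or p. Were it 1, then Q would be normal in 'C(G), hence central because p
    does not divide q - 1; so 'C(G) would be abelian, and G as well. *)
Lemma avoid_q_small_cyc_norm : #|G| = (p * q)%N -> #|cyc_norm G| = p.
Proof.
move=> oG; rewrite avoid_q_card_cyc_norm.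
have sylQ := avoid_q_pcore_q_Sylow rcN trG GN QG.
have trC := regular_cent_trans point0 trG oG.
have oC : #|'C(G)| = (p * q)%N.
  apply/eqP; rewrite eqn_dvd (card_cent_dvd point0 trG).
  by rewrite (card_trans_stab point0 trC) dvdn_mulr.
have iQ : #|'C(G) : 'O_q(N)| = p.
  by rewrite -divgS ?(pHall_sub sylQ) // oC card_pcore_q // mulnK.
rewrite (card_Syl sylQ).
have : #|'C(G) : 'N_('C(G))('O_q(N))| %| p.
  rewrite -[X in _ %| X]iQ; apply: indexgS.
  by rewrite subsetI (pHall_sub sylQ) normG.
case/primeP: p_pr => _ p_div /p_div/orP[/eqP i1|/eqP //].
case/negP: avoid_q_not_abelian.
have CnQ : 'C(G) \subset 'N('O_q(N)).
  have := indexg_eq1 'C(G) 'N_('C(G))('O_q(N)); rewrite i1 eqxx => /esym.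
  by rewrite subsetI subxx.
have CcQ : 'C(G) \subset 'C('O_q(N)).
  have d1 := index_cent_Aut CnQ; rewrite (card_Aut_prime q_pr) ?card_pcore_q // in d1.
  have d2 : #|'C(G) : 'C_('C(G))('O_q(N))| %| p.
    rewrite -[X in _ %| X]iQ; apply: indexgS; rewrite subsetI (pHall_sub sylQ).
    by have := prime_cyclic; move=> /(_ _ 'O_q(N)%G); rewrite card_pcore_q // => /(_ q_pr)/cyclic_abelian.
  have i2 : #|'C(G) : 'C_('C(G))('O_q(N))| = 1%N.
    case/orP: (p_div _ d2) => /eqP // i2; by move: d1; rewrite i2 (negPf p_ndvd_q1).
  have := indexg_eq1 'C(G) 'C_('C(G))('O_q(N)); rewrite i2 eqxx => /esym.
  by rewrite subsetI subxx.
have aC : abelian 'C(G).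
  apply: cyclic_center_factor_abelian.
  have QZ : 'O_q(N) \subset 'Z('C(G)) by rewrite subsetI (pHall_sub sylQ) centsC.
  have : #|'C(G) / 'Z('C(G))| %| p.
    by rewrite card_quotient ?normal_norm ?center_normal // -[X in _ %| X]iQ indexgS.
  case/p_div/orP => /eqP o; last by apply: prime_cyclic; rewrite o.
  by rewrite (card1_trivg o) cyclic1.
have : G \subset 'C('C(G)) by rewrite centsC.
by rewrite (cent_trans_abelian point0 trC aC).
Qed.

End AvoidingQCount.

Section AvoidingQIso.

Variables N G1 G2 : {group Sn}.
Hypotheses (rcN : reg_cyc N).
Hypotheses (tr1 : perm_transitive G1) (G1N : G1 \subset 'N(N)).
Hypotheses (tr2 : perm_transitive G2) (G2N : G2 \subset 'N(N)).
Hypotheses (QG1 : ~~ ('O_q(N) \subset G1)) (QG2 : ~~ ('O_q(N) \subset G2)).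
Hypothesis o12 : #|G1| = #|G2|.
Local Notation P := 'O_p(N).
Local Notation Q := 'O_q(N).
Local Notation H := 'N(N).

Let avoid_q_mulQ (G : {group Sn}) : perm_transitive G -> G \subset H -> N * G = Q * G.
Proof.
move=> tr GN; rewrite -[X in X * _](pcoreMul rcN) -mulgA.
have cPQ : commute P Q.
  by apply: centC; rewrite (sub_abelian_cent2 (cyclic_abelian (let: And3 _ _ c := rcN in c))) ?pcore_sub.
by rewrite mulgA cPQ -mulgA mulSGid // pcore_p_sub.
Qed.

(** The image of G in 'N(N) / N lies in the cyclic group 'C_H(Q) / N, so it depends
    only on |G|. Hence so does N G = Q G, and G is isomorphic to Q G / Q. *)
Lemma avoid_q_isog : G1 \isog G2.
Proof.
have cyC : cyclic ('C_H(Q) / N).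
  have nP : 'C_H(Q) \subset 'N(P) by rewrite subIset // normal_norm ?pcore_holo.
  have := cyclic_mod_cent _ nP; rewrite card_pcore_p // => /(_ p_pr).
  rewrite (_ : 'C_('C_H(Q))(P) = N) //.
  by rewrite -setIA [_ :&: 'C(P)]setIC cent_pcores //; apply/setIidPr/normG.
have subC (G : {group Sn}) : perm_transitive G -> G \subset H -> ~~ (Q \subset G) ->
    G / N \subset 'C_H(Q) / N.
  by move=> tr GN QG; rewrite quotientS // subsetI GN (avoid_q_cent rcN).
have oq (G : {group Sn}) : perm_transitive G -> G \subset H -> ~~ (Q \subset G) ->
    #|G / N| = (#|G| %/ p)%N.
  move=> tr GN QG; rewrite card_quotient // -indexgI (avoid_q_capN rcN tr GN QG).
  by rewrite -divgS ?pcore_p_sub // card_pcore_p.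
have eN : G1 / N = G2 / N.
  apply/eqP; rewrite (eq_subG_cyclic cyC) ?subC // oq // oq // o12 //.
have eNG : N * G1 = N * G2 by rewrite -!quotientK // eN.
have eQ : G1 / Q = G2 / Q.
  by rewrite -(quotientMidl Q G1) -(quotientMidl Q G2) -!avoid_q_mulQ // eNG.
have nQ (G : {group Sn}) : G \subset H -> G \subset 'N(Q).
  by move=> GN; rewrite (subset_trans GN) ?normal_norm ?pcore_holo.
have iso1 : G1 \isog G1 / Q by rewrite quotient_isog ?nQ // setIC avoid_q_TI.
have iso2 : G2 \isog G2 / Q by rewrite quotient_isog ?nQ // setIC avoid_q_TI.
by apply: isog_trans iso1 _; rewrite /= eQ isog_sym.
Qed.

Let stab_Sylow (G : {group Sn}) (x : 'I_(p * q)) : perm_transitive G -> G \subset H ->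
  ~~ (Q \subset G) -> 2.-Sylow(G) 'C_G[x | 'P].
Proof.
move=> tr GN QG; have oG := card_trans_stab x tr.
have pq0 : 0 < p * q by rewrite muln_gt0 p_gt0.
rewrite pHallE subsetIl oG partnM // part_p'nat // mul1n /=.
have : (#|'C_G[x | 'P]| == 1%N) || (#|'C_G[x | 'P]| == 2).
  have [] := avoid_q_card rcN tr GN QG => /eqP; rewrite oG.
    by rewrite -[X in _ == X]muln1 eqn_pmul2l // => /eqP->; rewrite eqxx.
  have -> : (2 * p * q = p * q * 2)%N by ring.
  by rewrite eqn_pmul2l // => /eqP->; rewrite eqxx orbT.
by case/orP => /eqP ->; rewrite ?partn1 // part_pnat_id ?pnat_id.
Qed.

(** As p q is odd and |G| divides 2 p q, point stabilisers are Sylow 2-subgroups, so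
    that an isomorphism of abstract groups maps a point stabiliser to a conjugate
    of one. *)
Lemma avoid_q_perm_iso : perm_iso G1 G2.
Proof.
have [f f_inj f_im] := isogP avoid_q_isog.
have syl1 : 2.-Sylow(G2) (f @* 'C_G1[point0 | 'P]).
  rewrite -f_im; apply: morphim_pHall; [exact: subsetIl | exact: stab_Sylow].
have syl2 := stab_Sylow point0 tr2 G2N QG2.
have [h hG es] := Sylow_trans syl2 syl1.
exists point0, (h point0), f; split; first exact/isomP.
rewrite [LHS]es; apply/setP=> g; rewrite mem_conjg !mem_stab.
rewrite memJ_norm ?groupV ?(subsetP (normG G2)) //.
rewrite conjgE invgK !permM; congr (_ && _).
by rewrite -(inj_eq (@perm_inj _ h)) permKV.
Qed.

End AvoidingQIso.

Section Existence.

Variable N : {group Sn}.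
Hypothesis rcN : reg_cyc N.
Local Notation P := 'O_p(N).
Local Notation Q := 'O_q(N).
Local Notation H := 'N(N).
Local Notation Hx := 'C_H[point0 | 'P].
Local Notation A := 'C_Hx(Q).
Local Notation B := 'C_Hx(P).

(** Take G = P <[a * sg]>, where a has order m in the cyclic group A and sg generates
    Q. These commute, and q divides m, so that a * sg has order m; as a fixes the
    base point, the powers of a * sg move it like those of sg, and G is transitive.
    If G contained Q, it would contain N and a, and be too large. *)
Lemma avoid_q_exists m : 1 < m -> q %| m -> m %| 2 * q -> exists G : {group Sn},
  [/\ perm_transitive G, G \subset H, ~~ (Q \subset G) & #|G| = (p * m)%N].
Proof.
move=> m1 qm m2q; have [oA _] := card_stabAB rcN point0.
have [a0 eA] := cyclicP (stabA_cyclic rcN point0).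
have [a aA oa] : exists2 a, a \in A & #[a] = m.
  exists (a0 ^+ (2 * q %/ m)); first by rewrite eA mem_cycle.
  have oa0 : #[a0] = (2 * q)%N by rewrite orderE -eA.
  rewrite orderXdiv oa0 ?dvdn_div // divnA // mulKn // muln_gt0 //.
have [sg eQ] : exists s, Q = <[s]>.
  by apply/cyclicP; apply: prime_cyclic; rewrite card_pcore_q.
have os : #[sg] = q by rewrite orderE -eQ card_pcore_q.
have sgQ : sg \in Q by rewrite eQ cycle_id.
have aHx : a \in Hx by case/setIP: aA.
have aH : a \in H by apply: (subsetP (stab_sub N point0)).
have ax : a point0 = point0 by move: aHx; rewrite mem_stab => /andP[_ /eqP].
have cas : commute a sg by case/setIP: aA => _ /centP; apply.
have NH : N \subset H := normG N.
have sgN : sg \in N by apply: (subsetP (pcore_sub q N)).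
pose u := a * sg.
have uX k : u ^+ k = a ^+ k * sg ^+ k by rewrite expgMn.
have aXx k : (a ^+ k) point0 = point0.
  by elim: k => [|k IH]; rewrite ?expg0 ?perm1 // expgS permM ax.
have ou : #[u] = m.
  apply/eqP; rewrite eqn_dvd; apply/andP; split.
    rewrite order_dvdn uX -{1}oa expg_order mul1g -order_dvdn os //.
  rewrite -oa order_dvdn -in_set1 -[[set 1]](stab_capN rcN point0) inE groupX //=.
  have := uX #[u]; rewrite expg_order => /esym/eqP; rewrite mulg_eq1 => /eqP->.
  by rewrite groupV groupX.
have uH : u \in H by rewrite groupM // (subsetP NH).
have uP : <[u]> \subset 'N(P).
  by rewrite cycle_subG (subsetP (normal_norm (pcore_holo N p))).
have PuI : P :&: <[u]> = 1.
  apply: coprime_TIg; rewrite card_pcore_p // -orderE ou prime_coprime //.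
  apply/negP => /dvdn_trans/(_ m2q); rewrite Euclid_dvdM //.
  by rewrite !dvdn_prime2 // (negPf pq_neq) orbF (negPf p_neq2).
exists (P <*> <[u]>)%G; split => /=.
- apply: (perm_transitiveP (x := point0)) => i.
  have [trN _ _] := rcN; have [h hN <-] := transP point0 i trN.
  have : h \in Q * P.
    have -> : Q * P = N; last by [].
    rewrite -[RHS](pcoreMul rcN); apply: centC.
    by rewrite (sub_abelian_cent2 (cyclic_abelian (let: And3 _ _ c := rcN in c))) ?pcore_sub.
  case/mulsgP=> s y; rewrite eQ => /cycleP[k ->] yP ->.
  exists (u ^+ k * y); last by rewrite !permM uX permM aXx.
  apply: groupM; first exact: (subsetP (joing_subr _ _)) (mem_cycle _ _).
  exact: (subsetP (joing_subl _ _)) yP.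
- by rewrite join_subG cycle_subG uH (normal_sub (pcore_holo N p)).
- apply/negP=> QG; set G := P <*> <[u]> in QG.
  have oG : #|G| = (p * m)%N.
    by rewrite /G norm_joinEr // TI_cardMg // card_pcore_p // -orderE ou.
  have NG : N \subset G by rewrite -(pcoreMul rcN) mul_subG ?joing_subl.
  have uG : u \in G by rewrite (subsetP (joing_subr _ _)) ?cycle_id.
  have aG : a \in G by rewrite -[a](mulgK sg) groupM // groupV (subsetP QG).
  have NaI : N :&: <[a]> = 1.
    apply/trivgP; have : <[a]> :&: N \subset Hx :&: N by rewrite setSI ?cycle_subG.
    by rewrite stab_capN // setIC.
  have [_ oN _] := rcN.
  have : #|N * <[a]>| <= #|G| by rewrite subset_leq_card // mul_subG // cycle_subG.
  rewrite TI_cardMg // oN -orderE oa oG -mulnA leq_pmul2l //.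
  by rewrite -[X in _ <= X]mul1n leq_pmul2r ?(ltnW m1) // leqNgt (ltnW q_ge3).
by rewrite norm_joinEr // TI_cardMg // card_pcore_p // -orderE ou.
Qed.

(** Intersecting with the point stabiliser Hx identifies these groups with the
    subgroups of Hx. If a generates A, of order 2 q, and be generates B, of order
    q - 1, then b = a^2 be generates a cyclic subgroup of index 2 of Hx, of order
    q (q - 1) = 2^r q s, which does not contain the involution a^q. So there are
    2 sigma_0(2^r q s) + sigma_0(2^(r - 1) q s) subgroups, that is
    (4 (r + 1) + 2 r) sigma_0(s). *)
Lemma card_between_holo r s : 1 <= r -> odd s -> (q - 1 = 2 ^ r * s)%N ->
  #|[set K : {group Sn} | (N \subset K) && (K \subset H)]|
  = ((6 * r + 4) * size (divisors s))%N.
Proof.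
move=> r1 s_odd q_def.
have HxH := stab_sub N point0; have HxN := stab_mulN rcN point0.
have HxI := stab_capN rcN point0.
pose f (K : {group Sn}) := (K :&: Hx)%G.
have fK (K : {group Sn}) : N \subset K -> K \subset H -> (K :&: Hx) * N = K.
  move=> NK KH; rewrite group_modr // HxN; exact/setIidPl.
have f_inj : {in [set K : {group Sn} | (N \subset K) && (K \subset H)] &, injective f}.
  move=> K1 K2; rewrite !inE => /andP[NK1 K1H] /andP[NK2 K2H] /(congr1 val) /= e.
  by apply: val_inj; rewrite /= -(fK K1) // -(fK K2) // e.
have -> : #|[set K : {group Sn} | (N \subset K) && (K \subset H)]|
    = #|[set T : {group Sn} | T \subset Hx]|.
  rewrite -(card_in_imset f_inj); apply: eq_card => T; rewrite [RHS]inE.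
  apply/imsetP/idP => [[K _ ->]|THx]; first exact: subsetIr.
  have TH := subset_trans THx HxH.
  exists (T <*> N)%G; first by rewrite inE joing_subr join_subG TH normG.
  apply: val_inj; rewrite /= (norm_joinEl TH) -group_modl //.
  by rewrite [N :&: _]setIC HxI mulg1.
have [oA oB] := card_stabAB rcN point0.
have [a eA] := cyclicP (stabA_cyclic rcN point0).
have [be eB] := cyclicP (stabB_cyclic rcN point0).
have oa : #[a] = (2 * q)%N by rewrite orderE -eA.
have ob : #[be] = q.-1 by rewrite orderE -eB.
have aHx : a \in Hx by have : a \in A; [rewrite eA cycle_id | case/setIP].
have bHx : be \in Hx by have : be \in B; [rewrite eB cycle_id | case/setIP].
have aHx' := stab_abelian rcN point0.
pose b := a ^+ 2 * be; pose t := a ^+ q.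
have oa2 : #[a ^+ 2] = q by rewrite orderXdiv oa ?dvdn_mulr // mulKn.
have o_b : #[b] = (q * q.-1)%N.
  rewrite orderM ?oa2 ?ob //; last by rewrite prime_coprime.
  by apply: (centsP aHx') => //; rewrite groupX.
have q1E : q.-1 = (2 ^ r * s)%N by rewrite -q_def subn1.
have even_q1 : 2 %| q.-1 by rewrite q1E dvdn_mulr // dvdn_exp.
have o_t : #[t] = 2 by rewrite orderXdiv oa ?dvdn_mull // mulnK.
have tb : t \notin <[b]>.
  apply/negP=> /cycleP[k]; rewrite expgMn; last by apply: (centsP aHx'); rewrite ?groupX.
  move=> e; have bk : be ^+ k = 1.
    have : be ^+ k \in 'C_A(P).
      rewrite inE; apply/andP; split.
        rewrite eA -[be ^+ k](mulKg ((a ^+ 2) ^+ k)) -e /t -!expgM.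
        by rewrite groupM ?groupV ?mem_cycle.
      have : be ^+ k \in B by rewrite eB mem_cycle.
      by case/setIP.
    by rewrite (stabA_faithful rcN) => /set1P.
  move/eqP: e; rewrite bk mulg1 -expgM /t eq_expg_mod_order oa => /eqP e.
  have := congr1 (fun m => m %% 2) e; rewrite !modn_dvdm ?dvdn_mulr // modnMr modn2.
  by rewrite q_odd.
have even_b : 2 %| #[b] by rewrite o_b dvdn_mull.
have oHx : #|Hx| = (2 * #[b])%N by rewrite card_stab // o_b mulnA.
have bA : b \in Hx by rewrite groupM // groupX.
have tA : t \in Hx by rewrite groupX.
rewrite (card_subgroups_index2 aHx' bA tA o_t tb oHx even_b) o_b.
have s0 : 0 < s by case: (s) s_odd.
have qs0 : 0 < q * s by rewrite muln_gt0 q_gt0.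
have qs : ~~ (q %| s).
  apply: contra q_ndvd_q1 => /dvdn_trans; apply; rewrite q1E dvdn_mull //.
have odd2 : ~~ (2 %| q * s).
  by rewrite Euclid_dvdM // negb_or !dvdn2 !negbK s_odd q_odd.
have e1 : (q * q.-1 = 2 ^ r * (q * s))%N by rewrite q1E mulnCA.
have e2 : (q * q.-1 %/ 2 = 2 ^ r.-1 * (q * s))%N.
  by rewrite e1 -{1}(prednK r1) expnS -mulnA mulKn.
rewrite e2 e1 !size_divisors_coprime_pfactor // prednK //.
have := @size_divisors_coprime_pfactor q 1 s q_pr s0 qs; rewrite expn1 => ->.
by ring.
Qed.

End Existence.

(** The Sylow p-subgroup S of G is normal. As 'C(G) is regular too, it has a Sylow
    subgroup R of order q, and S R is a regular cyclic group. *)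
Lemma regular_cyc_norm G : perm_transitive G -> #|G| = (p * q)%N -> exists N, N \in cyc_norm G.
Proof.
move=> tr oG.
have trC := regular_cent_trans point0 tr oG.
have oC : #|'C(G)| = (p * q)%N.
  apply/eqP; rewrite eqn_dvd (card_cent_dvd point0 tr).
  by rewrite (card_trans_stab point0 trC) dvdn_mulr.
have [S sylS] := Sylow_exists p G; have [R sylR] := Sylow_exists q 'C(G).
have oS : #|S| = p.
  rewrite (card_Hall sylS) oG partnM // part_pnat_id ?pnat_id // part_p'nat ?muln1 // pnatE //.
have oR : #|R| = q.
  rewrite (card_Hall sylR) oC partnM // part_p'nat ?pnatE // part_pnat_id ?pnat_id // mul1n //.
have RC := pHall_sub sylR; have SG := pHall_sub sylS.
have cSR : R \subset 'C(S) by rewrite (subset_trans RC) ?centS.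
have SRI : S :&: R = 1 by apply: coprime_TIg; rewrite oS oR prime_coprime // dvdn_prime2.
have oN : #|S <*> R| = (p * q)%N by rewrite cent_joinEr // TI_cardMg // oS oR.
have cN : cyclic (S <*> R).
  rewrite cent_joinEr // cyclicM //; try by apply: prime_cyclic; rewrite ?oS ?oR.
  by rewrite oS oR prime_coprime // dvdn_prime2.
have GS : G \subset 'N(S).
  have iS : #|G : 'N_G(S)| %| q.
    have iGS : #|G : S| = q by rewrite -divgS // oG oS mulKn.
    by rewrite -[X in _ %| X]iGS indexgS // subsetI SG normG.
  have := card_Syl_mod G p_pr; rewrite (card_Syl sylS).
  have lt : #|G : 'N_G(S)| < p by apply: leq_ltn_trans (dvdn_leq q_gt0 iS) q_lt_p.
  rewrite modn_small // => i1.
  have := indexg_eq1 G 'N_G(S); rewrite i1 eqxx => /esym.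
  by rewrite subsetI subxx.
exists (S <*> R)%G; apply/cyc_normP; split => //=; last first.
  by rewrite normsY // cents_norm // centsC.
apply: (semiregular_trans point0) => // y.
have stS : 'C_S[y | 'P] = 1.
  by apply/trivgP; rewrite -(regular_stab y tr oG) setSI.
have stR : 'C_R[y | 'P] = 1.
  apply/trivgP/subsetP=> c /setIP[cR /astab1P]; rewrite /= apermE => cy.
  by rewrite (cent_trans_free tr (subsetP RC _ cR) cy).
have big (T : {group Sn}) : prime #|T| -> T \subset S <*> R -> 'C_T[y | 'P] = 1 ->
    ~~ (#|T| %| #|'C_(S <*> R)[y | 'P]|).
  move=> T_pr TN st; rewrite (cardSg_cyclic cN) ?subsetIl //.
  apply/negP; rewrite subsetI => /andP[_ Ty].
  by move: T_pr; rewrite -(setIidPl Ty) st cards1.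
have nS := big _ _ (joing_subl S R) stS; have nR := big _ _ (joing_subr S R) stR.
rewrite oS oR in nS nR; have {}nS := nS p_pr; have {}nR := nR q_pr.
apply: card1_trivg; have : #|'C_(S <*> R)[y | 'P]| %| p * q by rewrite -[X in _ %| X]oN cardSg ?subsetIl.
rewrite Gauss_dvdr; last by rewrite coprime_sym prime_coprime.
case/primeP: q_pr => _ q_div /q_div/orP[/eqP //|/eqP e].
by rewrite e dvdnn in nR.
Qed.

(** The group G / P is cyclic of order 2 q. The inverse image in G of its subgroup
    of order q has odd order p q, hence meets trivially the point stabilisers,
    which have order 2. *)
Lemma avoid_q_regular_normal N G : reg_cyc N -> perm_transitive G -> G \subset 'N(N) ->
    ~~ ('O_q(N) \subset G) -> #|G| = (2 * p * q)%N ->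
  exists C : {group Sn}, [/\ perm_transitive C, #|C| = (p * q)%N & C <| G].
Proof.
move=> rcN tr GN QG oG; set P := 'O_p(N).
have nP : G \subset 'N(P) by rewrite (subset_trans GN) ?normal_norm ?pcore_holo.
have PG : P <| G by rewrite /normal pcore_p_sub.
have cy : cyclic (G / P).
  have := cyclic_mod_cent _ nP; rewrite card_pcore_p // => /(_ p_pr).
  by rewrite (avoid_q_centP rcN).
have oq : #|G / P| = (2 * q)%N.
  rewrite card_quotient // -divgS ?pcore_p_sub // card_pcore_p // oG.
  by rewrite -mulnA mulnCA mulKn.
have [c ec] := cyclicP cy; have oc : #[c] = (2 * q)%N by rewrite orderE -ec.
have cX : <[c ^+ 2]> <| G / P.
  by rewrite -sub_abelian_normal ?cyclic_abelian // ec cycle_subG mem_cycle.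
pose C := (coset P @*^-1 <[c ^+ 2]>)%G.
have oC : #|C| = (p * q)%N.
  rewrite card_cosetpre card_pcore_p // -orderE orderXdiv oc ?dvdn_mulr //.
  by rewrite mulKn.
have CG : C <| G by rewrite -(quotientGK PG) cosetpre_normal.
exists C; split=> //; apply: (semiregular_trans point0) => // y.
apply: card1_trivg.
have d2 : #|'C_G[y | 'P]| %| 2.
  have := card_trans_stab y tr; rewrite oG => /eqP.
  have -> : (2 * p * q = p * q * 2)%N by ring.
  by rewrite eqn_pmul2l ?muln_gt0 ?p_gt0 // => /eqP<-.
have dy : #|'C_C[y | 'P]| %| 2.
  by apply: dvdn_trans d2; apply: cardSg; rewrite setSI ?normal_sub.
have dC : #|'C_C[y | 'P]| %| p * q by rewrite -[X in _ %| X]oC cardSg ?subsetIl.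
case/primeP: (isT : prime 2) => _ /(_ _ dy)/orP[/eqP //|/eqP e].
have := odd_pq; rewrite p'natE // => /negP[].
by rewrite -[X in X %| _]e.
Qed.

Section Classification.

Variables r s : nat.
Hypotheses (r_ge1 : 1 <= r) (s_odd : odd s) (q_def : (q - 1 = 2 ^ r * s)%N).
Variable N : {group Sn}.
Hypothesis rcN : reg_cyc N.
Local Notation Q := 'O_q(N).
Local Notation H := 'N(N).

Let realised G := perm_transitive G /\ cyc_norm G != set0.

Let N_tr : perm_transitive N. Proof. by case: rcN. Qed.
Let N_card : #|N| = (p * q)%N. Proof. by case: rcN. Qed.
Let N_cyc : cyclic N. Proof. by case: rcN. Qed.

Let in_holo_cyc_norm G : G \subset H -> N \in cyc_norm G.
Proof. by move=> GH; apply/cyc_normP. Qed.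

Let q_sub_iff G : perm_transitive G -> G \subset H -> (Q \subset G) = (N \subset G).
Proof.
move=> tr GH; apply/idP/idP => [QG|]; last by apply: subset_trans; apply: pcore_sub.
by rewrite -(pcoreMul rcN) mul_subG // (pcore_p_sub rcN).
Qed.

Lemma conj_into_holomorph G : realised G ->
  exists s, perm_transitive (G :^ s)%G /\ (G :^ s)%G \subset H.
Proof.
case=> tr /set0Pn[N1 N1G].
have [tr1 o1 c1] := cyc_norm_reg N1G.
have [t eN] := regular_cyclic_conj point0 tr1 N_tr o1 N_card c1 N_cyc.
exists t; split; first exact: perm_transitiveJ.
have := cyc_normJ t point0 N1G; rewrite -eN.
by case/cyc_normP.
Qed.

(** A permutation that conjugates G1 to G2 maps N to a member of [cyc_norm G2], hence
    to N itself, so it lies in H. As H / N is abelian, it normalises all the groups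
    between N and H. *)
Lemma perm_iso_between_eq G1 G2 : perm_transitive G1 -> perm_transitive G2 ->
    G1 \subset H -> G2 \subset H -> N \subset G1 -> perm_iso G1 G2 -> G1 = G2.
Proof.
move=> tr1 tr2 G1H G2H NG1 /(perm_isoP point0 tr1 tr2)[t e2].
have NtG2 : (N :^ t)%G \in cyc_norm G2 by rewrite e2 cyc_normJ // in_holo_cyc_norm.
have Nt : (N :^ t)%G = N.
  apply: reg_cyc_norm_eq => //; first exact: cyc_norm_reg NtG2.
  by apply: subset_trans G2H; rewrite e2 /= conjSg.
have tH : t \in H by apply/normP; rewrite -[in RHS]Nt.
apply/val_inj/eqP; rewrite /= eq_sym eqEcard; apply/andP; split; last first.
  by rewrite e2 /= cardJg.
rewrite e2 /=; apply/subsetP=> _ /imsetP[g gG ->].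
rewrite conjg_mulR groupM // (subsetP NG1) //.
by apply: (comm_norm_reg rcN) => //; apply: (subsetP G1H).
Qed.

Variables Gn G2 : {group Sn}.
Hypotheses (Gn_tr : perm_transitive Gn) (GnH : Gn \subset H) (QGn : ~~ (Q \subset Gn)).
Hypothesis Gn_card : #|Gn| = (p * q)%N.
Hypotheses (G2_tr : perm_transitive G2) (G2H : G2 \subset H) (QG2 : ~~ (Q \subset G2)).
Hypothesis G2_card : #|G2| = (2 * p * q)%N.

Let S1 := [set K : {group Sn} | (N \subset K) && (K \subset H)].

Lemma num_perm_classes :
  num_classes (@perm_iso (p * q)) realised ((6 * r + 4) * size (divisors s) + 2).
Proof.
pose D := S1 :|: [set Gn; G2].
have DP G : G \in D -> perm_transitive G /\ G \subset H.
  case/setUP=> [|/set2P[]->] //; rewrite inE => /andP[NG GH]; split=> //.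
  exact: perm_transitiveS point0 N_tr NG.
have n12 : Gn != G2.
  apply/eqP=> /(congr1 (fun G : {group Sn} => #|G|)); rewrite Gn_card G2_card.
  by rewrite -mulnA => /eqP; rewrite -[X in X == _]mul1n eqn_pmul2r // muln_gt0 p_gt0.
have disj : S1 :&: [set Gn; G2] = set0.
  apply/setP=> G; rewrite !inE; apply/negbTE/negP=> /andP[/andP[NG _]].
  by case/orP=> /eqP e; move: NG; rewrite e -q_sub_iff // ?(negPf QGn) ?(negPf QG2).
have <- : #|D| = ((6 * r + 4) * size (divisors s) + 2)%N.
  by rewrite cardsU disj cards0 subn0 cards2 n12 (card_between_holo rcN r_ge1 s_odd q_def).
apply: num_classes_card => [G /DP[tr GH]|G1 G1' D1 D2 iso|G Greal].
- by split=> //; apply/set0Pn; exists N; apply: in_holo_cyc_norm.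
- have [tr1 G1H] := DP _ D1; have [tr2 G2H'] := DP _ D2.
  case/setUP: (D1) => [|D1'].
    by rewrite inE => /andP[NG _]; apply: perm_iso_between_eq.
  case/setUP: (D2) => [|D2'].
    rewrite inE => /andP[NG _]; apply/esym/perm_iso_between_eq => //.
    exact: perm_iso_sym point0 tr1 tr2 iso.
  have [t e] := proj1 (perm_isoP point0 tr1 tr2) iso.
  have o12 : #|G1| = #|G1'| by rewrite e cardJg.
  have o_neq : (p * q == 2 * p * q)%N = false.
    by rewrite -mulnA -[X in X == _]mul1n eqn_pmul2r // muln_gt0 p_gt0.
  move: o12 D1' D2'; rewrite !inE => o12 /orP[]/eqP e1 /orP[]/eqP e2; rewrite e1 e2 //.
    by move/eqP: o12; rewrite e1 e2 Gn_card G2_card o_neq.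
  by move/eqP: o12; rewrite e1 e2 Gn_card G2_card eq_sym o_neq.
have [trG _] := Greal; have [t [trt GtH]] := conj_into_holomorph Greal.
have isot : perm_iso G (G :^ t)%G by apply: perm_isoJ point0 _.
have [QG|QG] := boolP (Q \subset (G :^ t)%G).
  exists (G :^ t)%G => //; apply/setUP; left; rewrite inE GtH andbT.
  by rewrite -q_sub_iff.
have [oG|oG] := avoid_q_card rcN trt GtH QG.
  exists Gn; first by rewrite !inE eqxx orbT.
  apply: (perm_iso_trans point0 trG trt Gn_tr isot).
  by apply: (avoid_q_perm_iso rcN); rewrite ?oG.
exists G2; first by rewrite !inE eqxx !orbT.
apply: (perm_iso_trans point0 trG trt G2_tr isot).
by apply: (avoid_q_perm_iso rcN); rewrite ?oG.
Qed.

Lemma regular_perm_iso G : perm_transitive G -> #|G| = (p * q)%N ->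
  perm_iso G N \/ perm_iso G Gn.
Proof.
move=> trG oG; have [N1 N1G] := regular_cyc_norm trG oG.
have Greal : realised G by split=> //; apply/set0Pn; exists N1.
have [t [trt GtH]] := conj_into_holomorph Greal.
have isot : perm_iso G (G :^ t)%G by apply: perm_isoJ point0 _.
have [QG|QG] := boolP (Q \subset (G :^ t)%G).
  left; suff <- : (G :^ t)%G = N by [].
  apply/val_inj/eqP; rewrite /= eq_sym eqEcard cardJg oG N_card leqnn andbT.
  by move: QG; rewrite q_sub_iff.
right; apply: (perm_iso_trans point0 trG trt Gn_tr isot).
by apply: (avoid_q_perm_iso rcN); rewrite ?cardJg ?oG.
Qed.

Lemma nonregular_unique G : realised G -> ~ perm_iso G N -> ~ perm_iso G Gn ->
  #|cyc_norm G| = 1%N /\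
  exists C : {group Sn}, [/\ perm_transitive C, #|C| = (p * q)%N & C <| G].
Proof.
move=> Greal GN GGn; have [trG _] := Greal.
have [t [trt GtH]] := conj_into_holomorph Greal.
have isot : perm_iso G (G :^ t)%G by apply: perm_isoJ point0 _.
suff [c1 [C [trC oC CG]]] : #|cyc_norm (G :^ t)%G| = 1%N /\
    exists C : {group Sn}, [/\ perm_transitive C, #|C| = (p * q)%N & C <| (G :^ t)%G].
  split; first by rewrite -(card_cyc_normJ G t point0).
  exists (C :^ t^-1)%G; split; [exact: perm_transitiveJ | by rewrite cardJg |].
  by rewrite -(normalJ _ _ t) /= -conjsgM mulVg conjsg1.
have [QG|QG] := boolP (Q \subset (G :^ t)%G).
  split; first by rewrite (cyc_norm_super rcN trt GtH QG) cards1.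
  exists N; split=> //; rewrite /normal GtH andbT.
  by move: QG; rewrite q_sub_iff.
have [oG|oG] := avoid_q_card rcN trt GtH QG; last first.
  split; first exact: avoid_q_large_cyc_norm rcN trt GtH QG oG.
  exact: avoid_q_regular_normal rcN trt GtH QG oG.
case: GGn; apply: (perm_iso_trans point0 trG trt Gn_tr isot).
by apply: (avoid_q_perm_iso rcN); rewrite ?oG.
Qed.

End Classification.

End SophieGermain.

(** * Hopf-Galois structures of cyclic type in degree pq *)

Local Close Scope group_scope.

Lemma num_classes_iff (T : Type) (R : T -> T -> Prop) (P P' : T -> Prop) k :
  (forall y, P y <-> P' y) -> num_classes R P' k -> num_classes R P k.
Proof.
move=> PP' [x [xP xinj xcov]]; exists x; split=> // [i|y /PP'/xcov//].
exact/PP'/xP.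
Qed.

Theorem theorem4p4 (p q r s : nat)
    (q_ge3 : 3 <= q) (q_prime : prime q) (p_prime : prime p)
    (p_def : p = 2 * q + 1)
    (r_ge1 : 1 <= r) (s_odd : odd s) (q_def : q - 1 = 2 ^ r * s) :
  num_classes (@perm_iso (p * q))
    (realised_by_type (p * q) (cyclic_group (p * q)))
    ((6 * r + 4) * size (divisors s) + 2)
  /\
  exists Gc Gn : {group 'S_(p * q)},
    [/\ [/\ regular_on [set: 'I_(p * q)] Gc, cyclic Gc
          & realised_by_type (p * q) (cyclic_group (p * q)) Gc],
        [/\ regular_on [set: 'I_(p * q)] Gn, ~~ abelian Gn
          & realised_by_type (p * q) (cyclic_group (p * q)) Gn],
        forall G : {group 'S_(p * q)}, regular_on [set: 'I_(p * q)] G ->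
          perm_iso G Gc \/ perm_iso G Gn,
        (forall (K : fieldType) (E : splittingFieldType K) (L : {subfield E}),
           realises L Gc -> num_hopf_galois L (cyclic_group (p * q)) 1)
        /\ (forall (K : fieldType) (E : splittingFieldType K)
              (L : {subfield E}),
              realises L Gn -> num_hopf_galois L (cyclic_group (p * q)) p)
      & forall G : {group 'S_(p * q)},
          realised_by_type (p * q) (cyclic_group (p * q)) G ->
          ~ perm_iso G Gc -> ~ perm_iso G Gn ->
          forall (K : fieldType) (E : splittingFieldType K) (L : {subfield E}),
            realises L G ->
            almost_classically_galois L
            /\ num_hopf_galois L (cyclic_group (p * q)) 1].
Proof.
have pq_gt1 : 1 < p * q by rewrite (leq_trans (prime_gt1 p_prime)) ?leq_pmulr ?prime_gt0.
have [N rcN] := reg_cyc_exists (ltnW pq_gt1).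
have [N_tr oN N_cyc] := rcN.
have [Gn [Gn_tr GnN QGn oGn]] :=
  avoid_q_exists p_prime q_prime q_ge3 p_def rcN (prime_gt1 q_prime) (dvdnn q) (dvdn_mull 2 (dvdnn q)).
have q2 : 1 < 2 * q by rewrite (leq_trans (prime_gt1 q_prime)) ?leq_pmull.
have [G2 [G2_tr G2N QG2 oG2]] :=
  avoid_q_exists p_prime q_prime q_ge3 p_def rcN q2 (dvdn_mull 2 (dvdnn q)) (dvdnn _).
have {}oG2 : #|G2| = 2 * p * q by rewrite oG2 mulnCA mulnA.
have realised G : realised_by_type (p * q) (cyclic_group (p * q)) G <->
    perm_transitive G /\ cyc_norm G != set0.
  move: (p * q) pq_gt1 G => [|[|n]] // _ G; exact: realised_by_cyclicP.
have count G K (E : splittingFieldType K) (L : {subfield E}) : perm_transitive G ->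
    realises L G -> num_hopf_galois L (cyclic_group (p * q)) #|@cyc_norm (p * q) G|.
  move: (p * q) pq_gt1 G => [|[|n]] // _ G; exact: realises_num_hopf_galois.
have regular (G : {group 'S_(p * q)}) : regular_on [set: 'I_(p * q)] G <->
    perm_transitive G /\ #|G| = p * q.
  move: (p * q) pq_gt1 G => [|[|n]] // _ G.
  split=> [/regular_onTP/andP[tr /eqP oG] //|[tr oG]].
  by apply/regular_onTP; rewrite oG eqxx andbT.
have almost (G C : {group 'S_(p * q)}) K (E : splittingFieldType K) (L : {subfield E}) :
    perm_transitive G -> realises L G -> perm_transitive C -> #|C| = p * q ->
    (C <| G)%g -> almost_classically_galois L.
  move: (p * q) pq_gt1 G C => [|[|n]] // _ G C.
  by move=> tr LG trC oC; apply: realises_almost_classical tr LG C trC oC.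
have holo (G : {group 'S_(p * q)}) : perm_transitive G -> G \subset 'N(N)%g ->
    realised_by_type (p * q) (cyclic_group (p * q)) G.
  move=> tr GN; apply/realised; split=> //; apply/set0Pn; exists N.
  exact/cyc_normP.
split.
  apply: num_classes_iff realised _.
  exact: (num_perm_classes p_prime q_prime q_ge3 p_def r_ge1 s_odd q_def rcN
    Gn_tr GnN QGn oGn G2_tr G2N QG2 oG2).
exists N, Gn; split.
- split=> //; first by apply/regular.
  by apply: holo; rewrite ?normG.
- split; [by apply/regular; split | | exact: holo].
  exact: (avoid_q_not_abelian p_prime q_prime q_ge3 p_def rcN Gn_tr GnN QGn).
- by move=> G /regular[tr oG]; exact: (regular_perm_iso p_prime q_prime q_ge3 p_def rcN Gn_tr GnN QGn oGn tr oG).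
- split=> K E L LG.
    have := count N K E L N_tr LG.
    have QN : ('O_q(N) \subset N)%g := pcore_sub q N.
    by rewrite (cyc_norm_super p_prime q_prime q_ge3 p_def rcN N_tr (normG N) QN) cards1.
  have := count Gn K E L Gn_tr LG.
  by rewrite (avoid_q_small_cyc_norm p_prime q_prime q_ge3 p_def rcN Gn_tr GnN QGn oGn).
move=> G /realised GP GN GGn K E L LG.
have [c1 [C [C_tr oC CG]]] := nonregular_unique p_prime q_prime q_ge3 p_def rcN Gn_tr GnN QGn oGn GP GN GGn.
have [tr _] := GP.
by split; [apply: almost tr LG C_tr oC CG | rewrite -c1; apply: count].
Qed.
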